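(* Let $\Omega\subset\mathbb{C}^d$ be a bounded convex domain with $C^\infty$ boundary. If there exist $o\in\Omega$, $x\in\partial\Omega$, $M\ge 0$ and $T\in\mathbb{R}$ such that $$\{x+e^{-2t}n_x : t>T\}\subset \mathrm{Aut}(\Omega)\cdot\{p\in\Omega : K_\Omega(p,o)\le M\},$$ then $x$ has finite type in the sense of D'Angelo.
   Context: $\mathrm{Aut}(\Omega)$ is the group of biholomorphisms of $\Omega$; for $B\subset\Omega$, $\mathrm{Aut}(\Omega)\cdot B=\bigcup_{\varphi\in\mathrm{Aut}(\Omega)}\varphi(B)$. $K_\Omega$ is the Kobayashi distance. $n_x$ is the inward pointing unit normal vector to $\partial\Omega$ at $x$. With $r$ a smooth defining function of $\Omega$ near $x$ ($\nabla r\neq 0$), $x$ has finite type in the sense of D'Angelo if $\sup_\gamma \nu(r\circ\gamma)/\nu(\gamma-x)<\infty$, where the supremum is over non-constant holomorphic germs $\gamma:(\mathbb{C},0)\to(\mathbb{C}^d,x)$ and $\nu$ is the order of vanishing at $0$. *)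

(* Defs.v *)
From HB Require Import structures.
From mathcomp Require Import all_boot all_order all_algebra.
From mathcomp Require Import all_classical all_reals all_analysis.
From mathcomp Require Import complex.

Set Implicit Arguments.
Unset Strict Implicit.
Unset Printing Implicit Defensive.

Import Order.TTheory GRing.Theory Num.Theory.
Import numFieldNormedType.Exports.

Local Open Scope classical_set_scope.
Local Open Scope complex_scope.
Local Open Scope ring_scope.

(* The numFieldType R[i] has no topology by default: give it the one of its
   norm, so that R[i] and 'rV[R[i]]_d are normed modules over R[i]. *)
HB.instance Definition _ (R : realType) := NormedModule.copy R[i] R[i]^o.

Definition is_domain (T : topologicalType) (A : set T) : Prop :=
  [/\ open A, A !=set0 & connected A].

Definition boundary (T : topologicalType) (A : set T) : set T :=
  closure A `\` interior A.

(* Differentiability is over the field R[i], hence it is complex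
   differentiability. *)
Definition holomorphic_on (R : realType) (V W : normedModType R[i])
    (U : set V) (f : V -> W) : Prop :=
  forall z, U z -> differentiable f z.

(* An automorphism of Omega is represented by any map of the ambient space
   whose restriction to Omega is a biholomorphism of Omega. *)
Definition Aut (R : realType) (V : normedModType R[i]) (Omega : set V) :
    set (V -> V) :=
  [set phi | holomorphic_on Omega phi /\ set_fun Omega Omega phi /\
    exists psi : V -> V,
      [/\ holomorphic_on Omega psi, set_fun Omega Omega psi,
          {in Omega, cancel phi psi} & {in Omega, cancel psi phi}]].

Definition Aut_orbit (R : realType) (V : normedModType R[i])
    (Omega B : set V) : set V :=
  \bigcup_(phi in Aut Omega) (phi @` B).

Section Kobayashi.
Context (R : realType) (V : normedModType R[i]).

Definition unit_disc : set R[i] := [set z | `|z| < 1].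

(* artanh |(a - b) / (1 - conj(b) a)|: the Poincare metric is normalized as
   |dz| / (1 - |z|^2). *)
Definition poincare_dist (a b : R[i]) : R :=
  let rho := complex.Re `|(a - b) / (1 - b^*%C * a)| in
  ln ((1 + rho) / (1 - rho)) / 2.

Definition disc_link (Omega : set V) (p q : V) (l : R) : Prop :=
  exists (f : R[i] -> V) (a b : R[i]),
    [/\ holomorphic_on unit_disc f, f @` unit_disc `<=` Omega,
        unit_disc a /\ unit_disc b, f a = p /\ f b = q &
        l = poincare_dist a b].

(* Infimum of the lengths of the chains of holomorphic discs from x to y. *)
Definition kobayashi_dist (Omega : set V) (x y : V) : \bar R :=
  ereal_inf [set L%:E | L in [set L : R |
    exists (n : nat) (p : nat -> V) (l : nat -> R),
      [/\ p 0%N = x, p n = y,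
          (forall i, (i < n)%N -> disc_link Omega (p i) (p i.+1) (l i)) &
          L = \sum_(i < n) l i]]].

End Kobayashi.

Section RealSmooth.
Context (R : realType) (V : normedModType R[i]).

Definition real_line (z v : V) (t : R) : V := z + t%:C *: v.

Definition real_derive (f : V -> R) (v : V) : V -> R :=
  fun z => derive1 (f \o real_line z v) 0.

Definition iter_real_derive (f : V -> R) (vs : seq V) : V -> R :=
  foldl real_derive f vs.

Definition smooth_on (U : set V) (f : V -> R) : Prop :=
  forall (vs : seq V) (z : V), U z ->
    {for z, continuous (iter_real_derive f vs)} /\
    (forall v, derivable (iter_real_derive f vs \o real_line z v) 0 1).

End RealSmooth.

Section SmoothBoundary.
Context (R : realType) (d : nat).
Implicit Types (Omega : set 'rV[R[i]]_d) (x n : 'rV[R[i]]_d).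

(* Gradient for the real inner product of C^d = R^2d: the j-th entry is
   dr/dx_j + i dr/dy_j. *)
Definition gradient (r : 'rV[R[i]]_d -> R) (z : 'rV[R[i]]_d) : 'rV[R[i]]_d :=
  \row_j (real_derive r (delta_mx 0 j) z +i*
          real_derive r ((0 +i* 1) *: delta_mx 0 j) z).

(* The norm of 'rV[R[i]]_d is the sup norm; unit normals need this one. *)
Definition euclidean_norm (v : 'rV[R[i]]_d) : R :=
  Num.sqrt (\sum_j (complex.Re (v 0 j) ^+ 2 + complex.Im (v 0 j) ^+ 2)).

Definition defining_function Omega x (r : 'rV[R[i]]_d -> R) : Prop :=
  exists U : set 'rV[R[i]]_d,
    [/\ open_nbhs x U, smooth_on U r,
        (forall z, U z -> (Omega z <-> r z < 0)) &
        (forall z, U z -> gradient r z != 0)].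

Definition smooth_boundary Omega : Prop :=
  forall y, boundary Omega y -> exists r, defining_function Omega y r.

Definition inward_unit_normal Omega x n : Prop :=
  exists2 r, defining_function Omega x r &
    n = - ((euclidean_norm (gradient r x))^-1%:C *: gradient r x).

End SmoothBoundary.

Section FiniteType.
Context (R : realType) (d : nat).

(* Supremum of the n such that the terms of degree < n of the Taylor expansion
   vanish, where T k says that those of degree k vanish. *)
Definition order_of_vanishing (T : nat -> Prop) : \bar R :=
  ereal_sup [set n%:R%:E | n in [set n : nat | forall k, (k < n)%N -> T k]].

Definition real_order (f : R[i] -> R) : \bar R :=
  order_of_vanishing (fun k =>
    forall vs : seq R[i], size vs = k -> iter_real_derive f vs 0 = 0).

Definition holomorphic_order (g : R[i] -> 'rV[R[i]]_d) : \bar R :=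
  order_of_vanishing (fun k => derive1n k g 0 = 0).

(* Representatives of the non-constant germs (C, 0) -> (C^d, x). *)
Definition nonconstant_germ (x : 'rV[R[i]]_d) (g : R[i] -> 'rV[R[i]]_d) :
    Prop :=
  [/\ g 0 = x, (\forall z \near (0 : R[i]), differentiable g z) &
      ~ (\forall z \near (0 : R[i]), g z = x)].

Definition contact_order (r : 'rV[R[i]]_d -> R) (x : 'rV[R[i]]_d)
    (g : R[i] -> 'rV[R[i]]_d) : \bar R :=
  (real_order (r \o g) / holomorphic_order (fun z => (g z - x)%R))%E.

(* The supremum does not depend on the defining function r. *)
Definition finite_type (Omega : set 'rV[R[i]]_d) (x : 'rV[R[i]]_d) : Prop :=
  forall r, defining_function Omega x r ->
    (ereal_sup [set contact_order r x g | g in nonconstant_germ x] < +oo)%E.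

End FiniteType.

(* Main.v *)
(* Every boundary point y carries a unit normal nu y and a ball of fixed radius r0
   in Omega tangent to the boundary at y; hence normals at nearby boundary points
   are close, and z |-> <z - y, nu y> is holomorphic with positive real part on
   Omega. Harnack's inequality for such functions turns the bound on the Kobayashi
   distance into automorphisms moving the points x + dl n to points which are the
   centre of a ball of fixed radius c0 in Omega.

   Suppose that an affine disc in direction v around x + dl n does not grow by a
   fixed factor when dl is multiplied by a fixed A. Then Omega contains, around
   some x + s n, a long chain of points of the bidisc (u, w) |->
   x + s (1 + u) / (1 - u) n + w v at which a functional in w and one in u decay
   geometrically. After the automorphism the chain converges to the boundary, along
   it the supporting hyperplanes hardly turn, and the maximum principle in u
   bounds c0 by a quantity which is too small. Iterating the growth, every
   holomorphic disc f in Omega with f 0 = x + dl n satisfies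
   |f w - f 0| ^ m <= C dl for |w| <= 1/2.

   If g - x vanishes to order a and r o g to order b, then w |-> g (t w) + K t^b n
   is such a disc for small t, so t ^ (a m) = O(t ^ b) and b / a <= m.

   Cauchy's formula is obtained from midpoint sums over dyadic squares rather than
   from integrals. *)

Require Import Defs.
From HB Require Import structures.
From mathcomp Require Import all_boot all_order all_algebra.
From mathcomp Require Import all_classical all_reals all_analysis.
From mathcomp Require Import complex.
From mathcomp Require Import ring lra zify.

Set Implicit Arguments.
Unset Strict Implicit.
Unset Printing Implicit Defensive.

Import Order.TTheory GRing.Theory Num.Theory.
Import numFieldNormedType.Exports.

Local Open Scope classical_set_scope.
Local Open Scope complex_scope.
Local Open Scope ring_scope.

(** Automorphisms of [Omega] need not extend to the boundary and respect neither convexity nor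
    hyperplanes. What they do transport is the class [pos_hol] of holomorphic functions with
    positive real part, and Harnack's inequality turns smallness of one such function, relative to
    its value at the centre of a ball in [Omega], into closeness to the boundary. This is why
    functionals are pulled back before they are compared. The chain runs from a point with [u] near
    the unit circle and [w = 0] to a point with [u = 0] and [w] near the circle. At each of its
    points one coordinate is close enough to its circle for one of the two functionals to be small.
    The last point is the same for all starting points, so a single supporting hyperplane serves the
    whole circle of [u], as the maximum principle requires. The numbers balance: [6 j + 12] links
    give smallness of order [8^-j], which beats the Harnack constant [5^j] and leaves distances to
    the boundary of order [l^j]; the total turning of the hyperplanes, of order [j l^(j/2)], then
    tends to 0. *)

Lemma geometric_small (R : realType) (a l e : R) : 0 <= l < 1 -> 0 < e ->
  exists N, forall n, (N <= n)%N -> a * l ^+ n < e.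
Proof.
move=> /andP[l0 l1] e0.
have l1' : `|l| < 1 by rewrite ger0_norm.
have := cvgr0_norm_lt (fun _ => _ : R^o) (cvg_geometric a l1') e e0.
case=> N _ NP; exists N => n Nn.
by apply: le_lt_trans (NP n Nn); rewrite ler_norm.
Qed.

(** * The modulus with real values, and complex differentiability in terms of it *)

Section ComplexModulus.
Variable R : realType.
Implicit Types z w h : R[i].

(** The norm of [R[i]] takes its values in [R[i]]; with its real part all estimates take place in
    the ordered field [R]. *)
Definition modc z : R := complex.Re `|z|.

Lemma normc_modc z : `|z| = (modc z)%:C.
Proof. by rewrite /modc normc_def. Qed.

Lemma modc_ge0 z : 0 <= modc z.
Proof. by rewrite -lecR -normc_modc; exact: normr_ge0. Qed.

Lemma modcM z w : modc (z * w) = modc z * modc w.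
Proof. by apply: complexI; rewrite rmorphM /= -!normc_modc normrM. Qed.

Lemma modcD z w : modc (z + w) <= modc z + modc w.
Proof. by rewrite -lecR rmorphD /= -!normc_modc ler_normD. Qed.

Lemma modcN z : modc (- z) = modc z.
Proof. by rewrite /modc normrN. Qed.

Lemma modcB z w : modc (z - w) <= modc z + modc w.
Proof. by rewrite -(modcN w) modcD. Qed.

Lemma modc_distC z w : modc (z - w) = modc (w - z).
Proof. by rewrite -modcN opprB. Qed.

Lemma modcV z : modc z^-1 = (modc z)^-1.
Proof. by apply: complexI; rewrite fmorphV /= -!normc_modc normfV. Qed.

Lemma modcX z n : modc (z ^+ n) = modc z ^+ n.
Proof. by apply: complexI; rewrite rmorphXn /= -!normc_modc normrX. Qed.

Lemma modc0 : modc 0 = 0.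
Proof. by rewrite /modc normr0. Qed.

Lemma modc1 : modc 1 = 1.
Proof. by rewrite /modc normr1. Qed.

Lemma modc_eq0 z : (modc z == 0) = (z == 0).
Proof.
apply/eqP/eqP => [z0|->]; last exact: modc0.
by apply/eqP; rewrite -normr_eq0 normc_modc z0.
Qed.

Lemma modc_gt0 z : (0 < modc z) = (z != 0).
Proof. by rewrite lt_def modc_eq0 modc_ge0 andbT. Qed.

Lemma modc_real (x : R) : modc x%:C = `|x|.
Proof. by rewrite /modc normc_def /= expr0n addr0 sqrtr_sqr. Qed.

Lemma modci : modc 'i = 1.
Proof. by rewrite /modc normc_def /= expr0n add0r expr1n sqrtr1. Qed.

Lemma modc_sqr z : modc z ^+ 2 = complex.Re z ^+ 2 + complex.Im z ^+ 2.
Proof. by rewrite /modc normc_def /= sqr_sqrtr // addr_ge0 ?sqr_ge0. Qed.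

Lemma normr_Re_le z : `|complex.Re z| <= modc z.
Proof.
rewrite -(@ler_pXn2r _ 2) ?nnegrE ?modc_ge0 // real_normK ?num_real //.
by rewrite modc_sqr lerDl sqr_ge0.
Qed.

Lemma normr_Im_le z : `|complex.Im z| <= modc z.
Proof.
rewrite -(@ler_pXn2r _ 2) ?nnegrE ?modc_ge0 // real_normK ?num_real //.
by rewrite modc_sqr lerDr sqr_ge0.
Qed.

Lemma modc_le_ReIm z : modc z <= `|complex.Re z| + `|complex.Im z|.
Proof.
rewrite [in X in X <= _](complexE z) (le_trans (modcD _ _)) //.
by rewrite modcM modci mul1r !modc_real.
Qed.

Lemma modc_conj z : modc z^*%C = modc z.
Proof. by rewrite /modc normcJ. Qed.

Lemma cReD z w : complex.Re (z + w) = complex.Re z + complex.Re w.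
Proof. by case: z; case: w. Qed.

Lemma cReN z : complex.Re (- z) = - complex.Re z.
Proof. by case: z. Qed.

Lemma cReB z w : complex.Re (z - w) = complex.Re z - complex.Re w.
Proof. by rewrite cReD cReN. Qed.

Lemma cImD z w : complex.Im (z + w) = complex.Im z + complex.Im w.
Proof. by case: z; case: w. Qed.

Lemma cImN z : complex.Im (- z) = - complex.Im z.
Proof. by case: z. Qed.

Lemma cImB z w : complex.Im (z - w) = complex.Im z - complex.Im w.
Proof. by rewrite cImD cImN. Qed.

Lemma cReM z w : complex.Re (z * w) =
  complex.Re z * complex.Re w - complex.Im z * complex.Im w.
Proof. by case: z; case: w. Qed.

Lemma cImM z w : complex.Im (z * w) =
  complex.Re z * complex.Im w + complex.Im z * complex.Re w.
Proof. by case: z => a b; case: w => c e /=; rewrite [b * c]mulrC. Qed.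

Lemma cReZ (x : R) z : complex.Re (x%:C * z) = x * complex.Re z.
Proof. by rewrite cReM /= mul0r subr0. Qed.

Lemma cImZ (x : R) z : complex.Im (x%:C * z) = x * complex.Im z.
Proof. by rewrite cImM /= mul0r addr0. Qed.

Lemma Re_le_modc z : complex.Re z <= modc z.
Proof. exact: le_trans (ler_norm _) (normr_Re_le z). Qed.

Lemma near_modcP w (P : R[i] -> Prop) :
  (\forall z \near w, P z) <->
  exists2 e : R, 0 < e & forall h, modc h < e -> P (w + h).
Proof.
split=> [/nbhs_normP[/= e e0 eP]|[e e0 eP]].
  have eE : e = (complex.Re e)%:C.
    by move: e0; rewrite ltcE /=; case: e {eP} => a b /= /andP[/eqP-> _].
  exists (complex.Re e); first by rewrite eE ltcR in e0.
  by move=> h he; apply: eP; rewrite /= opprD addNKr normrN normc_modc eE ltcR.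
apply/nbhs_normP; exists e%:C; rewrite /= ?ltcR // => z /=.
rewrite normc_modc ltcR modc_distC => /eP; by rewrite addrC subrK.
Qed.

(** Differentiability without a quotient: [h = 0] is no special case, and errors can be added
    directly. *)
Definition cdiff (f : R[i] -> R[i]) z (l : R[i]) :=
  forall e : R, 0 < e -> exists2 d : R, 0 < d &
    forall h, modc h < d -> modc (f (z + h) - f z - l * h) <= e * modc h.

Lemma cdiffP f z : differentiable f z <-> exists l, cdiff f z l.
Proof.
split=> [/derivable1_diffP|[l fl]].
  rewrite /derivable => /cvg_ex[l fl]; exists l => e e0.
  have /fl : nbhs l [set y : R[i] | modc (y - l) < e].
    by apply/near_modcP; exists e => // h he /=; rewrite addrC addKr.
  rewrite /= /dnbhs /within /= => /near_modcP[d d0 dP]; exists d => // h hd.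
  have [->|h0] := eqVneq h 0.
    by rewrite addr0 subrr mulr0 subrr modc0 mulr0.
  have := dP h hd; rewrite add0r => /(_ h0) /= /ltW.
  rewrite /GRing.scale /= mulr1 -[X in _ -> _ <= e * X]/(modc h) => he.
  rewrite -(ler_pdivrMr _ _ (_ : 0 < modc h)) ?modc_gt0 //.
  apply: le_trans he; rewrite -modcV -modcM mulrBl mulfK // [h + z]addrC.
  by rewrite [_ * h^-1]mulrC.
apply/derivable1_diffP; apply/cvg_ex; exists l => A /= /near_modcP[e e0 eA].
have e20 : 0 < e / 2 by rewrite divr_gt0.
have [d d0 dP] := fl _ e20.
rewrite /dnbhs /within /=; apply/near_modcP; exists d => // h hd.
rewrite add0r => h0 /=; rewrite -(subrK l (_ *: _)) addrC; apply: eA.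
apply: (@le_lt_trans _ _ (e / 2)); last by rewrite ltr_pdivrMr // ltr_pMr ?ltr1n.
have := dP h hd; rewrite -ler_pdivrMr ?modc_gt0 //; apply: le_trans.
rewrite -modcV -modcM mulrBl mulfK // /GRing.scale /= mulr1 [h + z]addrC.
by rewrite [_ * h^-1]mulrC.
Qed.

End ComplexModulus.

(** * Goursat's theorem *)

Section SquareCousin.
Variable R : realType.

(** Bisection: if [P] fails on a square it fails on one of its quarters, and the nested squares so
    obtained shrink to a point [(a, b)], near which the second hypothesis makes [P] hold. This is
    the compactness argument in Goursat's proof. *)
Lemma square_cousin (P : R -> R -> R -> Prop) :
  (forall x y s, 0 < s -> P x y (s / 2) -> P (x + s / 2) y (s / 2) ->
     P x (y + s / 2) (s / 2) -> P (x + s / 2) (y + s / 2) (s / 2) ->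
     P x y s) ->
  (forall a b, exists2 d, 0 < d & forall x y s, 0 < s < d ->
     x <= a <= x + s -> y <= b <= y + s -> P x y s) ->
  forall x y s, 0 < s -> P x y s.
Proof.
move=> Psplit Plocal x0 y0 s0 s0_gt0; apply: contrapT => nP0.
pose ok (k : nat) (q : R * R) := ~ P q.1 q.2 (s0 / 2 ^+ k).
have step k q : ok k q -> exists q', ok k.+1 q' /\
    (q.1 <= q'.1 /\ q'.1 + s0 / 2 ^+ k.+1 <= q.1 + s0 / 2 ^+ k) /\
    (q.2 <= q'.2 /\ q'.2 + s0 / 2 ^+ k.+1 <= q.2 + s0 / 2 ^+ k).
  move=> okq; apply: contrapT => noq; apply: okq.
  have sk : 0 < s0 / 2 ^+ k by rewrite divr_gt0 ?exprn_gt0.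
  have sE : s0 / 2 ^+ k / 2 = s0 / 2 ^+ k.+1.
    by rewrite exprSr invfM mulrA.
  have sk1 : s0 / 2 ^+ k.+1 = s0 / 2 ^+ k / 2 by [].
  apply: Psplit => //; rewrite sE; apply: contrapT => nP; apply: noq.
  - by exists (q.1, q.2) => /=; split=> //; lra.
  - by exists (q.1 + s0 / 2 ^+ k.+1, q.2) => /=; split=> //; lra.
  - by exists (q.1, q.2 + s0 / 2 ^+ k.+1) => /=; split=> //; lra.
  - by exists (q.1 + s0 / 2 ^+ k.+1, q.2 + s0 / 2 ^+ k.+1) => /=; split=> //; lra.
have [u [u0 uS]] : exists u : nat -> R * R, u 0%N = (x0, y0) /\
    forall k, ok k (u k) /\
    ((u k).1 <= (u k.+1).1 /\
       (u k.+1).1 + s0 / 2 ^+ k.+1 <= (u k).1 + s0 / 2 ^+ k) /\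
    ((u k).2 <= (u k.+1).2 /\
       (u k.+1).2 + s0 / 2 ^+ k.+1 <= (u k).2 + s0 / 2 ^+ k).
  have [nxt nxtP] : exists nxt : nat -> R * R -> R * R, forall k q, ok k q ->
      ok k.+1 (nxt k q) /\
      (q.1 <= (nxt k q).1 /\ (nxt k q).1 + s0 / 2 ^+ k.+1 <= q.1 + s0 / 2 ^+ k) /\
      (q.2 <= (nxt k q).2 /\ (nxt k q).2 + s0 / 2 ^+ k.+1 <= q.2 + s0 / 2 ^+ k).
    have H k q : {q' | ok k q -> ok k.+1 q' /\
      (q.1 <= q'.1 /\ q'.1 + s0 / 2 ^+ k.+1 <= q.1 + s0 / 2 ^+ k) /\
      (q.2 <= q'.2 /\ q'.2 + s0 / 2 ^+ k.+1 <= q.2 + s0 / 2 ^+ k)}.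
      by apply: cid; case: (pselect (ok k q)) => [/step[q' ?]|?];
        [exists q'|exists q].
    by exists (fun k q => sval (H k q)) => k q okq; case: (H k q) => q' /=; apply.
  pose u := fix u k := if k is j.+1 then nxt j (u j) else (x0, y0).
  have oku k : ok k (u k).
    elim: k => [|k IH /=]; first by rewrite /ok /= expr0 divr1.
    by have [] := nxtP _ _ IH.
  by exists u; split=> // k; split; [exact: oku | have [] := nxtP _ _ (oku k)].
(* The lower ends increase and never exceed any upper end, so their supremum lies in all the
   intervals. *)
have nested (v : nat -> R) :
    (forall k, v k <= v k.+1 /\ v k.+1 + s0 / 2 ^+ k.+1 <= v k + s0 / 2 ^+ k) ->
    exists a, forall k, v k <= a <= v k + s0 / 2 ^+ k.
  move=> vP.
  have sgt k : 0 < s0 / 2 ^+ k by rewrite divr_gt0 ?exprn_gt0.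
  have vmono : {homo v : m n / (m <= n)%N >-> m <= n}.
    by apply: homo_leq => [//|? ? ?|k]; [exact: le_trans | case: (vP k)].
  have vdecr k j : v (k + j)%N + s0 / 2 ^+ (k + j) <= v k + s0 / 2 ^+ k.
    elim: j => [|j IH]; first by rewrite addn0.
    by rewrite addnS; apply: le_trans IH; case: (vP (k + j)%N).
  have vub k m : v m <= v k + s0 / 2 ^+ k.
    case: (leqP k m) => [/subnKC <-|/ltnW km].
      by apply: le_trans (vdecr k (m - k)%N); rewrite lerDl; apply: ltW.
    by rewrite (le_trans (vmono _ _ km)) // lerDl; apply: ltW.
  have Vne : range v !=set0 by exists (v 0%N); exists 0%N.
  exists (sup (range v)) => k; apply/andP; split.
    apply: ub_le_sup; last by exists k.
    by exists (v 0%N + s0 / 2 ^+ 0) => _ [m _ <-].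
  by apply: ge_sup => // _ [m _ <-].
have [a aP] := nested (fun k => (u k).1) (fun k => (uS k).2.1).
have [b bP] := nested (fun k => (u k).2) (fun k => (uS k).2.2).
have [d d0 dP] := Plocal a b.
have [k kd] : exists k, s0 / 2 ^+ k < d.
  have [|N NP] := @geometric_small _ s0 (1 / 2) _ _ d0; first lra.
  by exists N; have := NP N (leqnn N); rewrite expr_div_n expr1n mulrA mulr1.
have [okk _] := uS k; apply: okk; apply: dP => //.
by rewrite kd andbT divr_gt0 ?exprn_gt0.
Qed.

End SquareCousin.

Section Goursat.
Variable R : realType.
Implicit Types (F G : R[i] -> R[i]) (p h z w : R[i]).

(* The midpoint sum of [F] over the segment from [p] to [p + h] cut into [2 ^ n]
   pieces plays the role of the line integral. *)
Fixpoint seg_sum n F p h : R[i] :=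
  if n is m.+1 then seg_sum m F p (h / 2) + seg_sum m F (p + h / 2) (h / 2)
  else h * F (p + h / 2).

Lemma seg_half_l (t : R) p h : p + t%:C * (h / 2) = p + (t / 2)%:C * h.
Proof. by rewrite rmorphM /= fmorphV /= rmorph_nat; ring. Qed.

Lemma seg_half_r (t : R) p h :
  p + h / 2 + t%:C * (h / 2) = p + ((1 + t) / 2)%:C * h.
Proof. by rewrite rmorphM rmorphD /= fmorphV /= rmorph_nat rmorph1; field. Qed.

Lemma seg_mid p h : p + h / 2 = p + (1 / 2 : R)%:C * h.
Proof. by rewrite rmorphM /= fmorphV /= rmorph_nat rmorph1; ring. Qed.

Lemma seg_sum_ext n F G p h :
  (forall t : R, 0 <= t <= 1 -> F (p + t%:C * h) = G (p + t%:C * h)) ->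
  seg_sum n F p h = seg_sum n G p h.
Proof.
elim: n p h => [|n IH] p h FG /=.
  by rewrite seg_mid FG //; lra.
congr (_ + _); apply: IH => t t01.
  by rewrite seg_half_l FG //; lra.
by rewrite seg_half_r FG //; lra.
Qed.

Lemma seg_sumD n F G p h :
  seg_sum n (fun z => F z + G z) p h = seg_sum n F p h + seg_sum n G p h.
Proof.
elim: n p h => [|n IH] p h /=; first by rewrite mulrDr.
by rewrite !IH addrACA.
Qed.

Lemma seg_sumZ n F (c : R[i]) p h :
  seg_sum n (fun z => c * F z) p h = c * seg_sum n F p h.
Proof.
elim: n p h => [|n IH] p h /=; first by rewrite mulrCA.
by rewrite !IH mulrDr.
Qed.

(** The midpoint rule is exact on affine functions at every level of subdivision; hence their sums
    around a square vanish exactly, not only in the limit. *)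
Lemma seg_sum_affine n (a b : R[i]) p h :
  seg_sum n (fun z => a + b * z) p h = h * (a + b * (p + h / 2)).
Proof. by elim: n p h => [|n IH] p h //=; rewrite !IH; field. Qed.

Lemma seg_sum_le n F p h (M : R) :
  (forall t : R, 0 <= t <= 1 -> modc (F (p + t%:C * h)) <= M) ->
  modc (seg_sum n F p h) <= M * modc h.
Proof.
elim: n p h => [|n IH] p h FM /=.
  by rewrite modcM mulrC seg_mid ler_wpM2r ?modc_ge0 // FM //; lra.
have h2 : modc (h / 2) = modc h / 2.
  by rewrite modcM modcV -[2](rmorph_nat (real_complex R)) modc_real normr_nat.
have := modcD (seg_sum n F p (h / 2)) (seg_sum n F (p + h / 2) (h / 2)).
have /IH : forall t : R, 0 <= t <= 1 -> modc (F (p + t%:C * (h / 2))) <= M.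
  by move=> t t01; rewrite seg_half_l FM //; lra.
have /IH : forall t : R, 0 <= t <= 1 ->
    modc (F (p + h / 2 + t%:C * (h / 2))) <= M.
  by move=> t t01; rewrite seg_half_r FM //; lra.
rewrite h2; lra.
Qed.

Lemma seg_sum_Im_ge n F p h (a : R) :
  (forall t : R, 0 <= t <= 1 -> a <= complex.Im (h * F (p + t%:C * h))) ->
  a <= complex.Im (seg_sum n F p h).
Proof.
elim: n p h a => [|n IH] p h a aF /=; first by rewrite seg_mid aF //; lra.
have half z : complex.Im (h / 2 * z) = complex.Im (h * z) / 2.
  rewrite -mulrA [2^-1 * z]mulrC mulrA mulrC.
  by rewrite -[2](rmorph_nat (real_complex R)) -fmorphV /= cImZ mulrC.
have /IH : forall t : R, 0 <= t <= 1 ->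
    a / 2 <= complex.Im (h / 2 * F (p + t%:C * (h / 2))).
  move=> t t01; rewrite seg_half_l half ler_wpM2r ?invr_ge0 // aF //; lra.
have /IH : forall t : R, 0 <= t <= 1 ->
    a / 2 <= complex.Im (h / 2 * F (p + h / 2 + t%:C * (h / 2))).
  move=> t t01; rewrite seg_half_r half ler_wpM2r ?invr_ge0 // aF //; lra.
rewrite cImD; lra.
Qed.

(* Counterclockwise around the square with lower left corner [p] and lower side
   [h]. *)
Definition sq_sum n F p h : R[i] :=
  seg_sum n F p h - seg_sum n F (p + h * 'i) h +
  seg_sum n F (p + h) (h * 'i) - seg_sum n F p (h * 'i).

(** Each inner edge is run through twice, in opposite directions. The level drops by one because
    halving the sides uses up one subdivision. *)
Lemma sq_sum_split n F p h : sq_sum n.+1 F p h =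
  sq_sum n F p (h / 2) + sq_sum n F (p + h / 2) (h / 2) +
  sq_sum n F (p + h / 2 * 'i) (h / 2) +
  sq_sum n F (p + h / 2 + h / 2 * 'i) (h / 2).
Proof.
rewrite /sq_sum /= [h * 'i / 2]mulrAC.
have hE : h = h / 2 + h / 2 by field.
have -> : p + h = p + h / 2 + h / 2 by rewrite {1}hE addrA.
have -> : p + h * 'i = p + h / 2 * 'i + h / 2 * 'i.
  by rewrite {1}hE mulrDl addrA.
set a := h / 2.
have -> : p + a * 'i + a * 'i + a = p + a + a * 'i + a * 'i by ring.
have -> : p + a + a + a * 'i = p + a + a * 'i + a by ring.
have -> : p + a * 'i + a = p + a + a * 'i by ring.
ring.
Qed.

Lemma sq_sumD n F G p h :
  sq_sum n (fun z => F z + G z) p h = sq_sum n F p h + sq_sum n G p h.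
Proof. by rewrite /sq_sum !seg_sumD; ring. Qed.

Lemma sq_sumZ n F (c : R[i]) p h :
  sq_sum n (fun z => c * F z) p h = c * sq_sum n F p h.
Proof. by rewrite /sq_sum !seg_sumZ; ring. Qed.

Lemma sq_sum_affine n (a b : R[i]) p h :
  sq_sum n (fun z => a + b * z) p h = 0.
Proof. by rewrite /sq_sum !seg_sum_affine; field. Qed.

Definition in_square (x y s : R) z :=
  x <= complex.Re z <= x + s /\ y <= complex.Im z <= y + s.

Definition square_edge (x y s : R) z :=
  in_square x y s z /\
  [\/ complex.Re z = x, complex.Re z = x + s,
      complex.Im z = y | complex.Im z = y + s].

Lemma square_edge_in x y s z : square_edge x y s z -> in_square x y s z.
Proof. by case. Qed.

Lemma sq_edges (x y s : R) (t : R) : 0 <= s -> 0 <= t <= 1 ->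
  [/\ square_edge x y s ((x +i* y) + t%:C * s%:C),
      square_edge x y s ((x +i* y) + s%:C * 'i + t%:C * s%:C),
      square_edge x y s ((x +i* y) + s%:C + t%:C * (s%:C * 'i)) &
      square_edge x y s ((x +i* y) + t%:C * (s%:C * 'i))].
Proof.
move=> s0 /andP[t0 t1].
have ts0 : 0 <= t * s by rewrite mulr_ge0.
have ts1 : t * s <= s by rewrite ler_piMl.
split; rewrite /square_edge /in_square !(cReD, cImD, cReM, cImM) /=
  !(mulr0, mul0r, mulr1, subr0, sub0r, add0r, addr0, oppr0);
  (split; [split; lra|]).
- by constructor 3.
- by constructor 4.
- by constructor 2.
- by constructor 1.
Qed.

Lemma sq_sum_ext n F G (x y s : R) : 0 <= s ->
  (forall z, square_edge x y s z -> F z = G z) ->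
  sq_sum n F (x +i* y) s%:C = sq_sum n G (x +i* y) s%:C.
Proof.
move=> s0 FG; rewrite /sq_sum.
congr (_ - _ + _ - _); apply: seg_sum_ext => t /(sq_edges x y s0)[*]; exact: FG.
Qed.

Lemma sq_sum_le n F (x y s M : R) : 0 <= s ->
  (forall z, square_edge x y s z -> modc (F z) <= M) ->
  modc (sq_sum n F (x +i* y) s%:C) <= 4 * M * s.
Proof.
move=> s0 FM; rewrite /sq_sum.
have ms : modc s%:C = s by rewrite modc_real ger0_norm.
have msi : modc (s%:C * 'i) = s by rewrite modcM modci mulr1.
have e1 := @seg_sum_le n F (x +i* y) s%:C M.
have e2 := @seg_sum_le n F (x +i* y + s%:C * 'i) s%:C M.
have e3 := @seg_sum_le n F (x +i* y + s%:C) (s%:C * 'i) M.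
have e4 := @seg_sum_le n F (x +i* y) (s%:C * 'i) M.
rewrite ms in e1 e2; rewrite msi in e3 e4.
have {}e1 := e1 (fun t t01 => FM _ (let: And4 a _ _ _ := sq_edges x y s0 t01 in a)).
have {}e2 := e2 (fun t t01 => FM _ (let: And4 _ a _ _ := sq_edges x y s0 t01 in a)).
have {}e3 := e3 (fun t t01 => FM _ (let: And4 _ _ a _ := sq_edges x y s0 t01 in a)).
have {}e4 := e4 (fun t t01 => FM _ (let: And4 _ _ _ a := sq_edges x y s0 t01 in a)).
set A := seg_sum _ _ _ _ in e1 *; set B := seg_sum _ _ _ _ in e2 *.
set C := seg_sum _ _ _ _ in e3 *; set D := seg_sum _ _ _ _ in e4 *.
have := modcB (A - B + C) D; have := modcD (A - B) C; have := modcB A B.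
lra.
Qed.

End Goursat.

Section GoursatTheorem.
Variable R : realType.
Implicit Types (F G : R[i] -> R[i]) (p h z w e : R[i]).

(** The odd square root, a primitive of [|x|^(-1/2) / 2]: its increments are additive in the
    interval, yet at least [sqrt s] on an interval of length [s] containing 0. *)
Definition sroot (x : R) : R := if 0 <= x then Num.sqrt x else - Num.sqrt (- x).

Definition sroot_incr (x s : R) : R := sroot (x + s) - sroot x.

Lemma sroot_incr_ge0 x s : 0 <= s -> 0 <= sroot_incr x s.
Proof.
move=> s0; rewrite /sroot_incr /sroot subr_ge0.
case: (lerP 0 x) => x0; case: (lerP 0 (x + s)) => xs0.
- by rewrite ler_sqrt // lerDl.
- lra.
- by apply: (@le_trans _ _ 0); rewrite ?oppr_le0 sqrtr_ge0.
- by rewrite lerN2 ler_sqrt; lra.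
Qed.

Lemma sroot_incr_split x s :
  sroot_incr x s = sroot_incr x (s / 2) + sroot_incr (x + s / 2) (s / 2).
Proof.
rewrite /sroot_incr; have -> : x + s / 2 + s / 2 = x + s by field.
ring.
Qed.

(** With [a = x + s] and [b = - x], both nonnegative, [(sqrt a + sqrt b)^2 >= a + b = s]. *)
Lemma sroot_incr_ge x s : 0 <= s -> x <= 0 <= x + s ->
  Num.sqrt s <= sroot_incr x s.
Proof.
move=> s0 /andP[x0 xs0]; rewrite /sroot_incr /sroot xs0.
have a0 := sqrtr_ge0 (x + s); have b0 := sqrtr_ge0 (- x).
have aE : Num.sqrt (x + s) ^+ 2 = x + s by rewrite sqr_sqrtr.
have bE : Num.sqrt (- x) ^+ 2 = - x by rewrite sqr_sqrtr // oppr_ge0.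
have -> : (if 0 <= x then Num.sqrt x else - Num.sqrt (- x)) = - Num.sqrt (- x).
  case: (lerP 0 x) => // x0'; have -> : x = 0 by lra.
  by rewrite oppr0 sqrtr0 oppr0.
rewrite opprK -(@ler_pXn2r _ 2) ?nnegrE ?addr_ge0 ?sqrtr_ge0 //.
rewrite sqr_sqrtr // sqrrD aE bE.
have : 0 <= Num.sqrt (x + s) * Num.sqrt (- x) by rewrite mulr_ge0.
rewrite -mulr_natr; lra.
Qed.

(* An additive function of squares which is at least [s] on the squares of side
   [s] containing [e], although [e] is a single point: it is the area for the
   density |x - Re e|^(-1/2) |y - Im e|^(-1/2) / 4. *)
Definition point_weight e x y s : R :=
  sroot_incr (x - complex.Re e) s * sroot_incr (y - complex.Im e) s.

Lemma point_weight_ge0 e x y s : 0 <= s -> 0 <= point_weight e x y s.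
Proof. by move=> s0; rewrite mulr_ge0 ?sroot_incr_ge0. Qed.

Lemma point_weight_split e x y s : point_weight e x y s =
  point_weight e x y (s / 2) + point_weight e (x + s / 2) y (s / 2) +
  point_weight e x (y + s / 2) (s / 2) +
  point_weight e (x + s / 2) (y + s / 2) (s / 2).
Proof.
rewrite /point_weight (sroot_incr_split (x - _)) (sroot_incr_split (y - _)).
have -> : x - complex.Re e + s / 2 = x + s / 2 - complex.Re e by ring.
have -> : y - complex.Im e + s / 2 = y + s / 2 - complex.Im e by ring.
ring.
Qed.

Lemma point_weight_ge e x y s : 0 <= s -> in_square x y s e ->
  s <= point_weight e x y s.
Proof.
move=> s0 [/andP[xe ex] /andP[ye ey]].
have hx : Num.sqrt s <= sroot_incr (x - complex.Re e) s.
  by apply: sroot_incr_ge => //; apply/andP; split; lra.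
have hy : Num.sqrt s <= sroot_incr (y - complex.Im e) s.
  by apply: sroot_incr_ge => //; apply/andP; split; lra.
rewrite /point_weight -[X in X <= _](sqr_sqrtr s0) expr2.
by apply: ler_pM => //; exact: sqrtr_ge0.
Qed.

Definition ccont F z := forall e : R, 0 < e -> exists2 d : R, 0 < d &
  forall h, modc h < d -> modc (F (z + h) - F z) <= e.

Lemma in_square_dist x y s z w : in_square x y s z -> in_square x y s w ->
  modc (w - z) <= 2 * s.
Proof.
move=> [/andP[a b] /andP[c d]] [/andP[a' b'] /andP[c' d']].
apply: le_trans (modc_le_ReIm _) _; rewrite cReB cImB.
have : `|complex.Re w - complex.Re z| <= s by rewrite ler_norml; lra.
have : `|complex.Im w - complex.Im z| <= s by rewrite ler_norml; lra.
lra.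
Qed.

(** The error allowed on a square is [eps] times [W], the area plus the point weight; both are
    additive, so the allowances add up under subdivision. At a point of differentiability the affine
    part contributes 0 and the remainder is [o(s)] on a perimeter [4 s], which the area pays for. At
    [e1] only a constant is subtracted, and a remainder [o(1)] on the perimeter is paid for by the
    point weight. The exceptional point lets the theorem apply to a difference quotient at its
    centre. *)
Theorem goursat F e1 x0 y0 s0 : 0 < s0 ->
  (forall z, in_square x0 y0 s0 z -> (exists l, cdiff F z l) \/
     (z = e1 /\ ccont F z)) ->
  forall eta : R, 0 < eta -> exists N, forall n, (N <= n)%N ->
    modc (sq_sum n F (x0 +i* y0) s0%:C) <= eta.
Proof.
move=> s0_gt0 FP eta eta0.
pose W x y s := s ^+ 2 + point_weight e1 x y s.
have W_gt0 x y s : 0 < s -> 0 < W x y s.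
  move=> s0'; have := point_weight_ge0 e1 x y (ltW s0').
  have : 0 < s ^+ 2 by rewrite exprn_gt0.
  rewrite /W; lra.
have WsplitE x y s : W x y s = W x y (s / 2) + W (x + s / 2) y (s / 2) +
    W x (y + s / 2) (s / 2) + W (x + s / 2) (y + s / 2) (s / 2).
  rewrite /W (point_weight_split e1 x); by field.
have [eps eps0 epsE] : exists2 eps, 0 < eps & eps * W x0 y0 s0 = eta.
  exists (eta / W x0 y0 s0); first by rewrite divr_gt0 ?W_gt0.
  by rewrite divfK // gt_eqF ?W_gt0.
pose P x y s := x0 <= x -> x + s <= x0 + s0 -> y0 <= y -> y + s <= y0 + s0 ->
  exists N, forall n, (N <= n)%N ->
    modc (sq_sum n F (x +i* y) s%:C) <= eps * W x y s.
suff PP : P x0 y0 s0.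
  by rewrite -epsE; exact: PP.
apply: (@square_cousin _ P) => // {eta eta0 epsE}.
- move=> x y s s_gt0 P1 P2 P3 P4 hx hxs hy hys.
  have [c1 c2] : x0 <= x + s / 2 /\ y0 <= y + s / 2 by lra.
  have [c3 c4] : x + s / 2 <= x0 + s0 /\ y + s / 2 <= y0 + s0 by lra.
  have hh (a : R) : a + s / 2 + s / 2 = a + s by lra.
  have [N1 N1P] := P1 hx c3 hy c4.
  have [|N2 N2P] := P2 c1 _ hy c4; first by rewrite hh.
  have [|N3 N3P] := P3 hx c3 c2; first by rewrite hh.
  have [||N4 N4P] := P4 c1 _ c2; rewrite ?hh //.
  (* One level more than the four quarters ask for, since splitting the square uses up one. *)
  exists (N1 + N2 + N3 + N4).+1 => -[//|n]; rewrite ltnS => nN.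
  have n4 := leq_trans (leq_addl _ N4) nN; have {}nN := leq_trans (leq_addr N4 _) nN.
  have n3 := leq_trans (leq_addl _ N3) nN; have {}nN := leq_trans (leq_addr N3 _) nN.
  have n2 := leq_trans (leq_addl _ N2) nN; have n1 := leq_trans (leq_addr N2 _) nN.
  rewrite sq_sum_split.
  have -> : s%:C / 2 = (s / 2)%:C :> R[i].
    by rewrite rmorphM /= fmorphV /= rmorph_nat.
  have -> : (x +i* y) + (s / 2)%:C = (x + s / 2) +i* y :> R[i].
    by apply/eqP; rewrite eq_complex /= addr0 !eqxx.
  have -> : (x +i* y) + (s / 2)%:C * 'i = x +i* (y + s / 2) :> R[i].
    by apply/eqP; rewrite eq_complex /= !(mulr0, mul0r, mulr1, subr0, addr0, add0r) !eqxx.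
  have -> : ((x + s / 2) +i* y) + (s / 2)%:C * 'i =
      (x + s / 2) +i* (y + s / 2) :> R[i].
    by apply/eqP; rewrite eq_complex /= !(mulr0, mul0r, mulr1, subr0, addr0, add0r) !eqxx.
  rewrite (WsplitE x y s) 3!(mulrDr eps).
  apply: le_trans (modcD _ _) _; apply: lerD; last exact: N4P.
  apply: le_trans (modcD _ _) _; apply: lerD; last exact: N3P.
  apply: le_trans (modcD _ _) _; apply: lerD; last exact: N2P.
  exact: N1P.
have zw (z w : R[i]) : z + (w - z) = w by rewrite addrC subrK.
have ltr0Sn_ (k : nat) : 0 < k.+1%:R :> R by rewrite ltr0n.
move=> a b; pose z := a +i* b.
have [inz|noz] := pselect (in_square x0 y0 s0 z); last first.
  exists 1 => // x y s s01 xa yb hx hxs hy hys; exfalso; apply: noz.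
  by rewrite /in_square /=; split; lra.
have seg_lin (F0 E : R[i] -> R[i]) (c l : R[i]) x y s n : 0 <= s ->
    (forall w, F0 w = (c + l * w) + E w) ->
    sq_sum n F0 (x +i* y) s%:C = sq_sum n E (x +i* y) s%:C.
  move=> s_ge0 FE; rewrite (sq_sum_ext n (G := fun w => (c + l * w) + E w)) //.
  by rewrite sq_sumD sq_sum_affine add0r.
have inz' x y s : x <= a <= x + s -> y <= b <= y + s -> in_square x y s z by [].
case: (FP z inz) => [[l fl]|[ze Fc]].
  (* Points of the square are within [2 * s] of [z] and the perimeter is [4 * s], so [eps / 8]
     yields [eps * s ^+ 2]. *)
  have [d d0 dP] := fl (eps / 8) (divr_gt0 eps0 (ltr0Sn_ _)).
  exists (d / 2); first by rewrite divr_gt0.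
  move=> x y s /andP[s_gt0 sd] xa yb _ _ _ _; exists 0%N => n _.
  have s_ge0 := ltW s_gt0.
  rewrite (seg_lin F (fun w => F w - F z - l * (w - z)) (F z - l * z) l) //;
    last by move=> w; ring.
  have EM w : square_edge x y s w ->
      modc (F w - F z - l * (w - z)) <= eps / 8 * (2 * s).
    move=> /square_edge_in inw.
    have wz := in_square_dist (inz' x y s xa yb) inw.
    have := dP (w - z); rewrite zw => H; apply: le_trans (H _) _.
      by apply: le_lt_trans wz _; lra.
    by rewrite ler_wpM2l //; lra.
  apply: le_trans (sq_sum_le n s_ge0 EM) _.
  have := point_weight_ge0 e1 x y s_ge0.
  rewrite /W => u1.
  have -> : 4 * (eps / 8 * (2 * s)) * s = eps * s ^+ 2 by field.
  by rewrite ler_wpM2l ?(ltW eps0) //; lra.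
have [d d0 dP] := Fc (eps / 4) (divr_gt0 eps0 (ltr0Sn_ _)).
exists (d / 2); first by rewrite divr_gt0.
move=> x y s /andP[s_gt0 sd] xa yb _ _ _ _; exists 0%N => n _.
have s_ge0 := ltW s_gt0.
rewrite (seg_lin F (fun w => F w - F z) (F z) 0) //; last by move=> w; ring.
have EM w : square_edge x y s w -> modc (F w - F z) <= eps / 4.
  move=> /square_edge_in inw.
  have wz := in_square_dist (inz' x y s xa yb) inw.
  have := dP (w - z); rewrite zw => -> //.
  by apply: le_lt_trans wz _; lra.
apply: le_trans (sq_sum_le n s_ge0 EM) _.
have u1 := point_weight_ge0 e1 x y s_ge0.
have s2 : 0 <= s ^+ 2 by exact: sqr_ge0.
have -> : 4 * (eps / 4) * s = eps * s by field.
rewrite ler_wpM2l ?(ltW eps0) // /W.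
rewrite ze in inz'.
have := point_weight_ge s_ge0 (inz' x y s xa yb); lra.
Qed.

End GoursatTheorem.

(** * Cauchy's formula and its consequences *)

Section Cauchy.
Variable R : realType.
Implicit Types (f F G : R[i] -> R[i]) (p h z w a l : R[i]) (rho M : R).

Lemma cdiff_near f g z l :
  (exists2 d : R, 0 < d & forall h, modc h < d -> f (z + h) = g (z + h)) ->
  cdiff f z l -> cdiff g z l.
Proof.
move=> [d d0 fg] fl e e0; have [d' d'0 dP] := fl e e0.
exists (Num.min d d') => [|h]; first by rewrite lt_min d0.
rewrite lt_min => /andP[hd hd'].
have gz : f z = g z by have := fg 0; rewrite modc0 addr0; exact.
by rewrite -gz -fg // dP.
Qed.

Lemma differentiable_near f g z :
  (exists2 d : R, 0 < d & forall h, modc h < d -> f (z + h) = g (z + h)) ->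
  differentiable f z -> differentiable g z.
Proof.
by move=> fg /cdiffP[l fl]; apply/cdiffP; exists l; exact: cdiff_near fl.
Qed.

Lemma cdiff_ccont f z l : cdiff f z l -> ccont f z.
Proof.
move=> fl e e0; have [d d0 dP] := fl 1 ltr01.
have l0 := modc_ge0 l.
exists (Num.min d (e / (modc l + 1))) => [|h].
  by rewrite lt_min d0 divr_gt0 // ltr_wpDl.
rewrite lt_min => /andP[/dP hd]; rewrite ltr_pdivlMr ?ltr_wpDl // => he.
rewrite -(subrK (l * h) (f (z + h) - f z)).
apply: le_trans (modcD _ _) _; rewrite modcM.
move: hd he; rewrite mul1r mulrDr mulr1; have := modc_ge0 h; lra.
Qed.

Definition diff_quot f a l z : R[i] :=
  if z == a then l else (f z - f a) / (z - a).

Lemma diff_quot_off f a l z : z != a -> differentiable f z ->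
  differentiable (diff_quot f a l) z.
Proof.
move=> za fz.
apply: (@differentiable_near (fun z => (f z - f a) / (z - a))).
  exists (modc (a - z)); first by rewrite modc_gt0 subr_eq0 eq_sym.
  move=> h hz; rewrite /diff_quot; case: eqP => // zh.
  by move: hz; rewrite -zh addrC addKr ltxx.
apply: differentiableM; first by apply: differentiableB.
have za0 : z - a != 0 by rewrite subr_eq0.
by apply: differentiableV => //; apply: differentiableB.
Qed.

Lemma diff_quot_ccont f a l : cdiff f a l -> ccont (diff_quot f a l) a.
Proof.
move=> fl e e0; have [d d0 dP] := fl e e0; exists d => // h hd.
rewrite /diff_quot eqxx; have [|ha] := eqVneq (a + h) a.
  by rewrite subrr modc0 ltW.
have h0 : h != 0 by apply: contraNneq ha => ->; rewrite addr0.
have := dP h hd; rewrite -ler_pdivrMr ?modc_gt0 // -modcV -modcM.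
by rewrite mulrBl mulfK // [a + h]addrC addrK [h + a]addrC.
Qed.

Lemma cImV z : complex.Im z^-1 = - complex.Im z / modc z ^+ 2.
Proof. by rewrite modc_sqr; case: z => u v /=; rewrite mulNr. Qed.

Lemma cReV z : complex.Re z^-1 = complex.Re z / modc z ^+ 2.
Proof. by rewrite modc_sqr; case: z => u v /=. Qed.

Definition csq_sum n F a rho : R[i] :=
  sq_sum n F ((complex.Re a - rho) +i* (complex.Im a - rho)) (2 * rho)%:C.

Definition csq_edge a rho z :=
  square_edge (complex.Re a - rho) (complex.Im a - rho) (2 * rho) z.

Definition in_csq a rho z :=
  in_square (complex.Re a - rho) (complex.Im a - rho) (2 * rho) z.

Lemma in_csq_near a rho z : modc (z - a) <= rho -> in_csq a rho z.
Proof.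
move=> za; have := normr_Re_le (z - a); have := normr_Im_le (z - a).
rewrite cReB cImB !ler_norml => hi hr; rewrite /in_csq /in_square.
by split; lra.
Qed.

Lemma in_csq_modc a rho z : 0 <= rho -> in_csq a rho z -> modc (z - a) <= 2 * rho.
Proof.
move=> r0 [] h1 h2; apply: le_trans (modc_le_ReIm _) _; rewrite cReB cImB.
have : `|complex.Re z - complex.Re a| <= rho by rewrite ler_norml; lra.
have : `|complex.Im z - complex.Im a| <= rho by rewrite ler_norml; lra.
lra.
Qed.

Lemma csq_edge_dist a rho z w : 0 <= rho -> csq_edge a rho z ->
  modc (w - a) <= rho / 2 -> rho / 2 <= modc (z - w) <= 4 * rho.
Proof.
move=> rho0 [zin ze] wa.
have win : in_csq a rho w by apply: in_csq_near; lra.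
apply/andP; split; last first.
  by have := in_square_dist win zin; lra.
have := normr_Re_le (w - a); have := normr_Im_le (w - a).
rewrite cReB cImB !ler_norml => hi hr.
have zr := normr_Re_le (z - w); have zi := normr_Im_le (z - w).
case: ze => ze; [apply: le_trans zr|apply: le_trans zr|
  apply: le_trans zi|apply: le_trans zi]; rewrite ?cReB ?cImB ze ler_normr; lra.
Qed.

(** Stands in for the value [2 pi i] of the integral, of which only a lower bound is needed. The
    argument of [z - w] increases along every side; a side is at distance at least [rho / 2] from
    [w] and its points at distance at most [4 * rho], so each of the four contributes at least
    [1 / 16]. *)
Lemma csq_kernel_ge n a rho w : 0 < rho -> modc (w - a) <= rho / 2 ->
  1 / 4 <= complex.Im (csq_sum n (fun z => (z - w)^-1) a rho).
Proof.
move=> rho0 wa; rewrite /csq_sum /sq_sum.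
set p := _ +i* _; set s := (2 * rho)%:C.
have s0 : 0 <= 2 * rho by lra.
have wR := normr_Re_le (w - a); have wI := normr_Im_le (w - a).
rewrite cReB cImB !ler_norml in wR wI.
have neg q k : - seg_sum n (fun z => (z - w)^-1) q k =
    seg_sum n (fun z => - 1 * (z - w)^-1) q k by rewrite seg_sumZ mulN1r.
have bnd z t : csq_edge a rho z -> rho / 2 <= t ->
    1 / 16 <= 2 * rho * (t / modc (z - w) ^+ 2).
  move=> ze ht; have /andP[z1 z2] := csq_edge_dist (ltW rho0) ze wa.
  have m0 : 0 < modc (z - w) ^+ 2 by rewrite exprn_gt0 //; lra.
  rewrite mulrA ler_pdivlMr //.
  have : modc (z - w) ^+ 2 <= (4 * rho) ^+ 2 by rewrite lerXn2r ?nnegrE //; lra.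
  have : rho * rho <= 2 * rho * t.
    have -> : 2 * rho * t = rho * (2 * t) by ring.
    by rewrite ler_wpM2l //; lra.
  rewrite exprMn expr2 [rho ^+ 2]expr2; lra.
rewrite !neg !cImD.
have ImiM (z : R[i]) : complex.Im ('i * z) = complex.Re z.
  by case: z => u v /=; rewrite mul0r add0r mul1r.
have eqs t : 0 <= t <= 1 -> [/\ csq_edge a rho (p + t%:C * s),
   csq_edge a rho (p + s * 'i + t%:C * s), csq_edge a rho (p + s + t%:C * (s * 'i))
   & csq_edge a rho (p + t%:C * (s * 'i))] by move=> t01; exact: sq_edges.
have h1 : 1 / 16 <= complex.Im (seg_sum n (fun z => (z - w)^-1) p s).
  apply: seg_sum_Im_ge => t t01; have [e1 _ _ _] := eqs t t01.
  rewrite cImZ cImV; apply: bnd => //.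
  rewrite cImB !cImD. rewrite cImM /=; lra.
have h2 : 1 / 16 <= complex.Im (seg_sum n (fun z => -1 * (z - w)^-1) (p + s * 'i) s).
  apply: seg_sum_Im_ge => t t01; have [_ e1 _ _] := eqs t t01.
  rewrite cImZ mulN1r cImN cImV -mulNr opprK; apply: bnd => //.
  rewrite cImB !cImD !cImM /=; lra.
have h3 : 1 / 16 <= complex.Im (seg_sum n (fun z => (z - w)^-1) (p + s) (s * 'i)).
  apply: seg_sum_Im_ge => t t01; have [_ _ e1 _] := eqs t t01.
  rewrite -mulrA cImZ ImiM cReV; apply: bnd => //.
  rewrite cReB !cReD !cReM /=; lra.
have h4 : 1 / 16 <= complex.Im (seg_sum n (fun z => -1 * (z - w)^-1) p (s * 'i)).
  apply: seg_sum_Im_ge => t t01; have [_ _ _ e1] := eqs t t01.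
  rewrite -mulrA cImZ ImiM mulN1r cReN cReV -mulNr.
  apply: bnd => //.
  rewrite cReB !cReD !cReM /=; lra.
lra.
Qed.

(** Goursat's theorem for the difference quotient of [f] at [w], which is known only to be
    continuous at [w]. The sum of the kernel stays as a factor and is never evaluated. *)
Lemma cauchy_formula f a rho w : 0 < rho ->
  (forall z, in_csq a rho z -> differentiable f z) ->
  modc (w - a) <= rho / 2 -> forall eta : R, 0 < eta ->
  exists N, forall n, (N <= n)%N ->
    modc (csq_sum n (fun z => f z / (z - w)) a rho -
          f w * csq_sum n (fun z => (z - w)^-1) a rho) <= eta.
Proof.
move=> rho0 fd wa eta eta0.
have win : in_csq a rho w by apply: in_csq_near; lra.
have [l fl] := (iffLR (cdiffP _ _)) (fd w win).
have s0 : 0 < 2 * rho by lra.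
have [|N NP] := @goursat _ (diff_quot f w l) w (complex.Re a - rho)
    (complex.Im a - rho) _ s0 _ eta eta0.
  move=> z zin; have [->|zw] := eqVneq z w; first by right; split=> //; exact: diff_quot_ccont.
  by left; apply/cdiffP; apply: diff_quot_off => //; apply: fd.
exists N => n /NP; congr (modc _ <= _).
rewrite /csq_sum -sq_sumZ -[X in _ = _ - X]mul1r -mulNr -sq_sumZ -sq_sumD.
apply: sq_sum_ext; first exact: ltW.
move=> z ze; have /andP[zw _] := csq_edge_dist (ltW rho0) ze wa.
rewrite /diff_quot; case: eqP => [zE|_]; first by exfalso; move: zw; rewrite zE subrr modc0; lra.
ring.
Qed.

Lemma le_of_pow_le (A M C : R) : 0 <= A -> 0 <= M ->
  (forall k, A ^+ k <= C * M ^+ k) -> A <= M.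
Proof.
move=> A0 M0 H; rewrite leNgt; apply/negP => MA.
have A0' : 0 < A by lra.
have [|k kP] := @geometric_small _ C (M / A) 1 _ ltr01.
  by rewrite divr_ge0 //= ltr_pdivrMr // mul1r.
have := kP k (leqnn k); rewrite expr_div_n mulrA ltr_pdivrMr ?exprn_gt0 // mul1r.
by rewrite ltNge H.
Qed.

Lemma differentiable_pow f z k :
  differentiable f z -> differentiable (fun z => f z ^+ k) z.
Proof.
move=> fz; elim: k => [|k IH]; first exact: differentiable_cst.
rewrite (_ : (fun z => f z ^+ k.+1) = (fun z => f z * f z ^+ k)).
  exact: differentiableM.
by apply/funext => w; rewrite exprS.
Qed.

(** Cauchy's formula bounds [f a] only up to a constant. For every power of [f] it loses the same
    constant, which [le_of_pow_le] removes. *)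
Lemma local_max_modulus f a rho M : 0 < rho ->
  (forall z, in_csq a rho z -> differentiable f z) ->
  (forall z, csq_edge a rho z -> modc (f z) <= M) -> modc (f a) <= M.
Proof.
move=> rho0 fd fM.
have M0 : 0 <= M.
  have t01 : 0 <= (0 : R) <= 1 by rewrite lexx ler01.
  have s0 : 0 <= 2 * rho by lra.
  have [e1 _ _ _] := sq_edges (complex.Re a - rho) (complex.Im a - rho) s0 t01.
  exact: le_trans (modc_ge0 _) (fM _ e1).
have aa : modc (a - a) <= rho / 2 by rewrite subrr modc0; lra.
(* The sum is at most [16 * M ^+ k] and the kernel at least [1 / 4], so any constant from 64 on
   serves. *)
apply: (@le_of_pow_le _ _ 68) => //; first exact: modc_ge0.
move=> k; apply/ler_addgt0Pr => eps eps0.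
have fkd z : in_csq a rho z -> differentiable (fun z => f z ^+ k) z.
  by move=> /fd; exact: differentiable_pow.
have [|N NP] := cauchy_formula rho0 fkd aa (eta := eps / 4); first lra.
have {NP} := NP N (leqnn N); set S := csq_sum _ _ _ _; set c := csq_sum _ _ _ _ => NP.
have c4 : 1 / 4 <= modc c.
  apply: le_trans (csq_kernel_ge N rho0 aa) _.
  exact: le_trans (ler_norm _) (normr_Im_le _).
have SM : modc S <= 4 * (2 * M ^+ k / rho) * (2 * rho).
  apply: sq_sum_le; first lra.
  move=> z ze; have /andP[z1 _] := csq_edge_dist (ltW rho0) ze aa.
  rewrite modcM modcX modcV.
  have -> : 2 * M ^+ k / rho = M ^+ k * (rho / 2)^-1 by field; lra.
  have z0 : 0 < modc (z - a) by lra.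
  apply: ler_pM; rewrite ?exprn_ge0 ?invr_ge0 ?modc_ge0 //.
    by rewrite lerXn2r ?nnegrE ?modc_ge0 ?fM.
  by rewrite lef_pV2 ?posrE //; lra.
have := modcD (f a ^+ k * c - S) S; rewrite subrK modc_distC modcM modcX => H.
have E : 4 * (2 * M ^+ k / rho) * (2 * rho) = 16 * M ^+ k by field; lra.
rewrite {}E in SM.
have Mk : 0 <= M ^+ k by rewrite exprn_ge0.
have : modc (f a) ^+ k * (1 / 4) <= modc (f a) ^+ k * modc c.
  by rewrite ler_wpM2l ?exprn_ge0 ?modc_ge0.
lra.
Qed.

End Cauchy.

(** * The maximum modulus principle on discs *)

Section MaximumModulus.
Variable R : realType.
Implicit Types (f F G : R[i] -> R[i]) (p h z w a l : R[i]) (r rho M : R).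

Lemma modc_for_continuous (F : R[i] -> R) z :
  (forall e : R, 0 < e -> exists2 d : R, 0 < d &
     forall h, modc h < d -> `|F (z + h) - F z| <= e) ->
  {for z, continuous F}.
Proof.
move=> H A /= /nbhs_ballP[e /= e0 eA].
have [|d d0 dP] := H (e / 2); first lra.
apply/near_modcP; exists d => // h /dP he; apply: eA.
by rewrite /ball /= distrC; lra.
Qed.

Lemma modc_continuous a : continuous (fun z => modc (z - a)).
Proof.
move=> z; apply: modc_for_continuous => e e0; exists e => // h he.
rewrite ler_norml.
have := modcD (z - a) h; have := modcD (z + h - a) (- h).
rewrite addrAC addrK modcN [z - a + h]addrAC; lra.
Qed.

(** A closed subset of the image of a real square, so that compactness comes from that of
    segments. *)
Lemma compact_disc a r : compact [set z : R[i] | modc (z - a) <= r].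
Proof.
pose g (q : R * R) : R[i] := (complex.Re a + q.1) +i* (complex.Im a + q.2).
pose K : set (R * R) := `[- r, r]%classic `*` `[- r, r]%classic.
have cK : compact (g @` K).
  apply: continuous_compact; last first.
    by apply: compact_setX; exact: segment_compact.
  apply: continuous_subspaceT => q A /near_modcP[e e0 eA].
  have e2 : 0 < e / 2 by rewrite divr_gt0.
  apply/nbhs_ballP; exists (e / 2) => //= -[q1 q2] [/= b1 b2].
  rewrite /ball /= in b1 b2.
  have -> : g (q1, q2) = g q + ((q1 - q.1) +i* (q2 - q.2)).
    by apply/eqP; rewrite eq_complex /=; apply/andP; split; apply/eqP; ring.
  apply: eA; apply: le_lt_trans (modc_le_ReIm _) _ => /=.
  by rewrite [`|q1 - _|]distrC [`|q2 - _|]distrC; lra.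
apply: subclosed_compact cK _.
  have /continuous_closedP cl := @modc_continuous a.
  exact: (cl _ (@closed_le R r)).
move=> z /= zr; exists (complex.Re (z - a), complex.Im (z - a)).
  have := normr_Re_le (z - a); have := normr_Im_le (z - a).
  rewrite !ler_norml => hi hr; rewrite /K /=; split; rewrite /= in_itv /=; lra.
by apply/eqP; rewrite /g eq_complex /= cReB cImB ![_ + (_ - _)]addrC !subrK !eqxx.
Qed.

Lemma ccont_continuous F z : ccont F z -> {for z, continuous (fun w => modc (F w))}.
Proof.
move=> Fc; apply: modc_for_continuous => e e0; have [d d0 dP] := Fc e e0.
exists d => // h /dP he.
rewrite ler_norml.
have := modcD (F (z + h) - F z) (F z); have := modcD (F z - F (z + h)) (F (z + h)).
rewrite !subrK [modc (F z - _)]modc_distC; lra.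
Qed.

Lemma differentiable_ccont F z : differentiable F z -> ccont F z.
Proof. by move=> /cdiffP[l]; exact: cdiff_ccont. Qed.

Lemma bounded_on_disc f a r :
  (forall z, modc (z - a) <= r -> differentiable f z) ->
  exists2 B, 0 <= B & forall z, modc (z - a) <= r -> modc (f z) <= B.
Proof.
move=> fd; have [r0|r0] := lerP 0 r; last first.
  by exists 0 => // z zr; exfalso; have := modc_ge0 (z - a); lra.
have D0 : [set z : R[i] | modc (z - a) <= r] !=set0.
  by exists a; rewrite /= subrr modc0.
have fc : {within [set z : R[i] | modc (z - a) <= r],
    continuous (fun w => modc (f w))}.
  apply: continuous_in_subspaceT => z; rewrite inE /= => zr.
  by apply: ccont_continuous; apply: differentiable_ccont; apply: fd.
have [c _ cP] := compact_EVT_max D0 (@compact_disc a r) fc.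
exists (modc (f c)); first exact: modc_ge0.
by move=> z zr; apply: cP; rewrite inE.
Qed.

Lemma modc_sqrD z w : modc (z + w) ^+ 2 =
  modc z ^+ 2 + 2 * complex.Re (z^*%C * w) + modc w ^+ 2.
Proof. by rewrite !modc_sqr; case: z => z1 z2; case: w => w1 w2 /=; ring. Qed.

(** The terms linear in [X] cancel in the product, and [- b] outweighs the positive terms that
    remain. *)
Lemma max_modulus_ineq (X b c : R) : `|X| <= 1 / 4 -> 0 <= c <= b / 8 ->
  0 <= b <= 1 / 8 -> (1 - X - b) * (1 + X + c) <= 1 - b / 2.
Proof.
rewrite ler_norml => /andP[x1 x2] /andP[c0 c1] /andP[b0 b1].
have h1 : 0 <= X ^+ 2 by exact: sqr_ge0.
have h2 : - (c / 4) <= X * c.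
  have -> : - (c / 4) = - (1 / 4) * c by field.
  by rewrite ler_wpM2r //; lra.
have h3 : - (b / 4) <= b * X.
  have -> : - (b / 4) = b * (- (1 / 4)) by field.
  by rewrite ler_wpM2l //; lra.
have h4 : 0 <= b * c by rewrite mulr_ge0.
have -> : (1 - X - b) * (1 + X + c) = 1 + c - X ^+ 2 - X * c - b - b * X - b * c.
  by ring.
lra.
Qed.

(** A strict maximum would contradict the local principle on squares. The term
    [e * modc (z - a) ^+ 2] added to [modc (f z) ^+ 2] produces an interior maximum point [c], and
    the holomorphic factor [1 + beta * (z - c)] cancels the first-order part of this term at [c].
    What remains is a decrease of order [modc (z - c) ^+ 2], so the product [g] is strictly smaller
    on the edge of a square around [c] than at [c]. *)
Lemma max_modulus f a r M : 0 < r ->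
  (forall z, modc (z - a) <= r -> differentiable f z) ->
  (forall z, modc (z - a) = r -> modc (f z) <= M) ->
  forall z, modc (z - a) <= r -> modc (f z) <= M.
Proof.
move=> r0 fd fM z1 z1r; rewrite leNgt; apply/negP => Mz1.
have M0 : 0 <= M.
  apply: le_trans (modc_ge0 (f (a + r%:C))) (fM _ _).
  by rewrite addrC addKr modc_real gtr0_norm.
pose m1 := modc (f z1) ^+ 2.
have m1M : M ^+ 2 < m1 by rewrite ltrXn2r // ?nnegrE ?modc_ge0.
have M20 : 0 <= M ^+ 2 by exact: sqr_ge0.
(* The value of the added term on the circle. It is below the excess of [m1] over [M ^+ 2], which
   keeps the maximum off the circle, and small against [m1], so that [max_modulus_ineq] applies. *)
pose k := Num.min ((m1 - M ^+ 2) / 2) (m1 / 16).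
have k0 : 0 < k by rewrite lt_min; apply/andP; split; lra.
have [k1 k2] : k <= (m1 - M ^+ 2) / 2 /\ k <= m1 / 16.
  by split; rewrite ge_min lexx ?orbT.
have r20 : 0 < r ^+ 2 by rewrite exprn_gt0.
pose e := k / r ^+ 2.
have e0 : 0 < e by rewrite divr_gt0.
have er : e * r ^+ 2 = k by rewrite divfK // gt_eqF.
have D0 : [set z : R[i] | modc (z - a) <= r] !=set0 by exists z1.
have phic : {within [set z : R[i] | modc (z - a) <= r],
    continuous (fun w => modc (f w) ^+ 2 + e * modc (w - a) ^+ 2)}.
  rewrite (_ : (fun w => _) = (fun w => modc (f w) * modc (f w) +
      e * (modc (w - a) * modc (w - a)))); last first.
    by apply/funext => w; rewrite !expr2.
  apply: continuous_in_subspaceT => z; rewrite inE /= => zr.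
  have cz : {for z, continuous (fun w => modc (f w))}.
    by apply: ccont_continuous; apply: differentiable_ccont; apply: fd.
  have cm := @modc_continuous a z.
  exact: (cvgD (cvgM cz cz) (cvgM (cvg_cst e) (cvgM cm cm))).
have [c] := compact_EVT_max D0 (@compact_disc a r) phic.
rewrite inE /= => cr cmax.
have {}cmax z : modc (z - a) <= r -> modc (f z) ^+ 2 + e * modc (z - a) ^+ 2 <=
   modc (f c) ^+ 2 + e * modc (c - a) ^+ 2 by move=> zr; apply: cmax; rewrite inE.
pose v := modc (c - a); have v0 : 0 <= v by exact: modc_ge0.
have z1v : 0 <= e * modc (z1 - a) ^+ 2.
  by rewrite mulr_ge0 ?sqr_ge0 // ltW.
have v2r : v ^+ 2 <= r ^+ 2 by rewrite lerXn2r ?nnegrE // ltW.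
have ev : e * v ^+ 2 <= k by rewrite -er ler_wpM2l // ltW.
have cz1 := cmax z1 z1r.
have vr : v < r.
  rewrite lt_neqAle cr andbT; apply/negP => /eqP vr.
  have : modc (f c) ^+ 2 <= M ^+ 2.
    by rewrite lerXn2r ?nnegrE ?modc_ge0 // fM.
  move: cz1; rewrite -/m1 -/v vr er; move: m1M z1v k1; clear; lra.
pose A := modc (f c) ^+ 2.
have Am1 : m1 - k <= A by move: cz1; rewrite -/m1 -/v -/A; move: ev z1v; clear; lra.
have A0 : 0 < A by move: Am1 k2 m1M M20; clear; lra.
pose rho := (r - v) / 2.
have rho0 : 0 < rho by rewrite /rho; lra.
have inD z : in_csq c rho z -> modc (z - c) <= 2 * rho /\ modc (z - a) <= r.
  move=> /(in_csq_modc (ltW rho0)) zc; split=> //.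
  have := modcD (z - c) (c - a); rewrite addrA subrK -/v.
  by move: zc; rewrite /rho; clear; lra.
pose t := e / A.
have t0 : 0 < t by rewrite divr_gt0.
pose beta : R[i] := t%:C * (c - a)^*%C.
pose g z := f z * (1 + beta * (z - c)).
have gd z : in_csq c rho z -> differentiable g z.
  move=> /inD[_ zr]; apply: differentiableM; first exact: fd.
  have subd : differentiable (fun w => w - c) z by apply: differentiableB.
  have := differentiableD (differentiable_cst (1 : R[i]) z)
    (differentiableM (differentiable_cst (beta : R[i]) z) subd).
  exact.
have edge z : csq_edge c rho z -> modc (g z) ^+ 2 <= A - e * rho ^+ 2 / 8.
  move=> ze; have [zc zr] := inD z (square_edge_in ze).
  clear fd fM Mz1 D0 phic z1v cz1 m1M M20 z1r gd k1 inD.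
  have cc : modc (c - c) <= rho / 2 by rewrite subrr modc0 divr_ge0 ?(ltW rho0).
  have /andP[zl _] := csq_edge_dist (ltW rho0) ze cc.
  pose u := z - c; pose x := complex.Re ((c - a)^*%C * u).
  pose ww := modc u ^+ 2.
  have w1 : rho ^+ 2 / 4 <= ww.
    have : (rho / 2) ^+ 2 <= ww by rewrite lerXn2r ?nnegrE ?modc_ge0 // divr_ge0 ?(ltW rho0).
    by rewrite expr_div_n; clear; lra.
  have u2 : modc u <= r by rewrite /rho in zc; rewrite /u; move: zc v0; clear; lra.
  have w2 : ww <= r ^+ 2 by rewrite lerXn2r ?nnegrE ?modc_ge0 // ltW.
  have xE : modc (z - a) ^+ 2 = v ^+ 2 + 2 * x + ww.
    have -> : z - a = (c - a) + u by rewrite /u; ring.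
    exact: modc_sqrD.
  have bE : modc (1 + beta * u) ^+ 2 = 1 + 2 * t * x + t ^+ 2 * v ^+ 2 * ww.
    rewrite modc_sqrD conjc1 mul1r modc1 expr1n /beta -mulrA cReZ.
    by rewrite !modcM modc_conj modc_real gtr0_norm // /ww /v /x; ring.
  have xr : `|x| <= v * r.
    apply: le_trans (normr_Re_le _) _.
    by rewrite modcM modc_conj ler_wpM2l.
  have tk : t * r ^+ 2 <= 1 / 8.
    by rewrite /t mulrAC er ler_pdivrMr //; move: Am1 k2 k0; clear; lra.
  have fz := cmax z zr; rewrite xE -/v -/A in fz.
  have Q : (1 - 2 * t * x - t * ww) * (1 + 2 * t * x + t ^+ 2 * v ^+ 2 * ww)
      <= 1 - t * ww / 2.
    have tw : t * ww <= 1 / 8 by apply: le_trans tk; rewrite ler_wpM2l // ltW.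
    have tw0 : 0 <= t * ww by rewrite mulr_ge0 ?sqr_ge0 ?ltW.
    apply: max_modulus_ineq.
    - rewrite normrM normrM [ `|t|]gtr0_norm // [ `|2|]gtr0_norm //.
      have : t * `|x| <= t * (v * r) by rewrite ler_wpM2l // ltW.
      have : t * (v * r) <= t * r ^+ 2.
        by rewrite ler_wpM2l ?(ltW t0) // expr2 ler_wpM2r // ltW.
      by move: tk; clear; lra.
    - apply/andP; split; first by apply: mulr_ge0; [rewrite mulr_ge0 ?sqr_ge0|exact: sqr_ge0].
      have -> : t ^+ 2 * v ^+ 2 * ww = (t * v ^+ 2) * (t * ww) by ring.
      rewrite [t * ww / 8]mulrC ler_wpM2r //.
      have : t * v ^+ 2 <= t * r ^+ 2 by rewrite ler_wpM2l // ltW.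
      by move: tk; clear; lra.
    - by apply/andP.
  rewrite /g modcM exprMn -/u bE.
  have f2 : modc (f z) ^+ 2 <= A * (1 - 2 * t * x - t * ww).
    have -> : A * (1 - 2 * t * x - t * ww) = A - 2 * e * x - e * ww.
      by rewrite /t; field; rewrite gt_eqF.
    by move: fz; clear; lra.
  apply: (@le_trans _ _ (A * (1 - 2 * t * x - t * ww) *
      (1 + 2 * t * x + t ^+ 2 * v ^+ 2 * ww))).
    by rewrite ler_wpM2r // -bE sqr_ge0.
  rewrite -mulrA; apply: le_trans (ler_wpM2l (ltW A0) Q) _.
  have -> : A * (1 - t * ww / 2) = A - e * ww / 2.
    by rewrite /t; field; rewrite gt_eqF.
  have : e * (rho ^+ 2 / 4) <= e * ww by rewrite ler_wpM2l // ltW.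
  by clear; lra.
have gM z : csq_edge c rho z -> modc (g z) <= Num.sqrt (A - e * rho ^+ 2 / 8).
  move=> /edge ge; rewrite -[X in X <= _](ger0_norm (modc_ge0 _)) -sqrtr_sqr.
  by rewrite ler_wsqrtr.
have := local_max_modulus rho0 gd gM.
rewrite /g subrr mulr0 addr0 mulr1 => H.
have e80 : 0 < e * rho ^+ 2 / 8 by rewrite divr_gt0 // mulr_gt0 // exprn_gt0.
have := lerXn2r 2 (_ : modc (f c) \is Num.nneg) (_ : _ \is Num.nneg) H.
rewrite !nnegrE modc_ge0 sqrtr_ge0 => /(_ isT isT); rewrite -/A.
have [B0|B0] := lerP 0 (A - e * rho ^+ 2 / 8).
  by rewrite sqr_sqrtr //; move: e80; clear; lra.
by rewrite ler0_sqrtr ?(ltW B0) // expr0n /=; move: A0; clear; lra.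
Qed.

End MaximumModulus.

(** * Difference quotients are holomorphic at their centre *)

Section RemovableSingularity.
Variable R : realType.
Implicit Types (f F G : R[i] -> R[i]) (p h z w a l u : R[i]) (r rho M : R).

(** A limit without a limiting process: every [g u - m u] lies below every [g v + m v], and the
    supremum of the former separates them. *)
Lemma quasi_cauchy_real (T : Type) (S : set T) (g m : T -> R) :
  (forall (u v : T), S u -> S v -> g u - g v <= m u + m v) ->
  exists L, forall u : T, S u -> `|g u - L| <= m u.
Proof.
move=> gm; have [[u0 Su0]|S0] := pselect (S !=set0); last first.
  by exists 0 => u Su; exfalso; apply: S0; exists u.
pose E := [set g u - m u | u in S].
have Eub v : S v -> ubound E (g v + m v).
  by move=> Sv _ [u Su <-]; have := gm u v Su Sv; lra.
exists (sup E) => u Su; rewrite ler_norml.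
have h1 : sup E <= g u + m u by apply: ge_sup; [exists (g u0 - m u0); exists u0|exact: Eub].
have h2 : g u - m u <= sup E.
  by apply: ub_le_sup; [exists (g u0 + m u0); exact: Eub|exists u].
lra.
Qed.

Lemma quasi_cauchy (S : set R[i]) (g : R[i] -> R[i]) (m : R[i] -> R) :
  (forall u v, S u -> S v -> modc (g u - g v) <= m u + m v) ->
  exists L, forall u, S u -> modc (g u - L) <= 2 * m u.
Proof.
move=> gm.
have [|L1 L1P] := @quasi_cauchy_real _ S (fun u => complex.Re (g u)) m.
  by move=> u v Su Sv; rewrite -cReB (le_trans (Re_le_modc _)) ?gm.
have [|L2 L2P] := @quasi_cauchy_real _ S (fun u => complex.Im (g u)) m.
  move=> u v Su Sv; rewrite -cImB; apply: le_trans (gm u v Su Sv).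
  exact: le_trans (ler_norm _) (normr_Im_le _).
exists (L1 +i* L2) => u Su; apply: le_trans (modc_le_ReIm _) _.
by rewrite cReB cImB /=; have := L1P u Su; have := L2P u Su; lra.
Qed.

(** The geometric series of [1 / (z - w)] in powers of [(w - a) / (z - a)], stopped at third order
    with its exact remainder. *)
Lemma csq_sum_expand n F a rho w : 0 < rho -> modc (w - a) <= rho / 2 ->
  csq_sum n (fun z => F z / (z - w)) a rho =
  csq_sum n (fun z => F z / (z - a)) a rho +
  (w - a) * csq_sum n (fun z => F z / (z - a) ^+ 2) a rho +
  (w - a) ^+ 2 * csq_sum n (fun z => F z / (z - a) ^+ 3) a rho +
  (w - a) ^+ 3 * csq_sum n (fun z => F z / ((z - a) ^+ 3 * (z - w))) a rho.
Proof.
move=> rho0 wa; rewrite /csq_sum -!sq_sumZ -!sq_sumD.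
apply: sq_sum_ext; first lra.
move=> z ze; have /andP[z1 _] := csq_edge_dist (ltW rho0) ze wa.
have aa : modc (a - a) <= rho / 2 by rewrite subrr modc0; lra.
have /andP[z2 _] := csq_edge_dist (ltW rho0) ze aa.
have zw0 : z - w != 0 by rewrite -modc_gt0; lra.
have za0 : z - a != 0 by rewrite -modc_gt0; lra.
have wE : w = z - (z - w) by rewrite opprB addrC subrK.
set s := z - a in za0 *; set t := z - w in zw0 *.
have -> : w - a = s - t by rewrite /s /t; ring.
by field; rewrite za0 zw0.
Qed.

Lemma csq_sum_le n F a rho B : 0 < rho ->
  (forall z, csq_edge a rho z -> modc (F z) <= B) ->
  modc (csq_sum n F a rho) <= 8 * rho * B.
Proof.
move=> rho0 FB; apply: le_trans (@sq_sum_le _ n F _ _ _ B _ FB) _; first lra.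
by rewrite le_eqVlt; apply/orP; left; apply/eqP; ring.
Qed.

Lemma edge_quot_le F a rho B z (k : nat) : 0 < rho -> csq_edge a rho z ->
  modc (F z) <= B -> modc (F z / (z - a) ^+ k) <= B * (2 / rho) ^+ k.
Proof.
move=> rho0 ze FB.
have aa : modc (a - a) <= rho / 2 by rewrite subrr modc0; lra.
have /andP[z1 _] := csq_edge_dist (ltW rho0) ze aa.
rewrite modcM modcV modcX -exprVn; apply: ler_pM => //.
- exact: modc_ge0.
- by rewrite exprn_ge0 // invr_ge0 modc_ge0.
rewrite lerXn2r ?nnegrE ?invr_ge0 ?modc_ge0 //; first by rewrite divr_ge0 //; lra.
by rewrite -[2 / rho]invf_div lef_pV2 ?posrE //; lra.
Qed.

Lemma edge_quot2_le F a rho B z w (k : nat) : 0 < rho -> csq_edge a rho z ->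
  modc (w - a) <= rho / 2 -> modc (F z) <= B ->
  modc (F z / ((z - a) ^+ k * (z - w))) <= B * (2 / rho) ^+ k.+1.
Proof.
move=> rho0 ze wa FB.
have /andP[z1 _] := csq_edge_dist (ltW rho0) ze wa.
rewrite invfM mulrA modcM modcV exprSr (mulrA B); apply: ler_pM.
- exact: modc_ge0.
- by rewrite invr_ge0 modc_ge0.
- exact: edge_quot_le.
by rewrite -[2 / rho]invf_div lef_pV2 ?posrE //; lra.
Qed.

(** The midpoint sums are not known to converge, so the derivative cannot be read off from their
    limits. Instead Cauchy's formula for [F], which is [f] minus its first-order part at [a], is
    expanded in [u] at a finite level [n]. The sum [N1 n] is small because [F] is [o(u)], and then
    [F (a + u) / u ^+ 2] equals [N2 n / c n] up to [O(u)]. Comparing two values of [u] at a common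
    level shows that this quotient is Cauchy as [u] tends to 0; its limit is the derivative
    sought. *)
Lemma diff_quot_differentiable f a l rho : 0 < rho ->
  (forall z, modc (z - a) <= 2 * rho -> differentiable f z) ->
  cdiff f a l -> differentiable (diff_quot f a l) a.
Proof.
move=> rho0 fd fl.
pose F z := f z - f a - l * (z - a).
have Fd z : modc (z - a) <= 2 * rho -> differentiable F z.
  move=> za; have sa : differentiable (fun w => w - a) z by apply: differentiableB.
  have sf : differentiable (fun w => f w - f a) z.
    by apply: differentiableB => //; exact: fd.
  have := differentiableB sf (differentiableM (differentiable_cst (l : R[i]) z) sa).
  exact.
have [B B0 FB] := bounded_on_disc Fd.
have Fsq z : in_csq a rho z -> differentiable F z.
  by move=> /(in_csq_modc (ltW rho0)); exact: Fd.
have FBe z : csq_edge a rho z -> modc (F z) <= B.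
  by move=> /square_edge_in/(in_csq_modc (ltW rho0)); exact: FB.
have Fa : F a = 0 by rewrite /F !subrr mulr0 subrr.
have aa : modc (a - a) <= rho / 2 by rewrite subrr modc0; lra.
pose N0 n := csq_sum n (fun z => F z / (z - a)) a rho.
pose N1 n := csq_sum n (fun z => F z / (z - a) ^+ 2) a rho.
pose N2 n := csq_sum n (fun z => F z / (z - a) ^+ 3) a rho.
pose c n := csq_sum n (fun z => (z - a)^-1) a rho.
pose cw n w := csq_sum n (fun z => (z - w)^-1) a rho.
pose K := 8 * rho * (B * (2 / rho) ^+ 4).
pose K2 := 8 * rho * (B * (2 / rho) ^+ 3).
have i0 : 0 < 2 / rho by rewrite divr_gt0.
have rho_ge0 := ltW rho0; have i_ge0 := ltW i0.
have K0 : 0 <= K by apply: mulr_ge0; apply: mulr_ge0 => //; apply: exprn_ge0.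
have K20 : 0 <= K2 by apply: mulr_ge0; apply: mulr_ge0 => //; apply: exprn_ge0.
have N2le n : modc (N2 n) <= K2.
  by apply: csq_sum_le => // z ze; apply: edge_quot_le => //; exact: FBe.
have cw_ge n w : modc (w - a) <= rho / 2 -> 1 / 4 <= modc (cw n w).
  move=> wa; apply: le_trans (csq_kernel_ge n rho0 wa) _.
  exact: le_trans (ler_norm _) (normr_Im_le _).
have cw_le n w : modc (w - a) <= rho / 2 -> modc (cw n w) <= 16.
  move=> wa; have -> : 16 = 8 * rho * (1 * (2 / rho) ^+ 1) by field; lra.
  apply: csq_sum_le => // z ze.
  have := @edge_quot2_le (fun=> 1) a rho 1 z w 0 rho0 ze wa.
  by rewrite expr0 !mul1r modc1; apply.
pose K3 := 8 * rho * (1 * (2 / rho) ^+ 2).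
have K30 : 0 <= K3 by apply: mulr_ge0; apply: mulr_ge0 => //; apply: exprn_ge0.
(* Lets the kernel at [a + u] be replaced by [c n], which does not depend on [u], with an error of
   one more factor [u]. *)
have cw_lip n w : modc (w - a) <= rho / 2 ->
    modc (cw n w - c n) <= K3 * modc (w - a).
  move=> wa.
  have -> : cw n w - c n =
      (w - a) * csq_sum n (fun z => 1 / ((z - a) ^+ 1 * (z - w))) a rho.
    rewrite /cw /c /csq_sum -[X in _ - X]mul1r -mulNr -!sq_sumZ -sq_sumD.
    apply: sq_sum_ext; first lra.
    move=> z ze; have /andP[z1 _] := csq_edge_dist (ltW rho0) ze wa.
    have /andP[z2 _] := csq_edge_dist (ltW rho0) ze aa.
    have zw0 : z - w != 0 by rewrite -modc_gt0; lra.
    have za0 : z - a != 0 by rewrite -modc_gt0; lra.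
    have -> : w - a = (z - a) - (z - w) by ring.
    by field; rewrite za0 zw0.
  rewrite modcM mulrC ler_wpM2r ?modc_ge0 //; apply: csq_sum_le => // z ze.
  by apply: (@edge_quot2_le (fun=> 1)) => //; rewrite modc1.
(* The value of the Cauchy formula at [a + u], expanded in [u]. *)
have main u (eta : R) : modc u <= rho / 2 -> 0 < eta ->
    exists N, forall n, (N <= n)%N ->
    modc (F (a + u) * cw n (a + u) - u * N1 n - u ^+ 2 * N2 n) <=
      K * modc u ^+ 3 + eta.
  move=> ur eta0; have wa : modc (a + u - a) <= rho / 2 by rewrite addrC addKr.
  have [|n1 n1P] := cauchy_formula rho0 Fsq wa (eta := eta / 2); first lra.
  have [|n2 n2P] := cauchy_formula rho0 Fsq aa (eta := eta / 2); first lra.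
  exists (n1 + n2)%N => n nn.
  have {}n1P := n1P n (leq_trans (leq_addr _ _) nn).
  have {}n2P := n2P n (leq_trans (leq_addl _ _) nn).
  rewrite Fa mul0r subr0 -/(N0 n) in n2P.
  rewrite csq_sum_expand // -/(N0 n) -/(N1 n) -/(N2 n) -/(cw n (a + u)) in n1P.
  move: n1P; rewrite [a + u - a]addrC addKr.
  set E := csq_sum _ _ _ _; set X := F (a + u) * _ => n1P.
  have EK : modc E <= K.
    apply: csq_sum_le => // z ze; apply: edge_quot2_le => //; exact: FBe.
  have -> : X - u * N1 n - u ^+ 2 * N2 n = - (N0 n + u * N1 n + u ^+ 2 * N2 n +
      u ^+ 3 * E - X) + N0 n + u ^+ 3 * E by ring.
  apply: le_trans (modcD _ _) _; rewrite modcM modcX [K * _]mulrC.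
  have : modc u ^+ 3 * modc E <= modc u ^+ 3 * K.
    by rewrite ler_wpM2l // exprn_ge0 // modc_ge0.
  have := modcD (- (N0 n + u * N1 n + u ^+ 2 * N2 n + u ^+ 3 * E - X)) (N0 n).
  rewrite modcN; move: n1P n2P EK; clear; lra.
have Fo (e : R) : 0 < e -> exists2 d : R, 0 < d & forall u, modc u < d ->
    modc (F (a + u)) <= e * modc u.
  move=> e0; have [d d0 dP] := fl e e0; exists d => // u /dP.
  by rewrite /F [a + u - a]addrC addKr.
have N1small (e : R) : 0 < e -> exists N, forall n, (N <= n)%N -> modc (N1 n) <= e.
  move=> e0; have [|d d0 dP] := Fo (e / 64); first lra.
  clear fd fl Fd B0 FB Fsq FBe Fa aa cw_ge K30 cw_lip Fo.
  (* [main] is read at the single real point [u = m]; after division by [m], each term other than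
     [N1 n] is a small fraction of [e]. *)
  pose m := Num.min (rho / 2) (Num.min (d / 2) (Num.min 1 (e / (4 * (K + K2 + 1))))).
  have K1 : 0 < 4 * (K + K2 + 1) by lra.
  have m0 : 0 < m.
    by rewrite !lt_min; apply/and4P; split; rewrite ?divr_gt0.
  have [m1 [m2 [m3 m4]]] : m <= rho / 2 /\ m <= d / 2 /\ m <= 1 /\
      m <= e / (4 * (K + K2 + 1)).
    by rewrite /m !ge_min !lexx !orbT.
  rewrite ler_pdivlMr // in m4.
  have um : modc (m%:C : R[i]) = m by rewrite modc_real gtr0_norm.
  have [||N NP] := main m%:C (e * m / 4); rewrite ?um //; first by rewrite divr_gt0 ?mulr_gt0.
  exists N => n /NP; set X := F _ * _ => H.
  have X1 : modc X <= e / 4 * m.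
    rewrite modcM; have wa : modc (a + m%:C - a) <= rho / 2 by rewrite addrC addKr um.
    have Fm : modc (F (a + m%:C)) <= e / 64 * m by rewrite -{2}um; apply: dP; rewrite um; move: m2 d0; clear; lra.
    have -> : e / 4 * m = (e / 64 * m) * 16 by field.
    by apply: ler_pM; rewrite ?modc_ge0 ?cw_le.
  have m2' : m ^+ 2 <= m by rewrite expr2 ler_piMl // ltW.
  have X2 : modc (m%:C ^+ 2 * N2 n) <= m ^+ 2 * K2.
    by rewrite modcM modcX um ler_wpM2l // sqr_ge0.
  have := modcD (X - m%:C * N1 n - m%:C ^+ 2 * N2 n) (m%:C ^+ 2 * N2 n - X).
  have -> : X - m%:C * N1 n - m%:C ^+ 2 * N2 n + (m%:C ^+ 2 * N2 n - X) =
    - (m%:C * N1 n) by ring.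
  rewrite modcN modcM um => H2.
  have H3 := modcB (m%:C ^+ 2 * N2 n) X.
  have X3 : K * m ^+ 3 <= m * (K * m).
    have -> : K * m ^+ 3 = m * (K * m ^+ 2) by ring.
    by rewrite ler_wpM2l ?(ltW m0) // ler_wpM2l.
  have X4 : m ^+ 2 * K2 = m * (K2 * m) by ring.
  have X5 : m * (m * (4 * (K + K2 + 1))) <= m * e by rewrite ler_wpM2l // ltW.
  rewrite -(ler_pM2l m0); rewrite um in H; have := sqr_ge0 m; have := mulr_ge0 (ltW m0) (ltW e0).
  by move: H H2 H3 X1 X2 X3 X4 X5; clear; lra.
pose C2 := 4 * (K2 + K * rho).
have C20 : 0 <= C2 by rewrite /C2 mulr_ge0 // addr_ge0 // mulr_ge0 // ltW.
have Fquad u : modc u <= rho / 2 -> modc (F (a + u)) <= C2 * modc u ^+ 2.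
  move=> ur; apply/ler_addgt0Pr => e e0.
  clear fd fl Fd B0 FB Fsq FBe Fa aa cw_le K30 cw_lip Fo.
  have u0 := modc_ge0 u.
  pose b := e / (8 * (rho + 1)).
  have b0 : 0 < b by rewrite divr_gt0 //; lra.
  have [n1 n1P] := N1small b b0.
  have [|n2 n2P] := main u (e / 8) ur; first lra.
  have {}n1P := n1P (n1 + n2)%N (leq_addr _ _).
  have {}n2P := n2P (n1 + n2)%N (leq_addl _ _).
  have wa : modc (a + u - a) <= rho / 2 by rewrite addrC addKr.
  have cge := cw_ge (n1 + n2)%N _ wa.
  move: n2P; set n := (n1 + n2)%N; set X := F _ * _ => H.
  have Xge : modc (F (a + u)) * (1 / 4) <= modc X.
    by rewrite modcM ler_wpM2l ?modc_ge0.
  have := modcD (X - u * N1 n - u ^+ 2 * N2 n) (u * N1 n + u ^+ 2 * N2 n).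
  have -> : X - u * N1 n - u ^+ 2 * N2 n + (u * N1 n + u ^+ 2 * N2 n) = X by ring.
  have H3 := modcD (u * N1 n) (u ^+ 2 * N2 n).
  rewrite (modcM u) (modcM (u ^+ 2)) modcX in H3.
  have H4 : modc u * modc (N1 n) <= rho * b by apply: ler_pM => //; rewrite ?modc_ge0 //; move: ur rho0; clear; lra.
  have H5 : modc u ^+ 2 * modc (N2 n) <= modc u ^+ 2 * K2.
    by rewrite ler_wpM2l // sqr_ge0.
  have H6 : K * modc u ^+ 3 <= K * rho * modc u ^+ 2.
    have -> : K * modc u ^+ 3 = K * modc u * modc u ^+ 2 by ring.
    by rewrite ler_wpM2r ?sqr_ge0 // ler_wpM2l //; move: ur rho0; clear; lra.
  have H7 : rho * b <= e / 8.
    have : b * (8 * (rho + 1)) = e by rewrite /b divfK // gt_eqF //; move: rho0; clear; lra.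
    by move: b0; clear; nra.
  rewrite /C2; move: H Xge H3 H4 H5 H6 H7; clear; lra.
pose C3 := C2 * K3 + K.
have C30 : 0 <= C3 by rewrite addr_ge0 // mulr_ge0.
have step3 u (eta : R) : modc u <= rho / 2 -> 0 < eta ->
    exists N, forall n, (N <= n)%N ->
    modc (F (a + u) * c n - u ^+ 2 * N2 n) <= C3 * modc u ^+ 3 + eta.
  move=> ur eta0; have u0 := modc_ge0 u.
  clear fd fl Fd B0 FB Fsq FBe Fa aa cw_le cw_ge Fo.
  have [|n1 n1P] := N1small (eta / (2 * (rho + 1))); first by rewrite divr_gt0 //; lra.
  have [|n2 n2P] := main u (eta / 2) ur; first lra.
  exists (n1 + n2)%N => n nn.
  have {}n1P := n1P n (leq_trans (leq_addr _ _) nn).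
  have {}n2P := n2P n (leq_trans (leq_addl _ _) nn).
  have wa : modc (a + u - a) <= rho / 2 by rewrite addrC addKr.
  have := cw_lip n _ wa; rewrite [a + u - a]addrC addKr => lip.
  have -> : F (a + u) * c n - u ^+ 2 * N2 n =
    (F (a + u) * cw n (a + u) - u * N1 n - u ^+ 2 * N2 n) + u * N1 n -
    F (a + u) * (cw n (a + u) - c n) by ring.
  apply: le_trans (modcB _ _) _.
  have H1 := modcD (F (a + u) * cw n (a + u) - u * N1 n - u ^+ 2 * N2 n) (u * N1 n).
  rewrite !modcM in H1 *.
  have H2 : modc (F (a + u)) * modc (cw n (a + u) - c n) <=
      (C2 * modc u ^+ 2) * (K3 * modc u).
    by apply: ler_pM; rewrite ?modc_ge0 // Fquad.
  have H3 : modc u * modc (N1 n) <= eta / 2.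
    rewrite ler_pdivlMr in n1P; last by move: rho0; clear; lra.
    have := modc_ge0 (N1 n); move: ur u0 n1P rho0; clear; nra.
  have -> : C3 * modc u ^+ 3 = (C2 * modc u ^+ 2) * (K3 * modc u) + K * modc u ^+ 3.
    by rewrite /C3; ring.
  by move: H1 H2 H3 n2P; clear; lra.
pose psi u := F (a + u) / u ^+ 2.
pose S := [set u : R[i] | u != 0 /\ modc u <= rho / 2].
have [L LP] : exists L, forall u, S u -> modc (psi u - L) <= 2 * (4 * C3 * modc u).
  apply: (@quasi_cauchy S psi (fun u => 4 * C3 * modc u)).
  have key u (eta : R) : S u -> 0 < eta -> exists N, forall n, (N <= n)%N ->
      modc (psi u * c n - N2 n) <= C3 * modc u + eta.
    move=> [u0 ur] eta0; have u0' : 0 < modc u by rewrite modc_gt0.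
    have u2 : 0 < modc u ^+ 2 by rewrite exprn_gt0.
    have [|N NP] := step3 u (eta * modc u ^+ 2) ur; first by rewrite mulr_gt0.
    exists N => n /NP H; rewrite -(ler_pM2l u2) -modcX -modcM.
    have -> : u ^+ 2 * (psi u * c n - N2 n) = F (a + u) * c n - u ^+ 2 * N2 n.
      by rewrite /psi; field.
    apply: le_trans H _; rewrite modcX; clear; lra.
  move=> u v Su Sv; apply/ler_addgt0Pr => e e0.
  have [|n1 n1P] := key u (e / 8) Su; first by rewrite divr_gt0.
  have [|n2 n2P] := key v (e / 8) Sv; first by rewrite divr_gt0.
  have {}n1P := n1P (n1 + n2)%N (leq_addr _ _).
  have {}n2P := n2P (n1 + n2)%N (leq_addl _ _).
  set n := (n1 + n2)%N in n1P n2P.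
  have cge : 1 / 4 <= modc (c n) := cw_ge n a aa.
  have := modcB (psi u * c n - N2 n) (psi v * c n - N2 n).
  have -> : psi u * c n - N2 n - (psi v * c n - N2 n) = (psi u - psi v) * c n.
    by ring.
  rewrite modcM => H.
  have : modc (psi u - psi v) * (1 / 4) <= modc (psi u - psi v) * modc (c n).
    by rewrite ler_wpM2l ?modc_ge0.
  by move: n1P n2P H; clear; lra.
apply/cdiffP; exists L => e e0.
pose d := Num.min (rho / 2) (e / (8 * C3 + 1)).
have C31 : 0 < 8 * C3 + 1 by rewrite ltr_wpDl // mulr_ge0.
exists d; first by rewrite lt_min divr_gt0 // divr_gt0.
move=> u; rewrite lt_min => /andP[ur]; rewrite ltr_pdivlMr // => ue.
have [->|u0] := eqVneq u 0; first by rewrite addr0 subrr mulr0 subrr modc0 mulr0.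
have -> : diff_quot f a l (a + u) - diff_quot f a l a - L * u = (psi u - L) * u.
  rewrite /diff_quot eqxx ifN; last by rewrite -subr_eq0 [a + u]addrC addrK.
  by rewrite /psi /F [a + u]addrC addrK; field.
rewrite modcM ler_wpM2r ?modc_ge0 //; apply: le_trans (LP u _) _.
  by split=> //; exact: ltW.
have := modc_ge0 u; move: ue; clear; lra.
Qed.

End RemovableSingularity.

(** * Taylor expansion, Schwarz's lemma and Harnack's inequality *)

Section Consequences.
Variable R : realType.
Implicit Types (f g q : R[i] -> R[i]) (h z w a l u : R[i]) (r rho M : R).

(** On the circle [modc (z - a) >= r / 2], which bounds the quotient by [4 * B / r] there and, by
    the maximum principle, inside. Repeated division gives Taylor expansions. *)
Lemma divide_at f z0 r B a : 0 < r ->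
  (forall z, modc (z - z0) <= r -> differentiable f z) ->
  (forall z, modc (z - z0) <= r -> modc (f z) <= B) ->
  modc (a - z0) <= r / 2 ->
  exists q : R[i] -> R[i],
    [/\ forall z, modc (z - z0) <= r -> differentiable q z,
        forall z, modc (z - z0) <= r -> modc (q z) <= 4 * B / r,
        forall z, f z = f a + (z - a) * q z & cdiff f a (q a)].
Proof.
move=> r0 fd fB ar.
have [l fl] := (iffLR (cdiffP f a)) (fd a (ltac:(lra))).
exists (diff_quot f a l).
have qd z : modc (z - z0) <= r -> differentiable (diff_quot f a l) z.
  move=> zr; have [->|za] := eqVneq z a; last by apply: diff_quot_off => //; exact: fd.
  apply: (@diff_quot_differentiable _ f a l (r / 4)) => //; first lra.
  move=> w wa; apply: fd.
  have := modcD (w - a) (a - z0); rewrite addrA subrK; lra.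
split=> //.
- apply: max_modulus => // z zr.
  have za : r / 2 <= modc (z - a).
    have := modcD (z - a) (a - z0); rewrite addrA subrK; lra.
  have z0' : z - a != 0 by rewrite -modc_gt0; lra.
  rewrite /diff_quot ifN; last by rewrite -subr_eq0.
  rewrite modcM modcV ler_pdivrMr; last lra.
  apply: le_trans (modcB _ _) _.
  have h1 : modc (f z) <= B by apply: fB; rewrite zr.
  have h2 : modc (f a) <= B by apply: fB; lra.
  have B0 := le_trans (modc_ge0 _) h1.
  have : 4 * B / r * (r / 2) <= 4 * B / r * modc (z - a).
    by apply: ler_wpM2l => //; rewrite divr_ge0 ?mulr_ge0 // ltW.
  have -> : 4 * B / r * (r / 2) = 2 * B by field; lra.
  lra.
- move=> z; rewrite /diff_quot; case: eqP => [->|/eqP za].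
    by rewrite subrr mul0r addr0.
  have za0 : z - a != 0 by rewrite subr_eq0.
  by rewrite mulrC divfK // addrC subrK.
- by rewrite /diff_quot eqxx.
Qed.

Lemma cdiff_unique f z l l' : cdiff f z l -> cdiff f z l' -> l = l'.
Proof.
move=> fl fl'; apply/eqP; rewrite -subr_eq0 -modc_eq0 eq_le modc_ge0 andbT.
apply/ler_addgt0Pr => e e0; rewrite add0r.
have [|d d0 dP] := fl (e / 2); first lra.
have [|d' d'0 dP'] := fl' (e / 2); first lra.
pose m := Num.min d d' / 2.
have mm : 0 < Num.min d d' by rewrite lt_min d0.
have m0 : 0 < m by rewrite /m; lra.
have [m1 m2] : m < d /\ m < d'.
  have [] : Num.min d d' <= d /\ Num.min d d' <= d' by rewrite !ge_min !lexx orbT.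
  by rewrite /m; lra.
have um : modc (m%:C : R[i]) = m by rewrite modc_real gtr0_norm.
have h1 := dP m%:C; have h2 := dP' m%:C; rewrite um in h1 h2.
have := modcB (f (z + m%:C) - f z - l' * m%:C) (f (z + m%:C) - f z - l * m%:C).
have -> : f (z + m%:C) - f z - l' * m%:C - (f (z + m%:C) - f z - l * m%:C) =
  (l - l') * m%:C by ring.
rewrite modcM um => h3; rewrite -(ler_pM2r m0).
have := h1 m1; have := h2 m2; lra.
Qed.

Lemma cdiff_derive1 f z l : cdiff f z l -> derive1 f z = l.
Proof.
move=> fl; have /derivable1_diffP df : differentiable f z by apply/cdiffP; exists l.
have df' := df; rewrite /derivable in df'.
apply: (cdiff_unique _ fl) => e e0.
have cv : (fun h => h^-1 *: (f (h *: 1 + z) - f z)) @ 0^' --> derive1 f z.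
  rewrite derive1E; exact: df'.
have /cv : nbhs (derive1 f z) [set y : R[i] | modc (y - derive1 f z) < e].
  by apply/near_modcP; exists e => // h he /=; rewrite addrC addKr.
rewrite /= /dnbhs /within /= => /near_modcP[d d0 dP]; exists d => // h hd.
have [->|h0] := eqVneq h 0.
  by rewrite addr0 subrr mulr0 subrr modc0 mulr0.
have := dP h hd; rewrite add0r => /(_ h0) /= /ltW.
rewrite /GRing.scale /= mulr1 => he.
rewrite -(ler_pdivrMr _ _ (_ : 0 < modc h)) ?modc_gt0 //.
apply: le_trans he; rewrite -modcV -modcM mulrBl mulfK // [h + z]addrC.
by rewrite [_ * h^-1]mulrC.
Qed.

Lemma differentiable_cdiff f z : differentiable f z -> cdiff f z (derive1 f z).
Proof. by move=> /cdiffP[l fl]; rewrite (cdiff_derive1 fl). Qed.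

(** Three successive divisions at [a]. That [K] is uniform in [a] matters when expansions at two
    points are compared. *)
Lemma taylor3 f z0 r : 0 < r ->
  (forall z, modc (z - z0) <= r -> differentiable f z) ->
  exists K : R, forall a, modc (a - z0) <= r / 2 -> exists l2 : R[i],
    forall z, modc (z - z0) <= r ->
      modc (f z - f a - derive1 f a * (z - a) - l2 * (z - a) ^+ 2) <=
        K * modc (z - a) ^+ 3.
Proof.
move=> r0 fd; have [B B0 fB] := bounded_on_disc fd.
exists (4 * (4 * (4 * B / r) / r) / r) => a ar.
have [q1 [q1d q1B fE fa]] := divide_at r0 fd fB ar.
have [q2 [q2d q2B q1E _]] := divide_at r0 q1d q1B ar.
have [q3 [q3d q3B q2E _]] := divide_at r0 q2d q2B ar.
exists (q2 a) => z zr; rewrite (cdiff_derive1 fa).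
have -> : f z - f a - q1 a * (z - a) - q2 a * (z - a) ^+ 2 =
    q3 z * (z - a) ^+ 3.
  by rewrite (fE z) (q1E z) (q2E z); ring.
by rewrite modcM modcX ler_wpM2r ?exprn_ge0 ?modc_ge0 ?q3B.
Qed.

(** The expansions at [z0] and at [z0 + k] are compared at the points [z0] and [z0 + 2 * k]. These
    are symmetric about [z0 + k], so the unknown second coefficient there drops out of the
    difference. *)
Lemma derive1_differentiable f z0 r : 0 < r ->
  (forall z, modc (z - z0) <= r -> differentiable f z) ->
  differentiable (derive1 f) z0.
Proof.
move=> r0 fd; have [K KP] := taylor3 r0 fd.
have [|l2 l2P] := KP z0; first by rewrite subrr modc0; lra.
apply/cdiffP; exists (2 * l2) => e e0.
pose K' := Num.max K 1.
have K'0 : 0 < K' by rewrite lt_max ltr01 orbT.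
have KK' : K <= K' by rewrite le_max lexx.
pose d := Num.min (r / 4) (e / (5 * K')).
have K5 : 0 < 5 * K' by rewrite mulr_gt0.
exists d; first by rewrite lt_min !divr_gt0.
move=> k; rewrite lt_min => /andP[kr]; rewrite ltr_pdivlMr // => ke.
have [->|k0] := eqVneq k 0; first by rewrite addr0 subrr mulr0 subrr modc0 mulr0.
have k0' : 0 < modc k by rewrite modc_gt0.
have m2 : modc (2 : R[i]) = 2 by rewrite -(rmorph_nat (real_complex R)) modc_real normr_nat.
have [|l lP] := KP (z0 + k); first by rewrite addrC addKr; lra.
have h1 := lP (z0 + 2 * k); have h2 := lP z0; have h3 := l2P (z0 + 2 * k).
rewrite [z0 + 2 * k - z0]addrC addKr modcM m2 in h1 h3.
rewrite subrr modc0 in h2.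
have e1 : z0 + 2 * k - (z0 + k) = k by ring.
have e2 : z0 - (z0 + k) = - k by ring.
rewrite e1 in h1; rewrite e2 modcN sqrrN in h2.
have [c1 c2] : modc k <= r /\ 2 * modc k <= r by move: kr r0; clear; lra.
have {}h1 := h1 c2; have {}h2 := h2 (ltW r0); have {}h3 := h3 c2.
set b := z0 + k in h1 h2 *; set c := z0 + 2 * k in h1 h3.
set D := derive1 f b in h1 h2 *; set D0 := derive1 f z0 in h3 *.
set E1 := f c - _ - _ - _ in h1; set E2 := f z0 - _ - _ - _ in h2.
set E3 := f c - _ - _ - _ in h3.
have E : (D - D0 - 2 * l2 * k) * (2 * k) = E3 - E1 + E2.
  by rewrite /E1 /E2 /E3; ring.
have := modcD (E3 - E1) E2; have := modcB E3 E1; rewrite -E !modcM m2 => t1 t2.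
have k3 : 0 <= modc k ^+ 3 by rewrite exprn_ge0 // modc_ge0.
have t3 : K * modc k ^+ 3 <= K' * modc k ^+ 3 by rewrite ler_wpM2r.
rewrite exprMn in h3.
have k2 : 0 < 2 * modc k by rewrite mulr_gt0.
rewrite -(ler_pM2r k2).
(* The remainders at distances [2 * k], [k] and [k] contribute 8, 1 and 1. *)
have t4 : 10 * (K' * modc k ^+ 3) <= e * modc k * (2 * modc k).
  have -> : 10 * (K' * modc k ^+ 3) = 2 * modc k ^+ 2 * (modc k * (5 * K')) by ring.
  have -> : e * modc k * (2 * modc k) = 2 * modc k ^+ 2 * e by ring.
  by apply: ler_wpM2l; [rewrite mulr_ge0 // sqr_ge0|exact: ltW].
by move: h1 h2 h3 t1 t2 t3 t4 k3; clear; lra.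
Qed.

Lemma schwarz g : (forall z, modc z < 1 -> differentiable g z) ->
  (forall z, modc z < 1 -> modc (g z) <= 1) -> g 0 = 0 ->
  forall z, modc z < 1 -> modc (g z) <= modc z.
Proof.
move=> gd g1 g0 z z1; rewrite leNgt; apply/negP => zg.
have gz0 : 0 < modc (g z) by exact: le_lt_trans (modc_ge0 _) zg.
(* A violation at [z] means [t < 1]; a radius strictly between [t] and 1 already contradicts it,
   without a limit of radii. *)
pose t := modc z / modc (g z).
have t0 : 0 <= t by rewrite divr_ge0 ?modc_ge0.
have t1 : t < 1 by rewrite ltr_pdivrMr // mul1r.
have zt : modc z <= t.
  by rewrite ler_pdivlMr // ler_piMr ?modc_ge0 // g1.
pose r := (t + 1) / 2.
have r0 : 0 < r by rewrite /r; lra.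
have r1 : r < 1 by rewrite /r; lra.
have gd' w : modc (w - 0) <= r -> differentiable g w.
  by rewrite subr0 => wr; apply: gd; lra.
have gB w : modc (w - 0) <= r -> modc (g w) <= 1.
  by rewrite subr0 => wr; apply: g1; lra.
have [|q [qd _ gE _]] := divide_at r0 gd' gB (a := 0); first by rewrite subrr modc0; lra.
have qM : forall w, modc (w - 0) <= r -> modc (q w) <= r^-1.
  apply: max_modulus => // w wr.
  have gw : modc (g w) <= 1 by apply: gB; rewrite wr.
  rewrite -(ler_pM2l r0) mulfV ?gt_eqF // -{1}wr -modcM.
  by have := gE w; rewrite g0 add0r => <-.
have := gE z; rewrite g0 add0r subr0 => gzE.
have : modc (q z) <= r^-1 by apply: qM; rewrite subr0; rewrite /r; lra.
rewrite -(ler_pM2l r0) mulfV ?gt_eqF // => H.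
have : modc z * (r * modc (q z)) <= modc z * 1 by rewrite ler_wpM2l ?modc_ge0.
have -> : modc z * (r * modc (q z)) = r * modc (g z) by rewrite gzE modcM; ring.
rewrite mulr1.
have : t * modc (g z) < r * modc (g z) by rewrite ltr_pM2r //; rewrite /r; lra.
rewrite /t divfK ?gt_eqF //; lra.
Qed.

(** Schwarz's lemma for [(f - f 0) / (f + conj (f 0))]. The identity [DN] shows that this maps into
    the disc; combined with the resulting bound it gives a quadratic inequality in [X] and [a],
    whose two linear factors are the two forms of Harnack's inequality. *)
Lemma half_plane_schwarz f : (forall z, modc z < 1 -> differentiable f z) ->
  (forall z, modc z < 1 -> 0 < complex.Re (f z)) ->
  forall z, modc z < 1 ->
  [/\ (1 - modc z) * modc (f z - f 0) <= 2 * modc z * complex.Re (f 0),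
      (1 - modc z) * complex.Re (f z) <= (1 + modc z) * complex.Re (f 0) &
      (1 - modc z) * complex.Re (f 0) <= (1 + modc z) * complex.Re (f z)].
Proof.
move=> fd fp z z1.
have a0 : 0 < complex.Re (f 0) by apply: fp; rewrite modc0.
set a := complex.Re (f 0) in a0 *.
pose N w := f w - f 0; pose D w := f w + (f 0)^*%C.
have DN w : modc (D w) ^+ 2 - modc (N w) ^+ 2 = 4 * complex.Re (f w) * a.
  by rewrite /D /N /a !modc_sqr; case: (f w) => u v; case: (f 0) => c e /=; ring.
have D0 w : modc w < 1 -> 0 < modc (D w).
  move=> w1; rewrite modc_gt0 -modc_eq0 -sqrf_eq0 gt_eqF //.
  have := DN w; have := sqr_ge0 (modc (N w)).
  have : 0 < 4 * complex.Re (f w) * a by rewrite !mulr_gt0 // fp.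
  lra.
have Dn0 w : modc w < 1 -> D w != 0 by rewrite -modc_gt0; exact: D0.
have H : modc (N z / D z) <= modc z.
  have N0 : N 0 / D 0 = 0 by rewrite /N subrr mul0r.
  apply: (@schwarz (fun w => N w / D w) _ _ N0 z z1) => w w1; last first.
  - rewrite modcM modcV ler_pdivrMr ?D0 // mul1r.
    rewrite -(@ler_pXn2r _ 2) ?nnegrE ?modc_ge0 //.
    have := DN w; have : 0 < 4 * complex.Re (f w) * a by rewrite !mulr_gt0 // fp.
    lra.
  - have Nd := differentiableB (fd w w1) (differentiable_cst (f 0) w).
    have Dd := differentiableD (fd w w1) (differentiable_cst (f 0)^*%C w).
    by have := differentiableM Nd (differentiableV Dd (Dn0 w w1)).
rewrite modcM modcV ler_pdivrMr ?D0 // in H.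
have t0 := modc_ge0 z; set t := modc z in t0 z1 H *.
have X0 := fp z z1; have NR := Re_le_modc (N z).
split.
- have := modcD (N z) (2 * a%:C).
  have -> : N z + 2 * a%:C = D z.
    rewrite /N /D /a; case: (f 0) => c e; case: (f z) => u v.
    by apply/eqP; rewrite eq_complex /=; apply/andP; split; apply/eqP; ring.
  rewrite modcM modc_real gtr0_norm // -[2 in X in _ <= _ + X](rmorph_nat (real_complex R)) modc_real normr_nat.
  move=> DD; have : t * modc (D z) <= t * (modc (N z) + 2 * a) by rewrite ler_wpM2l.
  rewrite /N -/(N z); move: H DD; clear; lra.
all: have DNz := DN z; set X := complex.Re (f z) in X0 DNz *.
all: have Q : (1 - t ^+ 2) * (X ^+ 2 + a ^+ 2) <= 2 * (1 + t ^+ 2) * (X * a).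
  1,3: have HH : modc (N z) ^+ 2 <= t ^+ 2 * modc (D z) ^+ 2
    by rewrite -exprMn lerXn2r ?nnegrE ?mulr_ge0 ?modc_ge0.
  1,2: have XX : (X + a) ^+ 2 <= modc (D z) ^+ 2
    by rewrite /D modc_sqr /X /a; case: (f 0) => c e; case: (f z) => u v /=;
       rewrite lerDl sqr_ge0.
  1,2: have t2 : 0 <= 1 - t ^+ 2 by rewrite subr_ge0 expr_le1 // ltW.
  1,2: have : (1 - t ^+ 2) * (X + a) ^+ 2 <= (1 - t ^+ 2) * modc (D z) ^+ 2
    by rewrite ler_wpM2l.
  1,2: nra.
all: have QE : ((1 + t) * X - (1 - t) * a) * ((1 - t) * X - (1 + t) * a) =
    (1 - t ^+ 2) * (X ^+ 2 + a ^+ 2) - 2 * (1 + t ^+ 2) * (X * a) by ring.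
- rewrite leNgt; apply/negP => bad.
  have : 0 < ((1 + t) * X - (1 - t) * a) * ((1 - t) * X - (1 + t) * a).
    rewrite mulr_gt0 //; last lra.
    nra.
  rewrite QE; lra.
- rewrite leNgt; apply/negP => bad.
  have : 0 < (- ((1 + t) * X - (1 - t) * a)) * - ((1 - t) * X - (1 + t) * a).
    rewrite mulr_gt0 //; first lra.
    nra.
  rewrite mulrNN QE; lra.
Qed.

End Consequences.

(** * Hermitian space *)

Section HermitianSpace.
Variables (R : realType) (d : nat).
Local Notation V := 'rV[R[i]]_d.
Implicit Types (u v w x y : V) (c : R[i]) (t : R).

(** Linear in the first argument, so that [hip (z - y) v] is holomorphic in [z]. *)
Definition hip u v : R[i] := \sum_j u 0 j * (v 0 j)^*%C.

Lemma hipDl u v w : hip (u + v) w = hip u w + hip v w.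
Proof. by rewrite /hip -big_split; apply: eq_bigr => j _; rewrite mxE mulrDl. Qed.

Lemma hipZl c u v : hip (c *: u) v = c * hip u v.
Proof. by rewrite /hip mulr_sumr; apply: eq_bigr => j _; rewrite mxE mulrA. Qed.

Lemma hipNl u v : hip (- u) v = - hip u v.
Proof. by rewrite -scaleN1r hipZl mulN1r. Qed.

Lemma hipBl u v w : hip (u - v) w = hip u w - hip v w.
Proof. by rewrite hipDl hipNl. Qed.

Lemma hip0l v : hip 0 v = 0.
Proof. by rewrite -(scale0r v) hipZl mul0r. Qed.

Lemma hip_conj u v : hip v u = (hip u v)^*%C.
Proof.
rewrite /hip rmorph_sum /=; apply: eq_bigr => j _.
by rewrite rmorphM /= conjcK mulrC.
Qed.

Lemma hipDr u v w : hip u (v + w) = hip u v + hip u w.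
Proof. by rewrite hip_conj hipDl rmorphD /= -!hip_conj. Qed.

Lemma hipZr c u v : hip u (c *: v) = c^*%C * hip u v.
Proof. by rewrite hip_conj hipZl rmorphM /= -hip_conj. Qed.

Lemma hipNr u v : hip u (- v) = - hip u v.
Proof. by rewrite hip_conj hipNl rmorphN /= -hip_conj. Qed.

Lemma hipBr u v w : hip u (v - w) = hip u v - hip u w.
Proof. by rewrite hipDr hipNr. Qed.

Lemma Re_sum (I : Type) (s : seq I) (F : I -> R[i]) :
  complex.Re (\sum_(i <- s) F i) = \sum_(i <- s) complex.Re (F i).
Proof. by elim/big_rec2: _ => // i y1 y2 _ <-; rewrite cReD. Qed.

Local Notation enorm := (@euclidean_norm R d).

Lemma enorm_sum_ge0 v : 0 <= \sum_j (complex.Re (v 0 j) ^+ 2 + complex.Im (v 0 j) ^+ 2).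
Proof. by apply: sumr_ge0 => j _; rewrite addr_ge0 ?sqr_ge0. Qed.

Lemma enorm_ge0 v : 0 <= enorm v.
Proof. exact: sqrtr_ge0. Qed.

Lemma sqr_enorm v : enorm v ^+ 2 = complex.Re (hip v v).
Proof.
rewrite /euclidean_norm sqr_sqrtr ?enorm_sum_ge0 // /hip Re_sum.
by apply: eq_bigr => j _; case: (v 0 j) => a b /=; ring.
Qed.

Lemma Re_hipC u v : complex.Re (hip u v) = complex.Re (hip v u).
Proof. by rewrite (hip_conj v u); case: (hip v u). Qed.

Lemma enormZ c v : enorm (c *: v) = modc c * enorm v.
Proof.
apply/eqP; rewrite -(@eqrXn2 _ 2) ?mulr_ge0 ?enorm_ge0 ?modc_ge0 //.
rewrite exprMn !sqr_enorm hipZl hipZr mulrA modc_sqr.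
have -> : c * c^*%C = (complex.Re c ^+ 2 + complex.Im c ^+ 2)%:C.
  case: c => a b; apply/eqP; rewrite eq_complex /=.
  by apply/andP; split; apply/eqP; ring.
by rewrite cReZ.
Qed.

Lemma enormN v : enorm (- v) = enorm v.
Proof. by rewrite -scaleN1r enormZ modcN modc1 mul1r. Qed.

Lemma enorm0 : enorm 0 = 0.
Proof. by rewrite -(scale0r 0) enormZ modc0 mul0r. Qed.

Lemma modc_le_enorm v j : modc (v 0 j) <= enorm v.
Proof.
rewrite -(@ler_pXn2r _ 2) ?nnegrE ?enorm_ge0 ?modc_ge0 //.
rewrite /euclidean_norm sqr_sqrtr ?enorm_sum_ge0 // (bigD1 j) //= modc_sqr lerDl.
by apply: sumr_ge0 => k _; rewrite addr_ge0 ?sqr_ge0.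
Qed.

Lemma enorm_eq0 v : (enorm v == 0) = (v == 0).
Proof.
apply/eqP/eqP => [v0|->]; last exact: enorm0.
apply/rowP => j; rewrite mxE; apply/eqP; rewrite -modc_eq0 eq_le modc_ge0 andbT.
by rewrite -v0 modc_le_enorm.
Qed.

Lemma enorm_gt0 v : (0 < enorm v) = (v != 0).
Proof. by rewrite lt_def enorm_eq0 enorm_ge0 andbT. Qed.

Lemma cauchy_schwarz u v : complex.Re (hip u v) <= enorm u * enorm v.
Proof.
have [->|u0] := eqVneq u 0; first by rewrite hip0l enorm0 mul0r.
have [->|v0] := eqVneq v 0.
  by rewrite hip_conj hip0l conjc0 enorm0 mulr0.
have a0 : 0 < enorm u by rewrite enorm_gt0.
have b0 : 0 < enorm v by rewrite enorm_gt0.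
have := sqr_ge0 (enorm ((enorm v)%:C *: u - (enorm u)%:C *: v)).
rewrite sqr_enorm !(hipBl, hipBr, hipZl, hipZr, conjc_real).
rewrite !(cReB, cReZ) -!sqr_enorm (Re_hipC v u).
set a := enorm u in a0 *; set b := enorm v in b0 *; set p := complex.Re _ => H.
have {}H : 0 <= (2 * a * b) * (a * b - p) by lra.
by rewrite -subr_ge0 -(pmulr_rge0 _ (_ : 0 < 2 * a * b)) // !mulr_gt0.
Qed.

Lemma enormD u v : enorm (u + v) <= enorm u + enorm v.
Proof.
rewrite -(@ler_pXn2r _ 2) ?nnegrE ?addr_ge0 ?enorm_ge0 //.
rewrite sqr_enorm !(hipDl, hipDr) !cReD -!sqr_enorm (Re_hipC v u).
have := cauchy_schwarz u v; lra.
Qed.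

Lemma enormB u v : enorm (u - v) <= enorm u + enorm v.
Proof. by rewrite -(enormN v) enormD. Qed.

Lemma enorm_distC u v : enorm (u - v) = enorm (v - u).
Proof. by rewrite -enormN opprB. Qed.

Lemma enorm_le_sum v : enorm v <= \sum_j modc (v 0 j).
Proof.
rewrite -(@ler_pXn2r _ 2) ?nnegrE ?enorm_ge0 ?sumr_ge0 //; last first.
  by move=> j _; exact: modc_ge0.
rewrite {1}/euclidean_norm sqr_sqrtr ?enorm_sum_ge0 // expr2 mulr_sumr.
apply: ler_sum => j _; rewrite -modc_sqr expr2 ler_wpM2r ?modc_ge0 //.
by rewrite (bigD1 j) //= lerDl sumr_ge0 // => k _; exact: modc_ge0.
Qed.

Lemma near_enormP x (P : V -> Prop) :
  (\forall z \near x, P z) <->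
  exists2 e : R, 0 < e & forall h, enorm h < e -> P (x + h).
Proof.
split.
  move=> [A Anb AP].
  have /fin_all_exists2[e e0 eP] : forall j : 'I_d, exists2 e : R, 0 < e &
      forall h, modc h < e -> A 0 j (x 0 j + h).
    by move=> j; apply/near_modcP; exact: Anb.
  pose m := \big[Num.min/1]_j e j.
  exists m; first by rewrite /m; elim/big_ind: _ => // a b a0 b0; rewrite lt_min a0.
  move=> h hm; apply: AP => i j; rewrite ord1 mxE; apply: eP.
  apply: le_lt_trans (modc_le_enorm h j) (lt_le_trans hm _).
  by rewrite /m (bigD1 j) //= ge_min lexx.
move=> [e e0 eP].
have d0 : 0 < d%:R + 1 :> R by rewrite ltr_wpDl ?ler0n.
pose r := e / (d%:R + 1).
have r0 : 0 < r by rewrite divr_gt0.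
exists (fun i j => [set z | modc (z - x i j) < r]).
  by move=> i j; apply/near_modcP; exists r => // h hr /=; rewrite addrC addKr.
move=> z /= zA; rewrite -[z](subrK x) addrC; apply: eP.
apply: le_lt_trans (enorm_le_sum _) _.
apply: (@le_lt_trans _ _ (\sum_(j < d) r)).
  by apply: ler_sum => j _; have := zA 0 j; rewrite !mxE; exact: ltW.
rewrite sumr_const card_ord -mulr_natl /r mulrA ltr_pdivrMr //.
lra.
Qed.

Lemma open_enormP (A : set V) : open A ->
  forall x, A x -> exists2 e : R, 0 < e & forall h, enorm h < e -> A (x + h).
Proof. by move=> oA x Ax; apply/near_enormP; exact: open_nbhs_nbhs. Qed.

Lemma closure_enormP (A : set V) x : closure A x ->
  forall e : R, 0 < e -> exists2 h, enorm h < e & A (x + h).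
Proof.
move=> cl e e0; have /cl[z [Az /= ze]] : nbhs x [set z | enorm (z - x) < e].
  by apply/near_enormP; exists e => // h he /=; rewrite addrC addKr.
by exists (z - x) => //; rewrite addrC subrK.
Qed.

Lemma convex_enorm (A : set V) : convex_set A -> forall x y t, A x -> A y ->
  0 <= t <= 1 -> A (x + t%:C *: (y - x)).
Proof.
move=> cA x y t Ax Ay /andP[t0 t1].
have t0' : 0 <= t%:C :> R[i] by rewrite lecR.
have t1' : t%:C <= 1 :> R[i] by rewrite -(rmorph1 (real_complex R)) lecR.
have /set_mem := cA y x (Itv01 t0' t1') (mem_set Ay) (mem_set Ax).
congr (A _); rewrite /conv /=.
by rewrite /unstable.onem scalerBl scale1r scalerBr addrCA.
Qed.

Lemma modc_le_mx_norm v j : `|v 0 j| <= `|v|.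
Proof.
have -> : `|v| = (\big[Num.max/0%:nng]_i `|v i.1 i.2|%:nng)%:num :> R[i].
  exact: mx_normE.
rewrite -[leLHS]nngE num_le.
exact: (le_bigmax _ (fun i : 'I_1 * 'I_d => `|v i.1 i.2|%:nng) (0, j)).
Qed.

Lemma bounded_enorm (A : set V) : bounded_set A ->
  exists2 D : R, 0 < D & forall x y, A x -> A y -> enorm (x - y) <= D.
Proof.
case=> M [Mreal MP].
have [k kE] : exists k : R, M = k%:C by move: Mreal => /complex_realP.
have H x : A x -> enorm x <= d%:R * (`|k| + 1).
  move=> Ax; apply: le_trans (enorm_le_sum _) _.
  have -> : d%:R * (`|k| + 1) = \sum_(j < d) (`|k| + 1).
    by rewrite sumr_const card_ord mulr_natl.
  apply: ler_sum => j _; rewrite -lecR -normc_modc.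
  apply: le_trans (modc_le_mx_norm _ _) _.
  apply: (MP (`|k| + 1)%:C) => //; rewrite kE ltcR.
  by have := ler_norm k; lra.
exists (2 * (d%:R * (`|k| + 1)) + 1).
  have : 0 <= d%:R * (`|k| + 1) by rewrite mulr_ge0 ?ler0n ?addr_ge0.
  lra.
move=> x y Ax Ay; apply: le_trans (enormB _ _) _.
have := H x Ax; have := H y Ay; lra.
Qed.

End HermitianSpace.

(** * Real differentiability *)

Section RealDerivative.
Variable R : realType.
Implicit Types (f g : R -> R) (s t l e : R).

Lemma near_realP (x : R) (P : R -> Prop) :
  (\forall z \near x, P z) <->
  exists2 e : R, 0 < e & forall h, `|h| < e -> P (x + h).
Proof.
split=> [/nbhs_normP[/= e e0 eP]|[e e0 eP]].
  by exists e => // h he; apply: eP; rewrite /= opprD addNKr normrN.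
apply/nbhs_normP; exists e => // z /=; rewrite distrC => /eP.
by rewrite addrC subrK.
Qed.

Definition rdiff g s l := forall e, 0 < e -> exists2 d, 0 < d &
  forall t, `|t| < d -> `|g (s + t) - g s - l * t| <= e * `|t|.

Lemma rdiff_cvg g s l :
  rdiff g s l <-> (fun h => h^-1 *: (g (h *: 1 + s) - g s)) @ 0^' --> l.
Proof.
split=> [gl A /= /near_realP[e e0 eA]|gl e e0].
  have [|d d0 dP] := gl (e / 2); first lra.
  rewrite /dnbhs /within /=; apply/near_realP; exists d => // h hd.
  rewrite add0r => h0 /=; rewrite -(subrK l (_ *: _)) addrC; apply: eA.
  apply: (@le_lt_trans _ _ (e / 2)); last lra.
  have h0' : 0 < `|h| by rewrite normr_gt0.
  have := dP h hd; rewrite -ler_pdivrMr //; apply: le_trans.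
  rewrite -normfV -normrM mulrBl mulfK // /GRing.scale /= mulr1 [h + s]addrC.
  by rewrite [_ * h^-1]mulrC.
have /gl : nbhs l [set y : R | `|y - l| < e].
  by apply/near_realP; exists e => // h he /=; rewrite addrC addKr.
rewrite /= /dnbhs /within /= => /near_realP[d d0 dP]; exists d => // h hd.
have [->|h0] := eqVneq h 0.
  by rewrite addr0 subrr mulr0 subrr normr0 mulr0.
have := dP h hd; rewrite add0r => /(_ h0) /= /ltW.
rewrite /GRing.scale /= mulr1 => he.
rewrite -(ler_pdivrMr _ _ (_ : 0 < `|h|)) ?normr_gt0 //.
apply: le_trans he; rewrite -normfV -normrM mulrBl mulfK // [h + s]addrC.
by rewrite [_ * h^-1]mulrC.
Qed.

Lemma rdiffP g s l : rdiff g s l <-> derivable g s 1 /\ derive1 g s = l.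
Proof.
rewrite derive1E; split=> [/rdiff_cvg gl|[gd <-]].
  split; first by apply/cvg_ex; exists l.
  by apply: cvg_lim => //; exact: norm_hausdorff.
by apply/rdiff_cvg; exact: gd.
Qed.

Lemma rdiff_near f g s l :
  (exists2 d, 0 < d & forall t, `|t| < d -> f (s + t) = g (s + t)) ->
  rdiff f s l -> rdiff g s l.
Proof.
move=> [d d0 fg] fl e e0; have [d' d'0 dP] := fl e e0.
exists (Num.min d d') => [|t]; first by rewrite lt_min d0.
rewrite lt_min => /andP[td td'].
have gs : f s = g s by have := fg 0; rewrite normr0 addr0; exact.
by rewrite -gs -fg // dP.
Qed.

Lemma rdiffD f g s l m : rdiff f s l -> rdiff g s m ->
  rdiff (fun t => f t + g t) s (l + m).
Proof.
move=> fl gm e e0.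
have [|d d0 dP] := fl (e / 2); first lra.
have [|d' d'0 dP'] := gm (e / 2); first lra.
exists (Num.min d d') => [|t]; first by rewrite lt_min d0.
rewrite lt_min => /andP[/dP h1 /dP' h2].
have -> : f (s + t) + g (s + t) - (f s + g s) - (l + m) * t =
  (f (s + t) - f s - l * t) + (g (s + t) - g s - m * t) by ring.
by apply: le_trans (ler_normD _ _) _; lra.
Qed.

Lemma rdiffM f g s l m : rdiff f s l -> rdiff g s m ->
  rdiff (fun t => f t * g t) s (l * g s + f s * m).
Proof.
move=> /rdiffP[fd fl] /rdiffP[gd gm].
have := @is_deriveM _ _ f g s 1 l m.
rewrite derive1E in fl; rewrite derive1E in gm.
move=> /(_ (DeriveDef fd fl) (DeriveDef gd gm))[H1 H2].
apply/rdiffP; split; first exact: H1.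
by rewrite derive1E; etransitivity; [exact: H2|rewrite /GRing.scale /=; ring].
Qed.

Lemma rdiff_cst (c s : R) : rdiff (fun=> c) s 0.
Proof. by move=> e e0; exists 1 => // t _; rewrite subrr mul0r subrr normr0 mulr_ge0 // ltW. Qed.

Lemma rdiff_cont g s l : rdiff g s l -> {for s, continuous g}.
Proof.
by move=> /rdiffP[gd _]; apply: differentiable_continuous; apply/derivable1_diffP.
Qed.

Lemma rdiff_mvt g c (a M : R) :
  (forall s, `|s| <= `|c| -> exists2 l, rdiff g s l & `|l - a| <= M) ->
  `|g c - g 0 - c * a| <= M * `|c|.
Proof.
move=> H.
have [df dfP] : exists df : R -> R, forall s, `|s| <= `|c| ->
    rdiff g s (df s) /\ `|df s - a| <= M.
  exists (derive1 g) => s /H[l gl lM].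
  have /rdiffP[_ ->] := gl; by split.
have mv u v : u <= v -> (forall s, u <= s <= v -> `|s| <= `|c|) ->
    exists2 s, `|s| <= `|c| & g v - g u = df s * (v - u).
  move=> uv uvc.
  have [||s] := @MVT_segment _ g df u v uv.
  - move=> s; rewrite in_itv /= => /andP[us sv].
    have [|/rdiffP[gd ge] _] := dfP s.
      by apply: uvc; rewrite !ltW.
    by rewrite derive1E in ge; exact: DeriveDef.
  - apply: continuous_in_subspaceT => s; rewrite inE /= in_itv /= => us.
    by have [/rdiff_cont] := dfP s (uvc s us).
  by rewrite in_itv /= => us E; exists s => //; exact: uvc.
have fin s : `|s| <= `|c| -> g c - g 0 = df s * c -> `|g c - g 0 - c * a| <= M * `|c|.
  move=> sc ->; have [_ sM] := dfP s sc.
  have -> : df s * c - c * a = (df s - a) * c by ring.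
  by rewrite normrM ler_wpM2r.
have [c0|c0] := lerP 0 c.
  have [|s sc E] := mv 0 c c0.
    by move=> s /andP[s0 s1]; rewrite !ger0_norm.
  by apply: (fin s sc); rewrite E subr0.
have [|s sc E] := mv c 0 (ltW c0).
  by move=> s /andP[s0 s1]; rewrite !ler0_norm ?lerN2 // ltW.
apply: (fin s sc); have : g c - g 0 = - (g 0 - g c) by rewrite opprB.
by rewrite E sub0r mulrN opprK.
Qed.

End RealDerivative.

Section RealFrame.
Variables (R : realType) (V : normedModType R[i]).
Implicit Types (f : V -> R) (x y z v w h : V) (s t l : R).

Definition ldiff f v z l := rdiff (f \o real_line z v) 0 l.

Lemma ldiffP f v z l : ldiff f v z l <->
  derivable (f \o real_line z v) 0 1 /\ real_derive f v z = l.
Proof. exact: rdiffP. Qed.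

Lemma ldiff_shift f v z s l :
  ldiff f v (z + s%:C *: v) l <-> rdiff (f \o real_line z v) s l.
Proof.
rewrite /ldiff /rdiff /real_line /=.
have E t : z + s%:C *: v + t%:C *: v = z + (s + t)%:C *: v.
  by rewrite rmorphD /= scalerDl addrA.
by split=> H e e0; have [d d0 dP] := H e e0; exists d => // t /dP;
  rewrite add0r scale0r addr0 E.
Qed.

(* [N] stands for the modulus on R[i] and for the Euclidean norm on C^d, the
   norms of the library being R[i]-valued and, on C^d, the sup norm. *)
Variables (N : V -> R) (I : finType) (E : I -> V) (co : V -> I -> R).
Hypothesis nearN : forall z (P : V -> Prop), (\forall w \near z, P w) <->
  exists2 e : R, 0 < e & forall h, N h < e -> P (z + h).
Hypothesis N_ge0 : forall v, 0 <= N v.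
Hypothesis ND : forall v w, N (v + w) <= N v + N w.
Hypothesis NZ : forall s v, N (s%:C *: v) = `|s| * N v.
Hypothesis NE : forall k, N (E k) <= 1.
Hypothesis co_le : forall v k, `|co v k| <= N v.
Hypothesis co_span : forall v, v = \sum_k (co v k)%:C *: E k.
Hypothesis coD : forall v w k, co (v + w) k = co v k + co w k.
Hypothesis coZ : forall s v k, co (s%:C *: v) k = s * co v k.

Local Notation K := (#|I|%:R + 1 : R).

Lemma K_gt0 : 0 < K. Proof. by rewrite ltr_wpDl ?ler0n. Qed.

Lemma N0 : N 0 = 0.
Proof. by rewrite -(scale0r 0) (NZ 0) normr0 mul0r. Qed.

Lemma line_mvt f v z c (a M : R) :
  (forall s, `|s| <= `|c| ->
     exists2 l, ldiff f v (z + s%:C *: v) l & `|l - a| <= M) ->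
  `|f (z + c%:C *: v) - f z - c * a| <= M * `|c|.
Proof.
move=> H; have := @rdiff_mvt _ (f \o real_line z v) c a M.
rewrite /real_line /= scale0r addr0; apply=> s /H[l /ldiff_shift fl lM].
by exists l.
Qed.

Lemma frame_mvt f y h (a : I -> R) (M : R) :
  (forall k w, N w <= K * N h ->
     exists2 l, ldiff f (E k) (y + w) l & `|l - a k| <= M) ->
  `|f (y + h) - f y - \sum_k co h k * a k| <= M * (K * N h).
Proof.
move=> H.
have M0 (k : I) : 0 <= M.
  have [|l _] := H k 0; first by rewrite N0 mulr_ge0 ?(ltW K_gt0).
  exact: le_trans.
have partial (r : seq I) : (size r <= #|I|)%N ->
    `|f (y + \sum_(k <- r) (co h k)%:C *: E k) - f y - \sum_(k <- r) co h k * a k|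
      <= M * ((size r)%:R * N h) /\
    N (\sum_(k <- r) (co h k)%:C *: E k) <= (size r)%:R * N h.
  elim: r => [_|k r IH sr].
    by rewrite !big_nil addr0 !subr0 subrr normr0 mul0r mulr0 N0.
  have [h1 h2] := IH (ltnW sr).
  rewrite !big_cons; set S := \sum_(j <- r) _ *: _ in h1 h2 *.
  set T := \sum_(j <- r) _ in h1 *.
  have NkE : `|co h k| * N (E k) <= N h.
    by apply: (@le_trans _ _ (N h * 1)); [apply: ler_pM|rewrite mulr1].
  split; last first.
    rewrite -natr1 mulrDl mul1r; apply: le_trans (ND _ _) _.
    by rewrite [leLHS]addrC lerD // NZ.
  have step : `|f (y + S + (co h k)%:C *: E k) - f (y + S) - co h k * a k| <=
      M * `|co h k|.
    apply: line_mvt => s sc; rewrite -addrA; apply: H.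
    apply: le_trans (ND _ _) _; rewrite NZ mulrDl mul1r; apply: lerD.
      by apply: le_trans h2 _; rewrite ler_wpM2r // ler_nat ltnW.
    by apply: le_trans NkE; rewrite ler_wpM2r.
  rewrite [_ *: _ + S]addrC addrA.
  have -> : f (y + S + (co h k)%:C *: E k) - f y - (co h k * a k + T) =
    (f (y + S + (co h k)%:C *: E k) - f (y + S) - co h k * a k) +
    (f (y + S) - f y - T) by ring.
  apply: le_trans (ler_normD _ _) _; apply: le_trans (lerD step h1) _.
  rewrite -natr1 mulrDl mul1r mulrDr addrC lerD2l.
  by rewrite ler_wpM2l // (M0 k).
have [] := partial (index_enum I).
  by rewrite /index_enum -enumT -cardE.
rewrite -co_span => h1 _; apply: le_trans h1 _.
have sz : size (index_enum I) = #|I| by rewrite /index_enum -enumT -cardE.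
rewrite sz.
have [k|I0] := pickP I.
  rewrite ler_wpM2l ?(M0 k) // ler_wpM2r // lerDl.
  exact: ler01.
have -> : #|I| = 0%N by exact: eq_card0.
rewrite mul0r mulr0 add0r mul1r.
have -> : N h = 0 by rewrite (co_span h) big_pred0 // N0.
by rewrite mulr0.
Qed.

Lemma cont_normP f z : {for z, continuous f} <-> forall e, 0 < e ->
  exists2 d : R, 0 < d & forall h, N h < d -> `|f (z + h) - f z| <= e.
Proof.
split=> [fc e e0|H A /= /near_realP[e e0 eA]].
  have /fc /nearN[d d0 dP] : nbhs (f z) [set y : R | `|y - f z| < e].
    by apply/near_realP; exists e => // t te /=; rewrite addrC addKr.
  by exists d => // h /dP /= /ltW.
have [|d d0 dP] := H (e / 2); first lra.
apply/nearN; exists d => // h /dP he; rewrite /= -(subrK (f z) (f (z + h))) addrC.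
by apply: eA; lra.
Qed.

Definition C1_at f z := forall k, (\forall w \near z, exists l, ldiff f (E k) w l) /\
  {for z, continuous (real_derive f (E k))}.

Lemma uniform_radius (Q : I -> R -> Prop) :
  (forall k d d', Q k d -> d' <= d -> Q k d') ->
  (forall k, exists2 d, 0 < d & Q k d) -> exists2 d, 0 < d & forall k, Q k d.
Proof.
move=> Qle Qex.
have /fin_all_exists2[d d0 dP] := Qex.
pose m := \big[Num.min/1]_j d j.
exists m; first by rewrite /m; elim/big_ind: _ => // a b a0 b0; rewrite lt_min a0.
by move=> k; apply: Qle (dP k) _; rewrite /m (bigD1 k) //= ge_min lexx.
Qed.

Lemma C1_frechet f z : C1_at f z -> forall e, 0 < e ->
  exists2 d : R, 0 < d & forall h, N h < d ->
    `|f (z + h) - f z - \sum_k co h k * real_derive f (E k) z| <= e * N h.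
Proof.
move=> fC e e0; have K0 := K_gt0.
have [||d d0 dP] := @uniform_radius (fun k d => forall w, N w < d ->
    exists2 l, ldiff f (E k) (z + w) l & `|l - real_derive f (E k) z| <= e / K).
- by move=> k d d' H dd w wd; apply: H; exact: lt_le_trans wd dd.
- move=> k; have [/nearN[d d0 dP] /cont_normP/(_ (e / K))] := fC k.
  case=> [|d' d'0 dP']; first by rewrite divr_gt0.
  exists (Num.min d d') => [|w]; first by rewrite lt_min d0.
  rewrite lt_min => /andP[/dP[l fl] /dP' H]; exists l => //.
  by have /ldiffP[_ <-] := fl.
exists (d / K) => [|h]; first by rewrite divr_gt0.
rewrite ltr_pdivlMr // mulrC => hd.
have -> : e * N h = e / K * (K * N h) by field; rewrite gt_eqF.
by apply: frame_mvt => k w wh; apply: dP; exact: le_lt_trans hd.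
Qed.

Lemma C1_curve f z (g : R -> V) (a : I -> R) : C1_at f z -> g 0 = z ->
  (forall k, rdiff (fun t => co (g t) k) 0 (a k)) ->
  rdiff (f \o g) 0 (\sum_k a k * real_derive f (E k) z).
Proof.
move=> fC g0 ga e e0; have K0 := K_gt0.
pose D k := real_derive f (E k) z.
pose A := \sum_k `|a k| + 1; pose B := \sum_k `|D k| + 1.
have A0 : 0 < A by rewrite ltr_wpDl ?sumr_ge0.
have B0 : 0 < B by rewrite ltr_wpDl ?sumr_ge0.
have cog t k : co (g t - z) k = co (g t) k - co (g 0) k.
  by rewrite coD g0 -scaleN1r -(rmorph1 (real_complex R)) -rmorphN coZ mulN1r.
pose e1 := Num.min (1 / K) (e / (2 * (B * K))).
have e10 : 0 < e1 by rewrite lt_min !divr_gt0 ?mulr_gt0.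
have [e1a e1b] : e1 <= 1 / K /\ e1 <= e / (2 * (B * K)) by rewrite !ge_min !lexx orbT.
have [||d1 d10 d1P] := @uniform_radius (fun k d => forall t, `|t| < d ->
    `|co (g t - z) k - a k * t| <= e1 * `|t|).
- by move=> k d d' H dd t td; apply: H; exact: lt_le_trans td dd.
- move=> k; have [d d0 dP] := ga k e1 e10; exists d => // t /dP.
  by rewrite add0r cog.
pose e2 := e / (2 * (A * 1 + 1)).
have e20 : 0 < e2 by rewrite divr_gt0 // mulr_gt0 //; lra.
have [d2 d20 d2P] := C1_frechet fC e20.
have gN t : `|t| < d1 -> N (g t - z) <= (A + 1) * `|t|.
  move=> td; rewrite (co_span (g t - z)).
  apply: (@le_trans _ _ (\sum_k (`|a k| * `|t| + e1 * `|t|))).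
    have NS (r : seq I) : N (\sum_(k <- r) (co (g t - z) k)%:C *: E k) <=
        \sum_(k <- r) (`|a k| * `|t| + e1 * `|t|).
      elim: r => [|k r IH]; first by rewrite !big_nil N0.
      rewrite !big_cons; apply: le_trans (ND _ _) _; apply: lerD => //.
      rewrite NZ; have := d1P k t td; set c := co _ _ => h1.
      have : `|c| <= `|c - a k * t| + `|a k * t|.
        by have := ler_normD (c - a k * t) (a k * t); rewrite subrK.
      rewrite normrM => h2.
      have : `|c| * N (E k) <= `|c| * 1 by rewrite ler_wpM2l.
      lra.
    exact: NS.
  rewrite big_split /= -mulr_suml sumr_const -mulr_natl.
  have h3 : e1 * K <= 1 by rewrite -ler_pdivlMr.
  have h4 : #|I|%:R * (e1 * `|t|) <= 1 * `|t|.
    rewrite mulrA ler_wpM2r //; apply: le_trans h3; rewrite mulrC ler_wpM2l ?(ltW e10) //.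
    by rewrite lerDl.
  have : \sum_k `|a k| * `|t| <= A * `|t|.
    by rewrite -mulr_suml ler_wpM2r // /A lerDl.
  rewrite -mulr_suml; lra.
exists (Num.min d1 (d2 / (A + 1))) => [|t].
  by rewrite lt_min d10 divr_gt0 //; lra.
have A10 : 0 < A + 1 by lra.
rewrite lt_min ltr_pdivlMr // => /andP[td1 td2].
have hN := gN t td1.
have := d2P (g t - z); rewrite [z + _]addrC subrK.
have gd2 : N (g t - z) < d2 by apply: le_lt_trans hN _; rewrite mulrC.
move=> /(_ gd2) H.
rewrite /= add0r g0.
set S := \sum_k co _ k * _ in H.
have SE : `|S - (\sum_k a k * real_derive f (E k) z) * t| <= B * (e1 * `|t|).
  rewrite /S mulr_suml -sumrB.
  apply: le_trans (ler_norm_sum _ _ _) _.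
  apply: (@le_trans _ _ (\sum_k `|D k| * (e1 * `|t|))).
    apply: ler_sum => k _.
    have -> : co (g t - z) k * real_derive f (E k) z - a k * real_derive f (E k) z * t =
      D k * (co (g t - z) k - a k * t) by rewrite /D; ring.
    by rewrite normrM ler_wpM2l // d1P.
  by rewrite -mulr_suml ler_wpM2r ?mulr_ge0 ?(ltW e10) // /B lerDl.
have -> : f (g t) - f z - (\sum_k a k * real_derive f (E k) z) * t =
  (f (g t) - f z - S) + (S - (\sum_k a k * real_derive f (E k) z) * t) by ring.
apply: le_trans (ler_normD _ _) _.
have h5 : e2 * N (g t - z) <= e / 2 * `|t|.
  have -> : e / 2 * `|t| = e2 * ((A + 1) * `|t|) by rewrite /e2; field; rewrite gt_eqF //; lra.
  by rewrite ler_wpM2l // ltW.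
have h6 : B * (e1 * `|t|) <= e / 2 * `|t|.
  rewrite mulrA ler_wpM2r //.
  have K1 : 1 <= K by rewrite lerDr ler0n.
  have : e1 * (2 * (B * K)) <= e by rewrite -ler_pdivlMr // mulr_gt0 // mulr_gt0.
  have : B * e1 * 1 <= B * e1 * K by rewrite ler_wpM2l // mulr_ge0 // ltW.
  lra.
lra.
Qed.

End RealFrame.

Section DifferentiabilityClasses.
Variables (R : realType) (V : normedModType R[i]).
Implicit Types (f g : V -> R) (x y z v w h : V) (s t l : R) (U : set V).

Lemma near_line z v (P : V -> Prop) : (\forall w \near z, P w) ->
  exists2 d : R, 0 < d & forall t, `|t| < d -> P (real_line z v t).
Proof.
move=> /nbhs_normP[e /= e0 eP].
have [e' eE] : exists e' : R, e = e'%:C.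
  have /complex_realP[e' E] : e \is Num.real by rewrite gtr0_real.
  by exists e'.
have [k kE] : exists k : R, `|v| = k%:C.
  have /complex_realP[k E] : `|v| \is Num.real by rewrite normr_real.
  by exists k.
have k0 : 0 <= k by have := normr_ge0 v; rewrite kE lecR.
rewrite eE ltcR in e0; exists (e' / (k + 1)) => [|t].
  by rewrite divr_gt0 //; lra.
rewrite ltr_pdivlMr; last lra; move=> te.
apply: eP; rewrite /= /real_line opprD addNKr normrN normrZ kE eE.
rewrite normc_modc modc_real -rmorphM ltcR; have := normr_ge0 t; nra.
Qed.

(** [smooth_on] cut off at a finite order and made recursive in it, so that stability under sums,
    products and composition can be proved by induction. *)
Fixpoint Cn n U f : Prop := (forall z, U z -> {for z, continuous f}) /\
  if n is m.+1 then
    forall v, (forall z, U z -> derivable (f \o real_line z v) 0 1) /\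
              Cn m U (real_derive f v)
  else True.

Lemma smooth_Cn n U f : smooth_on U f -> Cn n U f.
Proof.
elim: n f => [|n IH] f fU; first by split=> // z /(fU [::])[].
split=> [z /(fU [::])[] //|v]; split=> [z /(fU [::])[_] //|].
by apply: IH => vs z Uz; exact: (fU (v :: vs) z Uz).
Qed.

Lemma Cn_cont n U f z : Cn n U f -> U z -> {for z, continuous f}.
Proof. by case: n => [|n] [+ _]; apply. Qed.

Lemma CnW n U f : Cn n.+1 U f -> Cn n U f.
Proof.
elim: n f => [|n IH] f [fc fv]; first by [].
by split=> // v; have [? /IH] := fv v.
Qed.

Lemma Cn_ldiff n U f v z : Cn n.+1 U f -> U z -> ldiff f v z (real_derive f v z).
Proof.
by move=> [_ fv] Uz; apply/ldiffP; split=> //; have [fd _] := fv v; exact: fd.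
Qed.

Section Open.
Variable U : set V.
Hypothesis oU : open U.

Lemma near_open z : U z -> \forall w \near z, U w.
Proof. by move=> Uz; exact: open_nbhs_nbhs. Qed.

Lemma ldiff_ext f g v z l : U z -> (forall w, U w -> f w = g w) ->
  ldiff f v z l -> ldiff g v z l.
Proof.
move=> Uz fg; apply: rdiff_near.
have [d d0 dP] := near_line v (near_open Uz).
by exists d => // t /dP /fg; rewrite add0r.
Qed.

Lemma continuous_ext f g z : U z -> (forall w, U w -> f w = g w) ->
  {for z, continuous f} -> {for z, continuous g}.
Proof.
move=> Uz fg fc; change (g @ z --> g z); rewrite -(fg z Uz).
by apply: cvg_trans fc; apply: near_eq_cvg; apply: filterS (near_open Uz).
Qed.

Lemma Cn_ext n f g : (forall z, U z -> f z = g z) -> Cn n U f -> Cn n U g.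
Proof.
elim: n f g => [|n IH] f g fg [fc fv].
  by split=> // z Uz; apply: (continuous_ext Uz fg); exact: fc.
have H v z : U z -> ldiff g v z (real_derive f v z).
  move=> Uz; apply: (ldiff_ext Uz fg); apply/ldiffP; split=> //.
  by have [fd _] := fv v; exact: fd.
split=> [z Uz|v]; first by apply: (continuous_ext Uz fg); exact: fc.
split=> [z /(H v)/ldiffP[] //|].
have [_ fn] := fv v; apply: IH fn => z /(H v)/ldiffP[_ ->] //.
Qed.

Lemma CnS n f (D : V -> V -> R) :
  (forall z, U z -> {for z, continuous f}) ->
  (forall v z, U z -> ldiff f v z (D v z)) -> (forall v, Cn n U (D v)) ->
  Cn n.+1 U f.
Proof.
move=> fc fD DC; split=> // v; split=> [z /(fD v)/ldiffP[] //|].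
by apply: Cn_ext (DC v) => z /(fD v)/ldiffP[_ ->].
Qed.

Lemma Cn_cst n c : Cn n U (fun=> c).
Proof.
elim: n c => [|n IH] c; first by split=> // z _; exact: cst_continuous.
apply: (CnS (D := fun _ _ => 0)) => // [z _|v z _]; first exact: cst_continuous.
exact: rdiff_cst.
Qed.

Lemma CnD n f g : Cn n U f -> Cn n U g -> Cn n U (fun z => f z + g z).
Proof.
have cD (F G : V -> R) z : {for z, continuous F} -> {for z, continuous G} ->
  {for z, continuous (fun z : V => F z + G z : R)} by move=> ? ?; exact: cvgD.
elim: n f g => [|n IH] f g fC gC.
  by split=> // z Uz; apply: cD; [case: fC|case: gC] => + _; exact.
apply: (CnS (D := fun v z => real_derive f v z + real_derive g v z)).
- by move=> z Uz; apply: cD; [exact: Cn_cont fC Uz|exact: Cn_cont gC Uz].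
- move=> v z Uz; exact: (rdiffD (Cn_ldiff v fC Uz) (Cn_ldiff v gC Uz)).
- by move=> v; apply: IH; [case: fC|case: gC] => _ /(_ v)[].
Qed.

Lemma CnM n f g : Cn n U f -> Cn n U g -> Cn n U (fun z => f z * g z).
Proof.
have cM (F G : V -> R) z : {for z, continuous F} -> {for z, continuous G} ->
  {for z, continuous (fun z : V => F z * G z : R)} by move=> ? ?; exact: cvgM.
elim: n f g => [|n IH] f g fC gC.
  by split=> // z Uz; apply: cM; [case: fC|case: gC] => + _; exact.
apply: (CnS (D := fun v z => real_derive f v z * g z + f z * real_derive g v z)).
- by move=> z Uz; apply: cM; [exact: Cn_cont fC Uz|exact: Cn_cont gC Uz].
- move=> v z Uz; have := rdiffM (Cn_ldiff v fC Uz) (Cn_ldiff v gC Uz).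
  by rewrite /real_line /= scale0r addr0.
- move=> v; apply: CnD; apply: IH; try exact: CnW.
  + by case: fC => _ /(_ v)[].
  + by case: gC => _ /(_ v)[].
Qed.

Lemma Cn_sum n (I : Type) (r : seq I) (F : I -> V -> R) :
  (forall k, Cn n U (F k)) -> Cn n U (fun z => \sum_(k <- r) F k z).
Proof.
move=> FC; elim: r => [|k r IH].
  by apply: Cn_ext (Cn_cst n 0) => z _; rewrite big_nil.
by apply: Cn_ext (CnD (FC k) IH) => z _; rewrite big_cons.
Qed.

End Open.

End DifferentiabilityClasses.

Section Composition.
Variables (R : realType) (V W : normedModType R[i]).
Variables (N : W -> R) (I : finType) (E : I -> W) (co : W -> I -> R).
Hypothesis nearN : forall z (P : W -> Prop), (\forall w \near z, P w) <->
  exists2 e : R, 0 < e & forall h, N h < e -> P (z + h).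
Hypothesis N_ge0 : forall v, 0 <= N v.
Hypothesis ND : forall v w, N (v + w) <= N v + N w.
Hypothesis NZ : forall (s : R) v, N (s%:C *: v) = `|s| * N v.
Hypothesis NE : forall k, N (E k) <= 1.
Hypothesis co_le : forall v k, `|co v k| <= N v.
Hypothesis co_span : forall v, v = \sum_k (co v k)%:C *: E k.
Hypothesis coD : forall v w k, co (v + w) k = co v k + co w k.
Hypothesis coZ : forall (s : R) v k, co (s%:C *: v) k = s * co v k.

Lemma Cn_C1 n (U : set W) f z : open U -> Cn n.+1 U f -> U z -> C1_at E f z.
Proof.
move=> oU fC Uz k; split.
  apply: filterS (near_open oU Uz) => w Uw; exists (real_derive f (E k) w).
  exact: Cn_ldiff fC Uw.
by case: fC => _ /(_ (E k))[_ /Cn_cont]; exact.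
Qed.

(** By the chain rule a derivative of [f \o g] is a sum of products of a derivative of a coordinate
    of [g] with a partial derivative of [f] composed with [g]; the induction hypothesis applies to
    the latter. *)
Lemma Cn_comp n (U : set V) (U' : set W) (f : W -> R) (g : V -> W) :
  open U -> open U' -> (forall z, U z -> U' (g z)) ->
  (forall z, U z -> {for z, continuous g}) ->
  (forall k, Cn n U (fun z => co (g z) k)) -> Cn n U' f -> Cn n U (f \o g).
Proof.
move=> oU oU' gU gc; elim: n f => [|n IH] f gC fC.
  split=> // z Uz; apply: continuous_comp; first exact: gc.
  exact: Cn_cont fC (gU z Uz).
apply: (CnS oU (D := fun v z => \sum_k real_derive (fun z => co (g z) k) v z *
                               real_derive f (E k) (g z))).
- move=> z Uz; apply: continuous_comp; first exact: gc.
  exact: Cn_cont fC (gU z Uz).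
- move=> v z Uz; apply: (C1_curve nearN N_ge0 ND NZ NE co_le co_span coD coZ
    (g := g \o real_line z v)).
  + exact: (Cn_C1 oU' fC (gU z Uz)).
  + by rewrite /real_line /= scale0r addr0.
  + by move=> k; exact: (Cn_ldiff v (gC k) Uz).
- move=> v; apply: Cn_sum => // k; apply: CnM => //.
    by case: (gC k) => _ /(_ v)[].
  apply: IH => [j|]; first exact: CnW.
  by case: fC => _ /(_ (E k))[].
Qed.

Local Notation K := (#|I|%:R + 1 : R).

(** Induction replaces Taylor's formula: the frame derivatives of [f] are bounded by the case of
    order [b], and [frame_mvt] with slopes 0 gains one power of [N h]. *)
Lemma Cn_vanish b (U : set W) (f : W -> R) y : open U -> U y -> Cn b U f ->
  (forall vs, (size vs < b)%N -> iter_real_derive f vs y = 0) ->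
  exists C r, [/\ 0 <= C, 0 < r &
    forall h, N h <= r -> `|f (y + h)| <= C * N h ^+ b].
Proof.
move=> oU Uy; have K0 : 0 < K := K_gt0 R I.
elim: b f => [|b IH] f fC fv.
  have [d d0 dP] := proj1 (cont_normP nearN f y) (Cn_cont fC Uy) 1 ltr01.
  exists (`|f y| + 1), (d / 2); split; [by rewrite addr_ge0| |].
    by rewrite divr_gt0.
  move=> h hd; rewrite expr0 mulr1.
  have /dP h1 : N h < d by apply: le_lt_trans hd _; rewrite ltr_pdivrMr // ltr_pMr // ltr1n.
  rewrite -(subrK (f y) (f (y + h))) addrC; apply: le_trans (ler_normD _ _) _.
  by rewrite lerD2l.
have : forall k, exists Cr : R * R, [/\ 0 <= Cr.1, 0 < Cr.2 &
    forall h, N h <= Cr.2 -> `|real_derive f (E k) (y + h)| <= Cr.1 * N h ^+ b].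
  move=> k; have [||C [r [C0 r0 H]]] := IH (real_derive f (E k)).
  - by case: fC => _ /(_ (E k))[].
  - by move=> vs sv; exact: (fv (E k :: vs)).
  - by exists (C, r).
case/fin_all_exists => Cr CrP.
have /nearN[e e0 eU] := near_open oU Uy.
have [e' e'0 e'e] : exists2 e' : R, 0 < e' & e' < e.
  by exists (e / 2); rewrite ?divr_gt0 // ltr_pdivrMr // ltr_pMr // ltr1n.
have [||d d0 dP] := @uniform_radius R I (fun k d => d <= (Cr k).2).
- by move=> k d d' + dd; exact: le_trans.
- by move=> k; exists (Cr k).2 => //; have [] := CrP k.
pose C := \sum_k (Cr k).1.
have CC k : (Cr k).1 <= C.
  by rewrite /C (bigD1 k) //= lerDl sumr_ge0 // => j _; have [] := CrP j.
have C0 : 0 <= C by rewrite /C sumr_ge0 // => j _; have [] := CrP j.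
exists (C * K ^+ b.+1), (Num.min (d / K) (e' / K)); split.
- by rewrite mulr_ge0 // exprn_ge0 // ltW.
- by rewrite lt_min !divr_gt0.
move=> h; rewrite le_min !ler_pdivlMr // => /andP[hd he].
have := frame_mvt N_ge0 ND NZ NE co_le co_span (f := f) (y := y) (h := h)
  (a := fun=> 0) (M := C * (K * N h) ^+ b).
rewrite big1 => [|k _]; last by rewrite mulr0.
have -> : f y = 0 := fv [::] isT.
rewrite !subr0 => H; apply: le_trans (H _) _ => [k w wh|].
  exists (real_derive f (E k) (y + w)).
    apply: (Cn_ldiff _ fC); apply: eU; apply: le_lt_trans wh _.
    by rewrite mulrC; exact: le_lt_trans e'e.
  rewrite subr0; have [c1 c2 c3] := CrP k.
  apply: le_trans (c3 w _) _.
    by apply: le_trans wh _; rewrite mulrC; apply: le_trans hd _.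
  apply: ler_pM => //; first by rewrite exprn_ge0.
  by apply: lerXn2r; rewrite ?nnegrE //; exact: le_trans wh.
by rewrite exprMn !exprS le_eqVlt; apply/orP; left; apply/eqP; ring.
Qed.

(** The mean value inequality used twice: second derivatives are bounded near [y0], so first
    derivatives vary at most linearly and the linearization errs quadratically. The constants are
    uniform in the base point [y], as inner balls of a common radius require. *)
Lemma C2_quadratic (U : set W) (f : W -> R) y0 : open U -> U y0 -> Cn 2 U f ->
  exists C r, [/\ 0 < C, 0 < r & forall y h, N (y - y0) <= r -> N h <= r ->
    U (y + h) /\
    `|f (y + h) - f y - \sum_k co h k * real_derive f (E k) y| <= C * N h ^+ 2].
Proof.
move=> oU Uy fC; have K0 : 0 < K := K_gt0 R I.
have /nearN[e e0 eU] := near_open oU Uy.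
pose D j k := real_derive (real_derive f (E k)) (E j).
have [||d d0 dP] := @uniform_radius R (I * I)%type (fun jk d => forall h, N h < d ->
    `|D jk.1 jk.2 (y0 + h) - D jk.1 jk.2 y0| <= 1).
- by move=> k d d' H dd w wd; apply: H; exact: lt_le_trans wd dd.
- move=> [j k]; apply: (proj1 (cont_normP nearN (D j k) y0) _ 1 ltr01).
  by case: fC => _ /(_ (E k))[_ [_ /(_ (E j))[_ DC]]]; exact: (proj1 DC y0 Uy).
pose B := \sum_(jk : I * I) `|D jk.1 jk.2 y0| + 1.
have B0 : 0 < B by rewrite ltr_wpDl ?sumr_ge0.
have DB j k h : N h < d -> `|D j k (y0 + h)| <= B.
  move=> /(dP (j, k)) /= h1; rewrite -(subrK (D j k y0) (D j k (y0 + h))) addrC.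
  apply: le_trans (ler_normD _ _) _; apply: lerD h1.
  by rewrite (bigD1 (j, k)) //= lerDl sumr_ge0.
pose m := Num.min d e.
have m0 : 0 < m by rewrite lt_min d0.
have K1 : 1 <= K by rewrite lerDr ler0n.
have KK1 : K <= K * K by rewrite ler_peMr // ltW.
have KK0 : 0 < 2 + K * K by rewrite addr_gt0 ?mulr_gt0.
exists (B * K * K * K), (m / (2 + K * K)); split; rewrite ?mulr_gt0 ?divr_gt0 //.
move=> y h; rewrite !ler_pdivlMr // => hy hh.
have near w : N w <= K * K * N h -> N (y - y0 + w) < m.
  move=> wh; rewrite -(@ltr_pM2r _ (2 + K * K)) //.
  apply: (@le_lt_trans _ _ (m + K * K * m)); last first.
    have -> : m * (2 + K * K) = m + m + K * K * m by ring.
    by rewrite ltrD2r ltrDl.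
  apply: (@le_trans _ _ ((N (y - y0) + K * K * N h) * (2 + K * K))).
    rewrite ler_pM2r //; apply: le_trans (ND _ _) _; exact: lerD.
  have -> : (N (y - y0) + K * K * N h) * (2 + K * K) =
    N (y - y0) * (2 + K * K) + K * K * (N h * (2 + K * K)) by ring.
  by apply: lerD => //; rewrite ler_wpM2l // mulr_ge0 // ltW.
have yE w : y + w = y0 + (y - y0 + w) by rewrite addrA [y0 + _]addrC subrK.
have UY w : N w <= K * K * N h -> U (y + w).
  move=> /near; rewrite lt_min => /andP[_ we]; rewrite yE; exact: eU.
split; first by apply: UY; rewrite ler_peMl // (le_trans K1).
have -> : B * K * K * K * N h ^+ 2 = B * (K * (K * N h)) * (K * N h) by ring.
apply: (frame_mvt N_ge0 ND NZ NE co_le co_span) => k w wh.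
have KwK : K * N w <= K * K * N h by rewrite -mulrA ler_wpM2l // ltW.
exists (real_derive f (E k) (y + w)).
  apply: (Cn_ldiff _ fC); apply: UY; apply: le_trans KwK; exact: ler_peMl.
have := frame_mvt N_ge0 ND NZ NE co_le co_span (f := real_derive f (E k))
  (y := y) (h := w) (a := fun=> 0) (M := B).
rewrite big1 => [|j _]; last by rewrite mulr0.
rewrite subr0 => H; apply: le_trans (H _) _ => [j w' w'h|].
  have w'K := le_trans w'h KwK.
  exists (D j k (y + w')).
    have fk : Cn 1 U (real_derive f (E k)) by case: fC => _ /(_ (E k))[].
    exact: (Cn_ldiff _ fk (UY _ w'K)).
  rewrite subr0 yE; apply: DB.
  by have := near _ w'K; rewrite lt_min => /andP[].
by rewrite ler_wpM2l ?(ltW B0) // ler_wpM2l // ltW.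
Qed.

End Composition.

(** * The real frames of C and C^d, and the resulting estimates for defining functions *)

Section Frames.
Variables (R : realType) (d : nat).
Local Notation V := 'rV[R[i]]_d.
Local Notation enorm := (@euclidean_norm R d).
Implicit Types (z w : R[i]) (v h x y : V) (t s : R).

Definition cframe (b : bool) : R[i] := if b then 1 else 0 +i* 1.
Definition ccoord z (b : bool) : R := if b then complex.Re z else complex.Im z.

Lemma cframe_modc b : modc (cframe b) <= 1.
Proof. by case: b; rewrite /cframe ?modc1 ?modci. Qed.

Lemma ccoord_le z b : `|ccoord z b| <= modc z.
Proof. by case: b; [exact: normr_Re_le|exact: normr_Im_le]. Qed.

Lemma ccoord_span z : z = \sum_b (ccoord z b)%:C *: cframe b.
Proof.
rewrite (eq_bigr (fun b : bool => (ccoord z b)%:C * cframe b)) //.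
rewrite big_bool /=; case: z => a b; apply/eqP; rewrite eq_complex /=.
by rewrite !mulr1 !mul0r !mulr0 !subr0 !addr0 !add0r !eqxx.
Qed.

Lemma ccoordD z w b : ccoord (z + w) b = ccoord z b + ccoord w b.
Proof. by case: b; [exact: cReD|exact: cImD]. Qed.

Lemma ccoordZ s z b : ccoord (s%:C *: z) b = s * ccoord z b.
Proof. by case: b; [exact: cReZ|exact: cImZ]. Qed.

Lemma modcZ s z : modc (s%:C *: z) = `|s| * modc z.
Proof. by rewrite (modcM s%:C z) modc_real. Qed.

Definition vframe (k : 'I_d * bool) : V := cframe k.2 *: delta_mx 0 k.1.
Definition vcoord v (k : 'I_d * bool) : R := ccoord (v 0 k.1) k.2.

Lemma vframe_enorm k : enorm (vframe k) <= 1.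
Proof.
case: k => j b; rewrite /vframe /= enormZ.
have : enorm (delta_mx 0 j) <= 1.
  apply: le_trans (enorm_le_sum _) _; rewrite (bigD1 j) //= mxE !eqxx modc1.
  by rewrite big1 ?addr0 // => k /negbTE kj; rewrite mxE kj andbF modc0.
by move=> h; rewrite mulr_ile1 ?enorm_ge0 ?modc_ge0 ?cframe_modc.
Qed.

Lemma vcoord_le v k : `|vcoord v k| <= enorm v.
Proof. exact: le_trans (ccoord_le _ _) (modc_le_enorm _ _). Qed.

Lemma vcoord_span v : v = \sum_k (vcoord v k)%:C *: vframe k.
Proof.
rewrite {1}(row_sum_delta v).
rewrite -(pair_bigA _ (fun j b => (vcoord v (j, b))%:C *: vframe (j, b))) /=.
apply: eq_bigr => j _; rewrite {1}(ccoord_span (v 0 j)) scaler_suml.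
by apply: eq_bigr => b _; rewrite /vframe scalerA.
Qed.

Lemma vcoordD v h k : vcoord (v + h) k = vcoord v k + vcoord h k.
Proof. by rewrite /vcoord mxE ccoordD. Qed.

Lemma vcoordZ s v k : vcoord (s%:C *: v) k = s * vcoord v k.
Proof. by rewrite /vcoord mxE; exact: ccoordZ. Qed.

Lemma enormZr s v : enorm (s%:C *: v) = `|s| * enorm v.
Proof. by rewrite enormZ modc_real. Qed.

Lemma hip_gradient (r : V -> R) v y :
  \sum_k vcoord v k * real_derive r (vframe k) y =
  complex.Re (hip v (gradient r y)).
Proof.
rewrite -(pair_bigA _ (fun j b => vcoord v (j, b) * real_derive r (vframe (j, b)) y)) /=.
rewrite /hip Re_sum; apply: eq_bigr => j _; rewrite big_bool /= /gradient mxE.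
have -> : vframe (j, true) = delta_mx 0 j :> V by rewrite /vframe /cframe /= scale1r.
have -> : vframe (j, false) = (0 +i* 1) *: delta_mx 0 j :> V by [].
rewrite /vcoord /ccoord /=.
set p := real_derive _ _ _; set q := real_derive _ _ _.
case: (v 0 j) => a b /=; ring.
Qed.

(** The derivative in direction [w] is the real part of [derive1 f z * w], which is again
    holomorphic in [z]. *)
Lemma Re_holomorphic_Cn n (U : set R[i]) f : open U ->
  (forall z, U z -> differentiable f z) -> Cn n U (fun z => complex.Re (f z)).
Proof.
move=> oU; elim: n f => [|n IH] f fd.
  split=> // z /fd /differentiable_ccont fc.
  apply/(cont_normP (N := @modc R)) => [w P|e e0]; first exact: near_modcP.
  have [dl dl0 dP] := fc e e0; exists dl => // h /dP.
  by apply: le_trans; rewrite -cReB normr_Re_le.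
have fc := fd; have {}fc z : U z -> {for z, continuous (fun z => complex.Re (f z))}.
  move=> /fd /differentiable_ccont fc'.
  apply/(cont_normP (N := @modc R)) => [w P|e e0]; first exact: near_modcP.
  have [dl dl0 dP] := fc' e e0; exists dl => // h /dP.
  by apply: le_trans; rewrite -cReB normr_Re_le.
apply: (CnS oU (D := fun w z => complex.Re (derive1 f z * w))) => // [w z Uz|w].
  move=> e e0.
  have [dl dl0 dP] := differentiable_cdiff (fd z Uz) (e := e / (modc w + 1))
    (ltac:(by rewrite divr_gt0 // ltr_wpDl ?modc_ge0)).
  have v1 : 0 < modc w + 1 by rewrite ltr_wpDl ?modc_ge0.
  exists (dl / (modc w + 1)) => [|t]; first by rewrite divr_gt0.
  rewrite ltr_pdivlMr // => td.
  have tv : modc (t%:C * w) <= `|t| * (modc w + 1).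
    by rewrite modcM modc_real ler_wpM2l // lerDl.
  have := dP _ (le_lt_trans tv td); rewrite /real_line /= scale0r addr0 add0r => H.
  have -> : complex.Re (f (z + t%:C *: w)) - complex.Re (f z) -
      complex.Re (derive1 f z * w) * t =
      complex.Re (f (z + t%:C * w) - f z - derive1 f z * (t%:C * w)).
    rewrite !cReB mulrCA cReZ [t * _]mulrC //.
  apply: le_trans (normr_Re_le _) _; apply: le_trans H _.
  by rewrite -mulrA ler_wpM2l ?(ltW e0) // ler_pdivrMl // [leRHS]mulrC.
apply: IH => z Uz; apply: differentiableM; last exact: differentiable_cst.
have /near_modcP[rho rho0 rhoP] := near_open oU Uz.
apply: (@derive1_differentiable _ f z (rho / 2)); first by rewrite divr_gt0.
move=> w' wz; apply: fd; rewrite -(subrK z w') addrC; apply: rhoP.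
by apply: le_lt_trans wz _; rewrite ltr_pdivrMr // ltr_pMr // ltr1n.
Qed.

Lemma open_disc (rho : R) : open [set z : R[i] | modc z < rho].
Proof.
rewrite openE => z /= zr; apply/near_modcP; exists (rho - modc z).
  by rewrite subr_gt0.
by move=> h hr /=; apply: le_lt_trans (modcD _ _) _; lra.
Qed.

Lemma differentiable_entry (g : R[i] -> V) j z : differentiable g z ->
  differentiable (fun w => g w 0 j) z.
Proof.
move=> gd; apply: (@differentiable_comp _ _ _ _ g (fun M : V => M 0 j)) gd _.
exact: differentiable_coord.
Qed.

Lemma order_bound (r : V -> R) (U : set V) (g : R[i] -> V) (rho : R) b :
  open U -> U (g 0) -> smooth_on U r -> 0 < rho ->
  (forall z, modc z < rho -> differentiable g z) ->
  (forall vs, (size vs < b)%N -> iter_real_derive (r \o g) vs 0 = 0) ->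
  exists C dl : R, [/\ 0 <= C, 0 < dl &
    forall z, modc z <= dl -> `|r (g z)| <= C * modc z ^+ b].
Proof.
move=> oU Ug rU rho0 gd van.
have [rho' [r'0 r'r gU]] : exists rho' : R, [/\ 0 < rho', rho' <= rho &
    forall z, modc z < rho' -> U (g z)].
  have gc : {for 0, continuous g}.
    by apply: differentiable_continuous; apply: gd; rewrite modc0.
  have /gc /near_modcP[e e0 eP] : nbhs (g 0) U by exact: (near_open oU Ug).
  exists (Num.min e rho); rewrite lt_min e0 ge_min lexx orbT; split=> // z.
  by rewrite lt_min => /andP[/eP ze _]; rewrite add0r in ze.
pose D := [set z : R[i] | modc z < rho'].
have Dd z : D z -> differentiable g z by move=> Dz; apply: gd; exact: lt_le_trans r'r.
have oD : open D := @open_disc rho'.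
have rgC : Cn b D (r \o g).
  apply: (@Cn_comp _ _ _ enorm _ vframe vcoord _ _ _ _ _ _ _ _ _ b D U) => //.
  - exact: near_enormP.
  - exact: enorm_ge0.
  - exact: enormD.
  - exact: enormZr.
  - exact: vframe_enorm.
  - exact: vcoord_le.
  - exact: vcoord_span.
  - exact: vcoordD.
  - exact: vcoordZ.
  - by move=> z /Dd; exact: differentiable_continuous.
  - case=> j [] /=; rewrite /vcoord /ccoord /=.
      by apply: Re_holomorphic_Cn => // z /Dd; exact: differentiable_entry.
    (* The imaginary part is the real part of [- 'i] times the function. *)
    apply: (Cn_ext oD (f := fun z => complex.Re (- 'i * g z 0 j))) => [z _|].
      by case: (g z 0 j) => p q /=; ring.
    apply: (@Re_holomorphic_Cn b D (fun z => - 'i * g z 0 j) oD) => z Dz.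
    exact: (differentiableM (differentiable_cst (- 'i : R[i]) z)
      (differentiable_entry j (Dd z Dz))).
  - exact: smooth_Cn.
have D0 : D 0 by rewrite /D /= modc0.
have := @Cn_vanish _ _ (@modc R) _ cframe ccoord _ _ _ _ _ _ _ b D (r \o g) 0 oD D0 rgC van.
case=> //.
- exact: near_modcP.
- exact: modc_ge0.
- exact: modcD.
- exact: modcZ.
- exact: cframe_modc.
- exact: ccoord_le.
- exact: ccoord_span.
move=> C [dl [C0 dl0 H]]; exists C, dl; split=> // z /H.
by rewrite add0r.
Qed.

Lemma quadratic_bound (r : V -> R) (U : set V) y0 : open U -> U y0 -> smooth_on U r ->
  exists C e : R, [/\ 0 < C, 0 < e & forall y h, enorm (y - y0) <= e -> enorm h <= e ->
    U (y + h) /\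
    `|r (y + h) - r y - complex.Re (hip h (gradient r y))| <= C * enorm h ^+ 2].
Proof.
move=> oU Uy rU.
have := @C2_quadratic _ _ enorm _ vframe vcoord _ _ _ _ _ _ _ U r y0 oU Uy (smooth_Cn 2 rU).
case=> //.
- exact: near_enormP.
- exact: enorm_ge0.
- exact: enormD.
- exact: enormZr.
- exact: vframe_enorm.
- exact: vcoord_le.
- exact: vcoord_span.
move=> C [e [C0 e0 H]]; exists C, e; split=> // y h hy hh.
by have [Uyh] := H y h hy hh; rewrite hip_gradient.
Qed.

Lemma gradient_continuous (r : V -> R) (U : set V) y0 : open U -> U y0 ->
  smooth_on U r -> forall e : R, 0 < e -> exists2 dl : R, 0 < dl &
    forall h, enorm h < dl -> enorm (gradient r (y0 + h) - gradient r y0) <= e.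
Proof.
move=> oU Uy rU e e0; pose c := (d%:R + d%:R + 1 : R).
have c0 : 0 < c by rewrite ltr_wpDl // addr_ge0.
have ec0 : 0 < e / c by rewrite divr_gt0.
have [||dl dl0 dlP] := @uniform_radius R ('I_d * bool)%type (fun k dl =>
    forall h, enorm h < dl -> `|real_derive r (vframe k) (y0 + h) -
      real_derive r (vframe k) y0| <= e / c).
- by move=> k dl dl' H dd w wd; apply: H; exact: lt_le_trans wd dd.
- move=> k; apply: (proj1 (cont_normP (@near_enormP R d) (real_derive r (vframe k)) y0) _
    (e / c) ec0).
  have [_ /(_ (vframe k))[_ rk]] := smooth_Cn 1 rU; exact: (proj1 rk y0 Uy).
exists dl => // h /dlP H; apply: le_trans (enorm_le_sum _) _.
apply: (@le_trans _ _ (\sum_(j < d) (e / c + e / c))).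
  apply: ler_sum => j _; apply: le_trans (modc_le_ReIm _) _.
  rewrite !mxE cReB cImB /=; apply: lerD.
    by have := H (j, true); rewrite /vframe /cframe /= scale1r.
  exact: (H (j, false)).
rewrite sumr_const card_ord -mulr_natl.
have -> : d%:R * (e / c + e / c) = e * ((d%:R + d%:R) / c) by ring.
by rewrite ler_piMr ?(ltW e0) // ler_pdivrMr // mul1r /c lerDl.
Qed.

End Frames.

(** * Convex domains with inner balls *)

(** Maximum modulus for [f + K] with a large real [K]: as [K] grows, [modc (f z + K%:C)] is [K] plus
    the real part of [f z], up to [O(1 / K)]. The summand [(B ^+ 2 + 1) / (X - E)] of [K] lets the
    excess [X - E] outweigh the imaginary part, which is at most [B]. *)
Lemma re_max_principle (R : realType) (f : R[i] -> R[i]) (r E : R) : 0 < r ->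
  (forall z, modc z <= r -> differentiable f z) ->
  (forall z, modc z = r -> complex.Re (f z) <= E) -> complex.Re (f 0) <= E.
Proof.
move=> r0 fd fE; rewrite leNgt; apply/negP => bad.
have fd0 z : modc (z - 0) <= r -> differentiable f z by rewrite subr0; exact: fd.
have [B B0 fB] := bounded_on_disc fd0.
set X := complex.Re (f 0) in bad.
have XE : 0 < X - E by lra.
pose K := (B ^+ 2 + 1) / (X - E) + B + `|E| + `|X|.
have K1 : 0 < (B ^+ 2 + 1) / (X - E) by rewrite divr_gt0 // ltr_wpDl ?sqr_ge0.
have [E1 E2] : - `|E| <= E /\ E <= `|E| by have := ler_norm E; have := ler_norm (- E); rewrite normrN; lra.
have [X1 X2] : - `|X| <= X /\ X <= `|X| by have := ler_norm X; have := ler_norm (- X); rewrite normrN; lra.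
have KB : B <= K by rewrite /K; have := normr_ge0 E; have := normr_ge0 X; lra.
pose M2 := (K + E) ^+ 2 + B ^+ 2.
have M20 : 0 <= M2 by rewrite addr_ge0 ?sqr_ge0.
have gd z : modc (z - 0) <= r -> differentiable (fun z => f z + K%:C) z.
  by move=> zr; apply: differentiableD; [exact: fd0|exact: differentiable_cst].
have gM z : modc (z - 0) = r -> modc (f z + K%:C) <= Num.sqrt M2.
  move=> zr; rewrite -[X in X <= _](ger0_norm (modc_ge0 _)) -sqrtr_sqr ler_wsqrtr //.
  rewrite modc_sqr cReD cImD /= addr0.
  have fz : modc (f z) <= B by apply: fB; rewrite zr.
  have h1 : complex.Re (f z) <= E by apply: fE; rewrite -[z]subr0.
  have := normr_Re_le (f z); have := normr_Im_le (f z); rewrite !ler_norml => hi hr.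
  have h2 : (complex.Re (f z) + K) ^+ 2 <= (K + E) ^+ 2.
    have Ez := Re_le_modc (f z); have Ez' : - modc (f z) <= complex.Re (f z) by case/andP: hr.
    by rewrite lerXn2r ?nnegrE; move: h1 fz KB Ez'; clear; lra.
  have h3 : complex.Im (f z) ^+ 2 <= B ^+ 2.
    by rewrite -real_normK ?num_real // lerXn2r ?nnegrE // (le_trans (normr_Im_le _)).
  exact: lerD.
have zz : modc (0 - 0 : R[i]) <= r by rewrite subrr modc0 ltW.
have := max_modulus r0 gd gM zz.
move=> H.
have := lerXn2r 2 (_ : modc (f 0 + K%:C) \is Num.nneg) (_ : _ \is Num.nneg) H.
rewrite !nnegrE modc_ge0 sqrtr_ge0 => /(_ isT isT).
rewrite sqr_sqrtr // modc_sqr cReD cImD /= addr0 -/X /M2.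
have := sqr_ge0 (complex.Im (f 0)).
have H2 : B ^+ 2 + 1 <= (X - E) * K.
  have H3 : (X - E) * ((B ^+ 2 + 1) / (X - E)) = B ^+ 2 + 1 by field; lra.
  have H4 : 0 <= (X - E) * (B + `|E| + `|X|).
    apply: mulr_ge0; [exact: ltW|by rewrite !addr_ge0].
  by rewrite /K; move: H3 H4; clear; lra.
have H5 : 0 <= (X - E) * (K + X + E).
  rewrite mulr_ge0 ?(ltW XE) //; rewrite /K; move: (ltW K1) B0 E1 X1; clear; lra.
by move: H2 H5; clear; lra.
Qed.

(** Bernoulli's inequality for the fourth root [th] of [l] bounds [j%:R * th ^+ j]. The square of
    this product uses up two of the four factors [th ^+ j] of [l ^+ j]; the other two tend to 0. *)
Lemma linear_geometric_small (R : realType) (C l e : R) : 0 < l < 1 -> 0 <= C ->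
  0 < e -> exists j : nat, (6 * j + 12)%:R ^+ 2 * C * l ^+ j < e.
Proof.
move=> /andP[l0 l1] C0 e0.
pose th := Num.sqrt (Num.sqrt l).
have s0 : 0 < Num.sqrt l by rewrite sqrtr_gt0.
have th0 : 0 < th by rewrite sqrtr_gt0.
have th2 : th ^+ 2 = Num.sqrt l by rewrite sqr_sqrtr // ltW.
have th4 : th ^+ 4 = l by rewrite -[4%N]/(2 * 2)%N exprM th2 sqr_sqrtr // ltW.
have th1 : th < 1.
  rewrite ltNge; apply/negP => th1; have := @exprn_ege1 _ 4 th th1; rewrite th4; lra.
pose a := th^-1 - 1.
have a0 : 0 < a by rewrite subr_gt0 invf_gt1.
have bern n : n%:R * th ^+ n <= a^-1.
  have H : 1 + n%:R * a <= (th^-1) ^+ n.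
    have -> : th^-1 = 1 + a by rewrite /a; ring.
    elim: n => [|n IH]; first by rewrite expr0 mul0r addr0.
    rewrite exprS; apply: (@le_trans _ _ ((1 + a) * (1 + n%:R * a))); last first.
      by rewrite ler_wpM2l //; lra.
    have : 0 <= a * (n%:R * a) by rewrite !mulr_ge0 ?ler0n // ltW.
    by rewrite -[n.+1]addn1 natrD; clear; lra.
  have thn : 0 < th ^+ n by rewrite exprn_gt0.
  rewrite -[a^-1]mul1r ler_pdivlMr //.
  have : (1 + n%:R * a) * th ^+ n <= (th^-1) ^+ n * th ^+ n by rewrite ler_wpM2r // ltW.
  rewrite -exprMn mulVf ?gt_eqF // expr1n.
  have -> : n%:R * th ^+ n * a = (1 + n%:R * a) * th ^+ n - th ^+ n by ring.
  lra.
have [|N NP] := @geometric_small _ (324 * C * a^-1 ^+ 2) (th ^+ 2) _ _ e0.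
  by rewrite sqr_ge0 /= expr_lt1 // ltW.
exists N.+1; apply: le_lt_trans (NP N.+1 (leqnSn N)).
have -> : l ^+ N.+1 = (th ^+ N.+1) ^+ 2 * (th ^+ 2) ^+ N.+1.
  by rewrite -th4 -!exprM -exprD [(N.+1 * 2)%N]mulnC -mulnDl.
set j := N.+1; rewrite mulrA ler_wpM2r ?exprn_ge0 ?(ltW th0) //.
have jle : (6 * j + 12)%:R <= 18 * j%:R :> R.
  by rewrite -natrM ler_nat [leqRHS](_ : _ = 6 * j + 12 * j)%N ?leq_add2l ?leq_pmulr // -mulnDl.
have H1 : (6 * j + 12)%:R * th ^+ j <= 18 * a^-1.
  apply: (@le_trans _ _ (18 * (j%:R * th ^+ j))); last by rewrite ler_wpM2l.
  by rewrite mulrA ler_wpM2r // exprn_ge0 // ltW.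
have -> : (6 * j + 12)%:R ^+ 2 * C * (th ^+ j) ^+ 2 =
    C * ((6 * j + 12)%:R * th ^+ j) ^+ 2 by ring.
have -> : 324 * C * a^-1 ^+ 2 = C * (18 * a^-1) ^+ 2 by ring.
rewrite ler_wpM2l // lerXn2r ?nnegrE // ?mulr_ge0 ?ler0n ?exprn_ge0 ?invr_ge0 //; lra.
Qed.

Section ConvexDomain.
Variables (R : realType) (d : nat).
Local Notation V := 'rV[R[i]]_d.
Local Notation enorm := (@euclidean_norm R d).
Variable Omega : set V.
Implicit Types (v x y p q : V) (u w z c : R[i]) (t : R).

Hypothesis opO : forall x, Omega x ->
  exists2 e : R, 0 < e & forall h, enorm h < e -> Omega (x + h).
Hypothesis cvxO : forall x y t, Omega x -> Omega y -> 0 <= t <= 1 ->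
  Omega (x + t%:C *: (y - x)).
Variable Dm : R.
Hypothesis Dm0 : 0 < Dm.
Hypothesis diamO : forall x y, Omega x -> Omega y -> enorm (x - y) <= Dm.

Definition bdry y := ~ Omega y /\
  forall e : R, 0 < e -> exists2 h, enorm h < e & Omega (y + h).

Lemma exit_point p q : Omega p -> ~ Omega q ->
  exists t, [/\ 0 < t, t <= 1 & bdry (p + t%:C *: (q - p))].
Proof.
move=> Op Oq.
pose S := [set s : R | 0 <= s <= 1 /\ Omega (p + s%:C *: (q - p))].
have S0 : S 0 by split; [lra|rewrite scale0r addr0].
have Sub : ubound S 1 by move=> s [/andP[]].
have Sne : S !=set0 by exists 0.
have hsup : has_sup S by split=> //; exists 1.
pose t := sup S.
have t0 : 0 <= t by apply: ub_le_sup => //; exists 1.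
have t1 : t <= 1 by apply: ge_sup.
have nOt : ~ Omega (p + t%:C *: (q - p)).
  move=> Ot; have [e e0 eP] := opO Ot.
  have t1' : t < 1.
    rewrite lt_neqAle t1 andbT; apply/eqP => tE; apply: Oq.
    by move: Ot; rewrite tE scale1r addrC subrK.
  pose s := Num.min ((1 - t) / 2) (e / (2 * (enorm (q - p) + 1))).
  have n0 := enorm_ge0 (q - p).
  have n1 : 0 < 2 * (enorm (q - p) + 1) by lra.
  have s0 : 0 < s by rewrite lt_min divr_gt0 //= ?divr_gt0 //; lra.
  have [s1 s2] : s <= (1 - t) / 2 /\ s <= e / (2 * (enorm (q - p) + 1)).
    by rewrite !ge_min !lexx orbT.
  have : S (t + s).
    split; first lra.
    rewrite rmorphD /= scalerDl addrA; apply: eP.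
    rewrite enormZ modc_real gtr0_norm //.
    rewrite ler_pdivlMr // in s2; nra.
  move=> /(ub_le_sup (ex_intro _ 1 Sub)); rewrite -/t; lra.
exists t; split=> //.
  rewrite lt_neqAle t0 andbT; apply/eqP => tE; apply: nOt.
  by rewrite -tE scale0r addr0.
split=> // e e0.
have n0 := enorm_ge0 (q - p).
have n1 : 0 < enorm (q - p) + 1 by lra.
have [|s Ss ts] := @sup_adherent _ S (e / (enorm (q - p) + 1)) _ hsup.
  by rewrite divr_gt0.
have st : s <= t by apply: ub_le_sup Ss; exists 1.
exists ((s - t)%:C *: (q - p)); last first.
  by rewrite -addrA -scalerDl -rmorphD /= [t + _]addrC subrK; exact: (proj2 Ss).
rewrite enormZ modc_real ler0_norm; last lra.
have ts' : t - s < e / (enorm (q - p) + 1) by rewrite -/t in ts; lra.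
rewrite ltr_pdivlMr // in ts'.
have : 0 <= t - s by lra.
nra.
Qed.

Definition in_ball p (r : R) := forall h, enorm h < r -> Omega (p + h).

Variables (nu : V -> V) (r0 : R).
Hypothesis r00 : 0 < r0.
Hypothesis nu1 : forall y, bdry y -> enorm (nu y) = 1.
Hypothesis nu_supp : forall y (z : V), bdry y -> Omega z ->
  0 < complex.Re (hip (z - y) (nu y)).
Hypothesis nu_ball : forall y, bdry y -> in_ball (y + r0%:C *: nu y) r0.

(** [y] is where the segment from [p] to [q] leaves [Omega]. Along it the supporting functional at
    [y] is positive at [p] and 0 at [y], hence not positive at [q]. *)
Lemma separation p q : Omega p -> ~ Omega q -> exists y,
  [/\ bdry y, complex.Re (hip (q - y) (nu y)) <= 0 & enorm (y - p) <= enorm (q - p)].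
Proof.
move=> Op Oq; have [t [t0 t1 bt]] := exit_point Op Oq.
exists (p + t%:C *: (q - p)); split=> //; last first.
  rewrite [p + _]addrC addrK enormZ modc_real gtr0_norm //.
  by rewrite ler_piMl // enorm_ge0.
set y := p + _ in bt *.
have := nu_supp bt Op.
have -> : p - y = (- t)%:C *: (q - p) by rewrite /y opprD addNKr rmorphN scaleNr.
have -> : q - y = (1 - t)%:C *: (q - p).
  by rewrite /y opprD addrA rmorphB /= rmorph1 scalerBl scale1r.
rewrite !hipZl !cReZ => H.
have X0 : complex.Re (hip (q - p) (nu y)) < 0.
  by rewrite -oppr_gt0 -(pmulr_rgt0 _ t0); lra.
by rewrite mulr_ge0_le0 //; lra.
Qed.

Lemma bdry_supp_ge0 y y' : bdry y -> bdry y' ->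
  0 <= complex.Re (hip (y' - y) (nu y)).
Proof.
move=> by_ [_ cl]; apply/ler_addgt0Pr => e e0.
have [h he Oh] := cl e e0.
have := nu_supp by_ Oh; rewrite addrAC (hipDl _ h) cReD => H.
have := cauchy_schwarz h (nu y); rewrite nu1 // mulr1. lra.
Qed.

Lemma bdry_diam y y' : bdry y -> bdry y' -> enorm (y - y') <= Dm.
Proof.
move=> [_ cl] [_ cl']; apply/ler_addgt0Pr => e e0.
have [|h he Oh] := cl (e / 2); first lra.
have [|h' he' Oh'] := cl' (e / 2); first lra.
have := enormB (y + h - (y' + h')) (h - h').
have -> : y + h - (y' + h') - (h - h') = y - y'.
  by apply/rowP => j; rewrite !mxE; ring.
have := enormB h h'; have := diamO Oh Oh'; lra.
Qed.

(** The ball at [y'] contains points arbitrarily close to [y' + r0 (nu y' - nu y)], and these lie on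
    the positive side of the hyperplane at [y]. This gives [r0 <= k + r0 c] for the real inner
    product [c] of the two normals, while [enorm (nu y' - nu y) ^+ 2] is [2 - 2 c]. *)
Lemma nu_close y y' (k : R) : bdry y -> bdry y' ->
  complex.Re (hip (y' - y) (nu y)) <= k -> enorm (nu y' - nu y) ^+ 2 <= 2 * k / r0.
Proof.
move=> by_ by' hk.
have H : r0 <= k + r0 * complex.Re (hip (nu y') (nu y)).
  apply/ler_addgt0Pr => e e0.
  pose s := Num.max (r0 - e) 0.
  have [s0 s1 sr] : [/\ 0 <= s, r0 - e <= s & s < r0].
    by split; rewrite ?le_max ?lexx ?orbT // gt_max r00 andbT; lra.
  have := nu_ball by' (h := - (s%:C *: nu y)).
  rewrite enormN enormZ modc_real ger0_norm // nu1 // mulr1 => /(_ sr) Os.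
  have := nu_supp by_ Os.
  have -> : y' + r0%:C *: nu y' - s%:C *: nu y - y =
      (y' - y) + (r0%:C *: nu y' - s%:C *: nu y) by apply/rowP => j; rewrite !mxE; ring.
  rewrite hipDl (hipBl (r0%:C *: _)) !hipZl cReD (cReB (r0%:C * _)) !cReZ -(sqr_enorm (nu y)) nu1 // expr1n; lra.
rewrite sqr_enorm !(hipBl, hipBr) !cReB -!sqr_enorm !nu1 // expr1n.
rewrite (Re_hipC (nu y) (nu y')) ler_pdivlMr //; nra.
Qed.

Definition pos_hol (h : V -> R[i]) :=
  (forall z : V, Omega z -> differentiable h z) /\
  (forall z : V, Omega z -> 0 < complex.Re (h z)).

Lemma differentiable_hip (W : normedModType R[i]) (f : W -> V) (y nn : V) a :
  differentiable f a -> differentiable (fun b : W => hip (f b - y) nn) a.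
Proof.
move=> fa; rewrite /hip.
have -> : (fun b : W => \sum_j (f b - y) 0 j * (nn 0 j)^*%C) =
    \sum_j (fun b : W => (f b - y) 0 j * (nn 0 j)^*%C).
  by apply/funext => b; rewrite fct_sumE.
apply: differentiable_sum => j; apply: differentiableM => //.
have -> : (fun b : W => (f b - y) 0 j) = (fun b : W => f b 0 j - y 0 j).
  by apply/funext => b; rewrite !mxE.
apply: differentiableB => //.
apply: (@differentiable_comp _ _ _ _ f (fun M : V => M 0 j)) => //.
exact: differentiable_coord.
Qed.

Lemma pos_hol_supp y : bdry y -> pos_hol (fun z : V => hip (z - y) (nu y)).
Proof.
move=> yb; split=> z Oz; last exact: nu_supp.
exact: (@differentiable_hip _ id).
Qed.

(** The Harnack constant at relative distance [2 / 3] is [(1 + 2 / 3) / (1 - 2 / 3) = 5]. *)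
Lemma harnack_scaled (f : R[i] -> R[i]) (a z : R[i]) (r : R) : 0 < r ->
  (forall w : R[i], modc (w - a) < r -> differentiable f w) ->
  (forall w : R[i], modc (w - a) < r -> 0 < complex.Re (f w)) ->
  modc (z - a) <= 2 / 3 * r ->
  complex.Re (f z) <= 5 * complex.Re (f a) /\
  complex.Re (f a) <= 5 * complex.Re (f z).
Proof.
move=> r_gt0 fd fp za.
have rr (w : R[i]) : modc w < 1 -> modc (a + r%:C * w - a) < r.
  move=> w1; rewrite [a + _]addrC addrK modcM modc_real gtr0_norm //.
  by rewrite gtr_pMr.
pose g (w : R[i]) := f (a + r%:C * w).
have gd (w : R[i]) : modc w < 1 -> differentiable g w.
  move=> w1; have idd : differentiable (fun w : R[i] => w) w by [].
  have aff : differentiable (fun w : R[i] => a + r%:C * w) w.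
    have := differentiableD (differentiable_cst (a : R[i]) w)
      (differentiableM (differentiable_cst (r%:C : R[i]) w) idd).
    exact.
  exact: (@differentiable_comp _ _ _ _ (fun w : R[i] => a + r%:C * w) f w aff (fd _ (rr _ w1))).
have gp (w : R[i]) : modc w < 1 -> 0 < complex.Re (g w) by move=> w1; apply: fp; exact: rr.
have rn0 : r%:C != 0 :> R[i] by rewrite -modc_eq0 modc_real normr_eq0 gt_eqF.
pose w := (z - a) / r%:C.
have wz : modc w <= 2 / 3.
  by rewrite modcM modcV modc_real gtr0_norm // ler_pdivrMr.
have w1 : modc w < 1 by lra.
have [_] := half_plane_schwarz gd gp w1.
have -> : g w = f z by rewrite /g /w mulrC divfK // addrC subrK.
have -> : g 0 = f a by rewrite /g mulr0 addr0.
have w0 := modc_ge0 w.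
have fa0 : 0 < complex.Re (f a) by apply: fp; rewrite subrr modc0.
have fz0 : 0 < complex.Re (f z) by apply: fp; lra.
by move=> h1 h2; split; nra.
Qed.

Lemma differentiable_line p v (w : R[i]) : differentiable (fun w : R[i] => p + w *: v) w.
Proof.
apply: differentiableD => //; exact: (@differentiableZl _ _ _ id).
Qed.

Lemma harnack_ball h p q (r : R) : pos_hol h -> 0 < r -> in_ball p r ->
  enorm (q - p) <= 2 / 3 * r -> complex.Re (h q) <= 5 * complex.Re (h p) /\
  complex.Re (h p) <= 5 * complex.Re (h q).
Proof.
move=> [hd hp] r_gt0 pr qp.
have [->|qp0] := eqVneq q p.
  have : 0 < complex.Re (h p) by apply: hp; rewrite -[p]addr0; apply: pr; rewrite enorm0.
  by split; lra.
have e0 : 0 < enorm (q - p) by rewrite enorm_gt0 subr_eq0.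
pose f (w : R[i]) := h (p + w *: (q - p)).
pose s := r / enorm (q - p).
have inO (w : R[i]) : modc (w - 0) < s -> Omega (p + w *: (q - p)).
  by rewrite subr0 ltr_pdivlMr // => ws; apply: pr; rewrite enormZ.
have [||||] := @harnack_scaled f 0 1 s.
- by rewrite divr_gt0.
- move=> w /inO Ow.
  apply: (@differentiable_comp _ _ _ _ (fun w : R[i] => p + w *: (q - p)) h).
    exact: differentiable_line.
  exact: hd.
- by move=> w /inO; exact: hp.
- by rewrite subr0 modc1 /s mulrA ler_pdivlMr // mul1r.
by rewrite /f scale0r addr0 scale1r [p + _]addrC subrK.
Qed.

(* Harnack's inequality along the segment from [p] to [q]: by convexity, the point
   [s k] of that segment keeps a distance of order [l ^+ k] to the complement. *)
Lemma harnack_segment h p q (c0 l : R) i : pos_hol h -> 0 < c0 -> in_ball p c0 ->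
  0 < l < 1 -> (1 - l) * Dm <= c0 / 2 -> Omega q -> in_ball q (2 * Dm * l ^+ i) ->
  complex.Re (h p) <= 5 ^+ i.+1 * complex.Re (h q).
Proof.
move=> ph c00 pc /andP[l0 l1] lD Oq qi.
pose s k := p + (1 - l ^+ k)%:C *: (q - p).
have Op : Omega p by rewrite -[p]addr0; apply: pc; rewrite enorm0.
have pq := diamO Oq Op.
have lk0 k : 0 < l ^+ k by rewrite exprn_gt0.
have lk1 k : l ^+ k <= 1 by rewrite exprn_ile1 // ltW.
have sb k : in_ball (s k) (c0 * l ^+ k).
  move=> hh hk.
  have lkC : (l ^+ k)%:C != 0 :> R[i] by rewrite -modc_eq0 modc_real normr_eq0 gt_eqF.
  have Oph : Omega (p + (l ^+ k)%:C^-1 *: hh).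
    apply: pc; rewrite enormZ modcV modc_real gtr0_norm //.
    by rewrite mulrC ltr_pdivrMr.
  have := cvxO Oq Oph (t := l ^+ k); rewrite (ltW (lk0 k)) lk1 => /(_ isT).
  congr (Omega _); rewrite /s.
  rewrite !scalerBr scalerDr scalerA mulfV // scale1r rmorphB /= rmorph1 !scalerBl !scale1r.
  rewrite opprB !addrA.
  by apply/rowP => j; rewrite !mxE; ring.
have step k : complex.Re (h p) <= 5 ^+ k * complex.Re (h (s k)).
  elim: k => [|k IH].
    by rewrite expr0 mul1r /s expr0 subrr scale0r addr0.
  apply: le_trans IH _; rewrite exprSr -mulrA ler_wpM2l ?exprn_ge0 //.
  have c0l : 0 < c0 * l ^+ k by rewrite mulr_gt0.
  (* By the choice of [l] a step is at most half the radius of the ball around [s k], within the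
     range of [harnack_ball]. *)
  suff : enorm (s k.+1 - s k) <= 2 / 3 * (c0 * l ^+ k).
    by case/(harnack_ball ph c0l (sb k)).
  have -> : s k.+1 - s k = (l ^+ k * (1 - l))%:C *: (q - p).
    rewrite /s opprD addrACA subrr add0r -scalerBl -rmorphB /= exprS.
    by congr (_%:C *: _); ring.
  rewrite enormZ modc_real ger0_norm; last by rewrite mulr_ge0 ?(ltW (lk0 k)) //; lra.
  have : (1 - l) * enorm (q - p) <= (1 - l) * Dm by rewrite ler_wpM2l //; lra.
  have := lk0 k; have := enorm_ge0 (q - p); nra.
rewrite exprSr -mulrA; apply: le_trans (step i) _.
rewrite ler_wpM2l ?exprn_ge0 //.
have qi' : enorm (s i - q) <= 1 / 2 * (2 * Dm * l ^+ i).
  have -> : s i - q = - ((l ^+ i)%:C *: (q - p)).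
    rewrite /s rmorphB /= rmorph1 scalerBl scale1r addrA [p + (q - p)]addrC subrK.
    by rewrite addrAC subrr add0r.
  rewrite enormN enormZ modc_real gtr0_norm //; have := lk0 i; nra.
have r1 : 0 < 2 * Dm * l ^+ i by rewrite !mulr_gt0.
have [|//] := harnack_ball (q := s i) ph r1 qi; lra.
Qed.

(** Contrapositive of [harnack_segment]: where [h] is too small there is no room for a ball of
    radius [2 * Dm * l ^+ i], and the segment to a point of that ball outside [Omega] meets the
    boundary. *)
Lemma near_bdry h p q (c0 l : R) i : pos_hol h -> 0 < c0 -> in_ball p c0 ->
  0 < l < 1 -> (1 - l) * Dm <= c0 / 2 -> Omega q ->
  5 ^+ i.+1 * complex.Re (h q) < complex.Re (h p) ->
  exists2 y, bdry y & enorm (y - q) < 2 * Dm * l ^+ i.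
Proof.
move=> ph c00 pc l01 lD Oq hh.
have : ~ in_ball q (2 * Dm * l ^+ i).
  by move=> /(harnack_segment ph c00 pc l01 lD Oq); rewrite leNgt hh.
move=> /existsNP[k /not_implyP[k1 k2]].
have [y [yb _ yk]] := separation Oq k2.
by exists y => //; apply: le_lt_trans yk _; rewrite addrC addKr.
Qed.

Lemma pos_hol_comp h (f : R[i] -> V) (w : R[i]) : pos_hol h -> Omega (f w) ->
  differentiable f w ->
  differentiable (fun z => h (f z)) w /\ 0 < complex.Re (h (f w)).
Proof.
move=> [hd hp] Ow fw; split; last exact: hp.
by apply: (@differentiable_comp _ _ _ _ f h) => //; exact: hd.
Qed.

Lemma harnack_disc h (f : R[i] -> V) (a z : R[i]) (r : R) : pos_hol h -> 0 < r ->
  (forall w : R[i], modc (w - a) < r -> Omega (f w) /\ differentiable f w) ->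
  modc (z - a) <= 2 / 3 * r ->
  complex.Re (h (f z)) <= 5 * complex.Re (h (f a)) /\
  complex.Re (h (f a)) <= 5 * complex.Re (h (f z)).
Proof.
move=> ph r_gt0 fO za.
have fd w : modc (w - a) < r -> differentiable (fun w => h (f w)) w.
  by move=> /fO[Ow fw]; have [] := pos_hol_comp ph Ow fw.
have fp w : modc (w - a) < r -> 0 < complex.Re (h (f w)).
  by move=> /fO[Ow fw]; have [] := pos_hol_comp ph Ow fw.
exact: (harnack_scaled r_gt0 fd fp za).
Qed.

(** [F] is a bidisc whose centre lies deep in [Omega]. By the last hypothesis and Harnack's
    inequality every point [Q u0 k] of the chain is within [dd] of the boundary, and consecutive
    points have nearly the same supporting hyperplane. Hence on a circle of [u], with [w = 0], the
    values of [F] lie at most slightly inside the hyperplane at [Y]. By the maximum principle so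
    does [F 0 0], against the ball of radius [c0] around it. *)
Lemma bidisc_core (F : R[i] -> R[i] -> V) (j : nat) (c0 l : R) (w0 : R[i])
    (N := (6 * j + 12)%N) (dd := 2 * Dm * l ^+ j) (eps := (1 / 2) ^+ N.+1 : R) :
  0 < c0 -> 0 < l < 1 -> (1 - l) * Dm <= c0 / 2 ->
  (N%:R * Dm) ^+ 2 * (52 * dd / r0) < (c0 / 2) ^+ 2 -> dd <= c0 / 2 ->
  (forall u w : R[i], modc u < 1 - eps -> modc w < 1 - eps ->
    [/\ Omega (F u w), differentiable (fun u => F u w) u &
        differentiable (fun w => F u w) w]) ->
  in_ball (F 0 0) c0 -> modc w0 = 1 ->
  (forall (u0 : R[i]) k, modc u0 = 1 -> (k <= N)%N -> exists2 h, pos_hol h &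
     complex.Re (h (F ((1 - (1 / 2) ^+ (N - k) : R)%:C * u0)
                      ((1 - (1 / 2) ^+ k : R)%:C * w0))) <=
     4 * (1 / 2) ^+ (3 * j + 6) * complex.Re (h (F 0 0))) ->
  False.
Proof.
move=> c00 l01 lD small1 small2 FO Fb w01 Fh.
pose hf k : R := (1 / 2) ^+ k.
have hf0 k : 0 < hf k by rewrite exprn_gt0 //; lra.
have hfS k : hf k.+1 = hf k / 2 by rewrite /hf exprS; ring.
have hf1 k : hf k <= 1 by rewrite exprn_ile1 //; lra.
have hfmono k m : (k <= m)%N -> hf m <= hf k.
  by move=> km; rewrite /hf ler_wiXn2l //; lra.
have epsE : eps = hf N / 2 by rewrite -hfS.
pose U k (u0 : R[i]) : R[i] := (1 - hf k)%:C * u0.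
have mU k u0 : modc u0 = 1 -> modc (U k u0) = 1 - hf k.
  by move=> u1; rewrite modcM u1 mulr1 modc_real ger0_norm // subr_ge0.
have UN k u0 : (k <= N)%N -> modc u0 = 1 -> modc (U k u0) < 1 - eps.
  by move=> kN u1; rewrite mU // epsE; have := hfmono k N kN; have := hf0 N; lra.
have US k u0 : U k.+1 u0 - U k u0 = (hf k / 2)%:C * u0.
  by rewrite /U -mulrBl -rmorphB /= hfS; congr (_%:C * _); field.
have U0 u0 : U 0%N u0 = 0 by rewrite /U /hf expr0 subrr mul0r.
pose Q u0 k := F (U (N - k)%N u0) (U k w0).
have OQ u0 k : modc u0 = 1 -> (k <= N)%N -> Omega (Q u0 k).
  by move=> u1 kN; have [] := FO _ _ (UN _ _ (leq_subr k N) u1) (UN _ _ kN w01).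
have dd0 : 0 < dd by rewrite /dd !mulr_gt0 ?exprn_gt0 //; case/andP: l01.
have nearQ u0 k : modc u0 = 1 -> (k <= N)%N ->
    exists2 y, bdry y & enorm (y - Q u0 k) < dd.
  move=> u1 kN; have [h ph hh] := Fh u0 k u1 kN.
  apply: (near_bdry ph c00 Fb l01 lD (OQ u0 k u1 kN)).
  have O00 : Omega (F 0 0) by rewrite -[F 0 0]addr0; apply: Fb; rewrite enorm0.
  have H0 := ph.2 _ O00.
  apply: le_lt_trans (ler_wpM2l _ hh) _; first by rewrite exprn_ge0.
  rewrite mulrA gtr_pMl //.
  (* Harnack's loss [5 ^+ j.+1] against a gain of order [8 ^+ j]: hence the factor 3 in [3 * j + 6],
     whose offset 6 absorbs the constants. *)
  have -> : 5 ^+ j.+1 * (4 * (1 / 2) ^+ (3 * j + 6)) = 5 / 16 * (5 / 8) ^+ j :> R.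
    have -> : (5 / 8) ^+ j = 5 ^+ j * ((1 / 2) ^+ 3) ^+ j :> R.
      by rewrite -exprMn; congr (_ ^+ _); field.
    by rewrite exprD exprM exprS; field.
  have : (5 / 8) ^+ j <= 1 :> R by rewrite exprn_ile1 //; lra.
  lra.
(* Two moves with Harnack constant 5 each, in [u] and then in [w], by way of
   [F (U m u0) (U k w0)]. *)
have step u0 k H : modc u0 = 1 -> (k < N)%N -> pos_hol H ->
    complex.Re (H (Q u0 k.+1)) <= 25 * complex.Re (H (Q u0 k)).
  move=> u1 kN pH.
  pose m := (N - k.+1)%N.
  have Nk : (N - k)%N = m.+1 by rewrite /m subnSK.
  have mN : (m < N)%N by rewrite /m ltn_subrL /= (leq_ltn_trans (leq0n k) kN).
  have r1 (i : nat) : (i < N)%N -> 0 < 3 / 4 * hf i by have := hf0 i; lra.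
  (* For [i < N] the gap left to the unit circle, [hf i / 4], is at least [hf N / 2 = eps]. *)
  have disc (i : nat) (a z : R[i]) : (i < N)%N -> modc a = 1 ->
      modc (z - U i a) < 3 / 4 * hf i -> modc z < 1 - eps.
    move=> iN a1 za; have := modcD (z - U i a) (U i a); rewrite subrK mU //.
    have := hfmono i.+1 N iN; rewrite epsE hfS; lra.
  have ratio i (a : R[i]) : modc a = 1 ->
      modc (U i.+1 a - U i a) <= 2 / 3 * (3 / 4 * hf i).
    move=> a1; rewrite US modcM a1 mulr1 modc_real gtr0_norm ?divr_gt0 //.
    by rewrite le_eqVlt; apply/orP; left; apply/eqP; field.
  have [|_ H1] := @harnack_disc H (fun u => F u (U k w0)) (U m u0) (U m.+1 u0)
      (3 / 4 * hf m) pH (r1 m mN) _ (ratio m u0 u1).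
    move=> w wa; have := disc m u0 w mN u1 wa => w1.
    by have [] := FO w (U k w0) w1 (UN _ _ (ltnW kN) w01).
  have [|H2 _] := @harnack_disc H (fun w => F (U m u0) w) (U k w0) (U k.+1 w0)
      (3 / 4 * hf k) pH (r1 k kN) _ (ratio k w0 w01).
    move=> w wa; have := disc k w0 w kN w01 wa => w1.
    by have [] := FO (U m u0) w (UN _ _ (ltnW mN) u1) w1.
  rewrite /Q Nk -/m; lra.
have one1 : modc (1 : R[i]) = 1 := modc1 R.
have [Y Yb YQ] := nearQ 1 N one1 (leqnn N).
(* For [k = N] the first coordinate is 0, whatever [u0] is. *)
have QN u0 : Q u0 N = Q 1 N by rewrite /Q subnn !U0.
pose sg := Num.sqrt (52 * dd / r0).
have sg0 : 0 <= sg by exact: sqrtr_ge0.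
have sg2 : sg ^+ 2 = 52 * dd / r0.
  by rewrite sqr_sqrtr // divr_ge0 ?(ltW r00) // mulr_ge0 // ltW.
have chain u0 m : modc u0 = 1 -> (m <= N)%N -> exists y,
    [/\ bdry y, enorm (y - Q u0 (N - m)%N) < dd & enorm (nu y - nu Y) <= m%:R * sg].
  move=> u1; elim: m => [_|m IH mN].
    by exists Y; rewrite subn0 QN subrr enorm0 mul0r.
  have [y' [y'b y'Q y'Y]] := IH (ltnW mN).
  have [y yb yQ] := nearQ u0 (N - m.+1)%N u1 (leq_subr _ _).
  exists y; split=> //.
  have kE : (N - m)%N = (N - m.+1).+1 by rewrite subnSK.
  have kN : (N - m.+1 < N)%N by rewrite ltn_subrL /= (leq_ltn_trans (leq0n m) mN).
  set k := (N - m.+1)%N in yQ kE kN *; rewrite kE in y'Q.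
  have st := step u0 k _ u1 kN (pos_hol_supp yb).
  have c1 := cauchy_schwarz (Q u0 k - y) (nu y).
  have c2 := cauchy_schwarz (y' - Q u0 k.+1) (nu y).
  rewrite nu1 // mulr1 enorm_distC in c1; rewrite nu1 // mulr1 in c2.
  (* The functional of [y] is below [dd] at [Q u0 k], hence below [25 * dd] at the next point of the
     chain, which is within [dd] of [y']. *)
  have : complex.Re (hip (y' - y) (nu y)) <= 26 * dd.
    have -> : y' - y = (y' - Q u0 k.+1) + (Q u0 k.+1 - y) by rewrite addrA subrK.
    have -> : 26 * dd = dd + 25 * dd by ring.
    rewrite hipDl cReD; apply: lerD; first exact: le_trans c2 (ltW y'Q).
    by apply: le_trans st _; rewrite ler_pM2l //; exact: le_trans c1 (ltW yQ).
  move=> /(nu_close yb y'b); have -> : 2 * (26 * dd) / r0 = sg ^+ 2.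
    by rewrite sg2; ring.
  rewrite ler_pXn2r ?nnegrE ?enorm_ge0 // => e1.
  have := enormD (nu y - nu y') (nu y' - nu Y); rewrite addrA subrK.
  rewrite [enorm (nu y - nu y')]enorm_distC -natr1 mulrDl mul1r => H.
  by apply: le_trans H _; rewrite addrC lerD.
have Nsg : N%:R * Dm * sg < c0 / 2.
  have a0 : 0 <= N%:R * Dm by rewrite mulr_ge0 ?ler0n // ltW.
  rewrite -(@ltr_pXn2r _ 2) ?nnegrE //; last lra.
    by rewrite exprMn sg2.
  by rewrite mulr_ge0.
pose G u := hip (F u 0 - Y) (nu Y).
have N0 : (0 < N)%N by rewrite /N addnC.
have lt0e : modc (0 : R[i]) < 1 - eps.
  by rewrite modc0 epsE; have := hf1 N; lra.
have rN : 0 < 1 - hf N.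
  by rewrite subr_gt0; have := hfmono 1%N N N0; rewrite /hf expr1; lra.
have : complex.Re (G 0) <= dd + N%:R * Dm * sg.
  apply: (@re_max_principle _ G (1 - hf N)).
  - exact: rN.
  - move=> z zr; have z1 : modc z < 1 - eps.
      apply: le_lt_trans zr _.
      by rewrite epsE ltrD2l ltrN2 ltr_pdivrMr // ltr_pMr // ltr1n.
    have [_ Fd _] := FO z 0 z1 lt0e.
    exact: (@differentiable_hip _ (fun u => F u 0)).
  - move=> z zr.
    pose u0 := z / (1 - hf N)%:C.
    have u1 : modc u0 = 1.
      by rewrite modcM modcV modc_real gtr0_norm // zr divff // gt_eqF.
    have zE : F z 0 = Q u0 0%N.
      rewrite /Q subn0 U0; congr (F _ 0); rewrite /U /u0 mulrC divfK //.
      by rewrite -modc_eq0 modc_real gtr0_norm // gt_eqF.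
    have [y [yb yQ yY]] := chain u0 N u1 (leqnn N); rewrite subnn in yQ.
    rewrite /G zE.
    have -> : Q u0 0%N - Y = (Q u0 0%N - y) + (y - Y) by rewrite addrA subrK.
    rewrite hipDl cReD.
    have c1 := cauchy_schwarz (Q u0 0%N - y) (nu Y).
    rewrite nu1 // mulr1 enorm_distC in c1.
    (* The part with [nu y] is not positive, since [Y] lies on the inner side of the hyperplane at
       [y]; the rest is controlled by the turning of the normals. *)
    have -> : hip (y - Y) (nu Y) = hip (y - Y) (nu y) + hip (y - Y) (nu Y - nu y).
      by rewrite -hipDr [nu y + _]addrC subrK.
    have c2 := cauchy_schwarz (y - Y) (nu Y - nu y).
    have c3 := bdry_supp_ge0 yb Yb.
    rewrite -opprB hipNl cReN in c3.
    have c4 : enorm (y - Y) * enorm (nu Y - nu y) <= Dm * (N%:R * sg).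
      apply: ler_pM; rewrite ?enorm_ge0 //; first exact: bdry_diam.
      by rewrite enorm_distC.
    rewrite cReD; apply: lerD; first exact: le_trans c1 (ltW yQ).
    rewrite -[leRHS]add0r; apply: lerD; first by rewrite -oppr_ge0.
    by apply: le_trans c2 _; apply: le_trans c4 _; rewrite mulrA [Dm * _]mulrC.
(* The ball around [F 0 0] extends by [c0] towards the hyperplane at [Y] without crossing it. *)
have : c0 <= complex.Re (G 0).
  apply/ler_addgt0Pr => e e0.
  pose s := Num.max (c0 - e) 0.
  have [s0 s1 sr] : [/\ 0 <= s, c0 - e <= s & s < c0].
    by split; rewrite ?le_max ?lexx ?orbT // gt_max c00 andbT ltrBlDr ltrDl.
  have := Fb (- (s%:C *: nu Y)).
  rewrite enormN enormZ modc_real ger0_norm // nu1 // mulr1 => /(_ sr) Os.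
  have := nu_supp Yb Os; rewrite addrAC hipBl -/(G 0) hipZl cReB cReZ -sqr_enorm.
  rewrite nu1 // expr1n; lra.
lra.
Qed.

End ConvexDomain.

(** * Growth and decay of discs *)

(** The phase of [w] is chosen so that [b * w] is real and negative, with modulus close to that of
    [b]. *)
Lemma Re_linear_bound (R : realType) (c : R) (b : R[i]) :
  (forall w : R[i], modc w < 1 -> 0 < c + complex.Re (b * w)) -> modc b <= c.
Proof.
move=> H; have [->|b0] := eqVneq b 0.
  by have := H 0; rewrite modc0 mulr0 addr0 => /(_ ltr01)/ltW.
have b0' : 0 < modc b by rewrite modc_gt0.
apply/ler_addgt0Pr => e e0.
pose s := Num.max 0 (1 - e / modc b).
have eb : 0 < e / modc b by rewrite divr_gt0.
have [s0 s1 s2] : [/\ 0 <= s, 1 - e / modc b <= s & s < 1].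
  by split; rewrite ?le_max ?lexx ?orbT // gt_max ltr01; lra.
have := H (- ((s / modc b)%:C * b^*%C)).
rewrite modcN modcM modc_real modc_conj ger0_norm; last by rewrite divr_ge0 // ltW.
rewrite divfK ?gt_eqF // => /(_ s2).
have -> : b * - ((s / modc b)%:C * b^*%C) = - (s * modc b)%:C.
  have bb : b * b^*%C = (modc b ^+ 2)%:C.
    rewrite modc_sqr; case: b {b0 b0' H s eb s0 s1 s2} => b1 b2.
    by apply/eqP; rewrite eq_complex /=; apply/andP; split; apply/eqP; ring.
  rewrite mulrN mulrCA bb -rmorphM /=; congr (- _%:C).
  by field; rewrite gt_eqF.
rewrite cReN /= => H1.
have : (1 - e / modc b) * modc b <= s * modc b by rewrite ler_wpM2r // ltW.
rewrite mulrBl mul1r divfK ?gt_eqF //; lra.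
Qed.

Section Cayley.
Variable R : realType.
Implicit Types (u z : R[i]) (s e : R).

(** The conformal map of the unit disc onto the right half-plane that takes 0 to [s]. *)
Definition cayley s u : R[i] := s%:C * ((1 + u) / (1 - u)).

Lemma cayley_sub_neq0 u : modc u < 1 -> 1 - u != 0.
Proof.
by move=> u1; rewrite subr_eq0; apply: contraTneq u1 => <-; rewrite modc1 ltxx.
Qed.

Lemma Re_cayley s u : modc u < 1 ->
  complex.Re (cayley s u) = s * ((1 - modc u ^+ 2) / modc (1 - u) ^+ 2).
Proof.
move=> u1; rewrite /cayley cReZ cReM cReV cImV.
rewrite !(cReB, cImB, cReD, cImD) /= (modc_sqr u).
have := exprn_gt0 2 (_ : 0 < modc (1 - u)); rewrite modc_gt0 => /(_ (cayley_sub_neq0 u1)).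
set m := modc (1 - u) ^+ 2 => m0; congr (s * _).
by field; rewrite gt_eqF.
Qed.

(** The last bound puts the image in the disc of diameter [4 * s / e] tangent to the imaginary axis
    at 0, the shape that fits into the inner ball at a boundary point. *)
Lemma cayley_bounds s e u : 0 < s -> 0 < e -> modc u < 1 - e ->
  [/\ s * e / 4 <= complex.Re (cayley s u), modc (cayley s u) <= 2 * s / e &
      modc (cayley s u) ^+ 2 <= 4 * s / e * complex.Re (cayley s u)].
Proof.
move=> s0 e0 ue; have u0 := modc_ge0 u.
have u1 : modc u < 1 by lra.
have m0 : 0 < modc (1 - u) by rewrite modc_gt0 cayley_sub_neq0.
have mge : e <= modc (1 - u).
  by have := modcD (1 - u) u; rewrite subrK modc1; lra.
have mle : modc (1 - u) <= 2 by have := modcB 1 u; rewrite modc1; lra.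
have ple : modc (1 + u) <= 2 by have := modcD 1 u; rewrite modc1; lra.
have q0 : e <= 1 - modc u ^+ 2 by nra.
have m20 : 0 < modc (1 - u) ^+ 2 by rewrite exprn_gt0.
rewrite Re_cayley //; split.
- have -> : s * e / 4 = s * (e / 4) by ring.
  apply: ler_wpM2l; first exact: ltW.
  rewrite ler_pdivlMr //.
  have : modc (1 - u) ^+ 2 <= 4 by have := modc_ge0 (1 - u); nra.
  nra.
- rewrite /cayley !modcM modcV modc_real gtr0_norm //.
  rewrite mulrA ler_pdivrMr //.
  have : 2 * s / e * e <= 2 * s / e * modc (1 - u).
    by rewrite ler_wpM2l // divr_ge0 ?mulr_ge0 // ltW.
  rewrite divfK ?gt_eqF //; have := modc_ge0 (1 + u); nra.
- rewrite /cayley !modcM modcV modc_real gtr0_norm // !exprMn exprVn.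
  have -> : 4 * s / e * (s * ((1 - modc u ^+ 2) / modc (1 - u) ^+ 2)) =
    s ^+ 2 * (4 * ((1 - modc u ^+ 2) / e) / modc (1 - u) ^+ 2).
    by field; rewrite !gt_eqF.
  rewrite ler_wpM2l ?sqr_ge0 // ler_wpM2r ?invr_ge0 ?(ltW m20) //.
  have : modc (1 + u) ^+ 2 <= 4 by have := modc_ge0 (1 + u); nra.
  have : 1 <= (1 - modc u ^+ 2) / e by rewrite ler_pdivlMr // mul1r.
  lra.
Qed.

Lemma cayley_inv s u : 0 < s -> modc u < 1 ->
  u = (cayley s u - s%:C) / (cayley s u + s%:C).
Proof.
move=> s0 u1; rewrite /cayley.
have h1 := cayley_sub_neq0 u1.
have sC : s%:C != 0 :> R[i] by rewrite -modc_eq0 modc_real normr_eq0 gt_eqF.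
have h2 : s%:C * (1 + u) + s%:C * (1 - u) != 0.
  have -> : s%:C * (1 + u) + s%:C * (1 - u) = s%:C * 2 by ring.
  by rewrite mulf_neq0 // pnatr_eq0.
by field; rewrite h1 h2.
Qed.

Lemma differentiable_cayley s u : modc u < 1 -> differentiable (cayley s) u.
Proof.
move=> /cayley_sub_neq0 u1.
have idd : differentiable (fun w : R[i] => w) u by [].
have one := differentiable_cst (1 : R[i]) u.
have den : differentiable (fun w : R[i] => 1 - w) u by exact: (differentiableB one idd).
have num : differentiable (fun w : R[i] => 1 + w) u by exact: (differentiableD one idd).
exact: (differentiableM (differentiable_cst (s%:C : R[i]) u)
  (differentiableM num (differentiableV den u1))).
Qed.

End Cayley.

(** For a functional [al z + be w + ga]: [a] and [A0] are the real part and the modulus of [al], [b]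
    is the modulus of [be], and [g] the real part of [ga]. The two inequalities between [b], [a] and
    [g] leave [a * dl] of order [k * b], since the lower height is at most half of [dl]. Then [g] is
    of order [b], and the last inequality, from the inner ball, carries the bound from [a] to [A0]
    because [dl] is small against [k * r0]. *)
Lemma functional_bounds (R : realType) (a A0 b g k r0 dl iA : R) :
  0 < b -> 0 < k <= 1 -> 0 < r0 -> 0 < dl -> 0 < iA <= 1 / 2 -> 4 * dl <= k * r0 ->
  `|a| <= A0 -> b <= a * (dl * iA) + g -> a * dl + g <= b * (1 + k) ->
  r0 * A0 <= g + r0 * a -> A0 * dl <= 3 * k * b.
Proof.
move=> b0 /andP[k0 k1] r00 dl0 /andP[i0 i1] dk aA h1 h2 h3.
have [a1 a2] : - A0 <= a /\ a <= A0 by move: aA; rewrite ler_norml => /andP.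
have had : a * dl <= 2 * k * b.
  have [a0|a0] := lerP a 0.
    have : a * dl <= 0 by rewrite mulr_le0_ge0 // ltW.
    have : 0 <= 2 * k * b by rewrite !mulr_ge0 // ltW.
    lra.
  have : a * dl * iA <= a * dl * (1 / 2) by rewrite ler_wpM2l // mulr_ge0 // ltW.
  lra.
have hg : g <= 4 * b.
  have [a0|a0] := lerP 0 a.
    have : 0 <= a * dl by rewrite mulr_ge0 // ltW.
    have : b * k <= b * 1 by rewrite ler_wpM2l // ltW.
    have : 0 <= a * (dl * iA) by rewrite !mulr_ge0 // ltW.
    lra.
  have g2 : 2 * r0 * (- a) <= g.
    have : r0 * (- a) <= r0 * A0 by rewrite ler_wpM2l ?(ltW r00) //; lra.
    lra.
  have : 4 * dl * (- a) <= k * r0 * (- a) by rewrite ler_wpM2r //; lra.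
  have : k * (r0 * (- a)) <= 1 * (r0 * (- a)).
    by rewrite ler_wpM2r // mulr_ge0 ?(ltW r00) //; lra.
  have : b * k <= b * 1 by rewrite ler_wpM2l // ltW.
  lra.
have : r0 * (A0 * dl) <= r0 * (3 * k * b); last by rewrite ler_pM2l.
have e1 : dl * (r0 * A0) <= dl * (g + r0 * a) by rewrite ler_wpM2l // ltW.
have e2 : r0 * (a * dl) <= r0 * (2 * k * b) by rewrite ler_wpM2l // ltW.
have e3 : dl * g <= dl * (4 * b) by rewrite ler_wpM2l // ltW.
have e4 : 4 * dl * b <= k * r0 * b by rewrite ler_wpM2r // ltW.
lra.
Qed.

Lemma height_arith (R : realType) (dl s e t : R) : 0 < dl -> 0 < e <= 1 / 8 ->
  s = dl * e / 8 -> 2 * e <= t ->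
  [/\ 0 < e / 8 <= 1 / 64, 16 * (e / 8) <= t, 0 < s * e / 8 <= s & s <= dl].
Proof.
move=> dl0 /andP[e0 e1] sE te.
have s0 : 0 < s by rewrite sE divr_gt0 // mulr_gt0.
have q0 : 0 < s * e / 8 by rewrite divr_gt0 // mulr_gt0.
have e1' : e <= 1 by lra.
have : s * e <= s * 1 by rewrite ler_wpM2l ?(ltW s0).
have : dl * e <= dl * 1 by rewrite ler_wpM2l ?(ltW dl0).
by move=> h1 h2; split; lra.
Qed.

(** By [A0 * dl <= 3 * k * b] the functional varies with the height by [O(k b)] only, and
    [k <= t / 16]. So its value at [(1 - t) w0] is about [t b] and its value at the centre about
    [b]. *)
Lemma functional_ratio (R : realType) (a A0 b g k dl s q t X : R) :
  0 < b -> 0 < k <= 1 / 64 -> 16 * k <= t -> A0 * dl <= 3 * k * b -> `|a| <= A0 ->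
  0 < q <= s -> s <= dl -> b <= a * q + g -> a * dl + g <= b * (1 + k) ->
  X <= 3 * k * b -> X - (1 - t) * b + g <= 4 * t * (a * s + g).
Proof.
move=> b0 /andP[k0 k1] kt A0dl aA /andP[q0 qs] sdl h1 h2 hX.
have [a1 a2] : - A0 <= a /\ a <= A0 by move: aA; rewrite ler_norml => /andP.
have dl0 : 0 < dl by lra.
have adl : - A0 * dl <= a * dl by rewrite ler_wpM2r // ltW.
have A00 : 0 <= A0 by apply: le_trans aA.
have e1 : A0 * (s - q) <= A0 * dl by rewrite ler_wpM2l //; lra.
have e2 : - A0 * (s - q) <= a * (s - q) by rewrite ler_wpM2r //; lra.
have base : b - 3 * k * b <= a * s + g by lra.
have kb : 16 * k * b <= t * b by rewrite ler_wpM2r // ltW.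
have kb2 : k * b <= 1 / 64 * b by rewrite ler_wpM2r // ltW.
have tb : t * (b - 3 * k * b) <= t * (a * s + g) by rewrite ler_wpM2l //; lra.
have tb0 : 0 <= t * b by rewrite mulr_ge0 ?(ltW b0) //; lra.
have tkb : t * (k * b) <= t * (1 / 64 * b) by rewrite ler_wpM2l //; lra.
lra.
Qed.

Lemma chain_half_length (i j : nat) : (i < 3 * j + 6)%N ->
  (3 * j + 6 <= 6 * j + 12 - i)%N.
Proof. lia. Qed.

(** * Growth of affine discs centred on the inner normal *)

Section KeyEstimate.
Variables (R : realType) (d : nat).
Local Notation V := 'rV[R[i]]_d.
Local Notation enorm := (@euclidean_norm R d).
Variable Omega : set V.
Implicit Types (v x y p q : V) (u w z c : R[i]) (t : R).

Hypothesis opO : forall x, Omega x ->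
  exists2 e : R, 0 < e & forall h, enorm h < e -> Omega (x + h).
Hypothesis cvxO : forall x y t, Omega x -> Omega y -> 0 <= t <= 1 ->
  Omega (x + t%:C *: (y - x)).
Variable Dm : R.
Hypothesis Dm0 : 0 < Dm.
Hypothesis diamO : forall x y, Omega x -> Omega y -> enorm (x - y) <= Dm.
Variables (nu : V -> V) (r0 : R).
Hypothesis r00 : 0 < r0.
Local Notation bdry := (bdry Omega).
Local Notation in_ball := (in_ball Omega).
Local Notation pos_hol := (pos_hol Omega).
Hypothesis nu1 : forall y, bdry y -> enorm (nu y) = 1.
Hypothesis nu_supp : forall y (z : V), bdry y -> Omega z ->
  0 < complex.Re (hip (z - y) (nu y)).
Hypothesis nu_ball : forall y, bdry y -> in_ball (y + r0%:C *: nu y) r0.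

Lemma hip_self v : hip v v = (enorm v ^+ 2)%:C.
Proof.
apply/eqP; rewrite eq_complex /= -sqr_enorm eqxx /=.
by have := hip_conj v v; case: (hip v v) => a b [] /eqP; rewrite -addr_eq0 -mulr2n mulrn_eq0 /=.
Qed.

Variable x : V.
Hypothesis xb : bdry x.
Local Notation n := (nu x).

Definition bipoint v z w : V := x + z *: n + w *: v.

Lemma hip_bipoint y (m v : V) z w :
  hip (bipoint v z w - y) m = hip n m * z + hip v m * w + hip (x - y) m.
Proof.
have -> : bipoint v z w - y = z *: n + w *: v + (x - y).
  by apply/rowP => j; rewrite !mxE; ring.
by rewrite !hipDl !hipZl; ring.
Qed.

Lemma ball_bipoint v z : modc (z - r0%:C) < r0 -> Omega (bipoint v z 0).
Proof.
move=> zr; have := nu_ball xb (h := (z - r0%:C) *: n).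
rewrite enormZ nu1 // mulr1 => /(_ zr); congr (Omega _).
by apply/rowP => j; rewrite !mxE; ring.
Qed.

Lemma cvx_bipoint v z w z' w' t : Omega (bipoint v z w) -> Omega (bipoint v z' w') ->
  0 <= t <= 1 -> Omega (bipoint v (z + t%:C * (z' - z)) (w + t%:C * (w' - w))).
Proof.
move=> h1 h2 t01; have := cvxO h1 h2 t01; congr (Omega _).
by apply/rowP => j; rewrite !mxE; ring.
Qed.

(** The point is a convex combination, with weight [1 - e] on a point of the disc of direction [v]
    at height [s * e / 8] and weight [e] on a point [z2] of the inner ball in the complex normal
    line. Thus one disc near the boundary produces the whole bidisc. *)
Lemma bidisc_bipoint v (dl s e : R) u w : 0 < dl -> 0 < e <= 1 / 2 ->
  s = dl * e / 8 -> 2 * dl < e * r0 ->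
  (forall w, modc w < 1 -> Omega (bipoint v (s * e / 8)%:C w)) ->
  modc u < 1 - e -> modc w < 1 - e -> Omega (bipoint v (cayley s u) w).
Proof.
move=> dl0 /andP[e0 e1] sE small vO ue we.
have s0 : 0 < s by rewrite sE divr_gt0 // mulr_gt0.
have [h1 h2 h3] := cayley_bounds s0 e0 ue.
set z := cayley s u in h1 h2 h3 *.
pose q : R := s * e / 8.
have q0 : 0 < q by rewrite divr_gt0 // mulr_gt0.
have eC : e%:C != 0 :> R[i] by rewrite -modc_eq0 modc_real normr_eq0 gt_eqF.
have e1C : (1 - e)%:C != 0 :> R[i].
  by rewrite -modc_eq0 modc_real normr_eq0 gt_eqF //; lra.
pose z2 : R[i] := (z - ((1 - e) * q)%:C) / e%:C.
pose w1 : R[i] := w / (1 - e)%:C.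
have O1 : Omega (bipoint v q%:C w1).
  apply: vO; rewrite modcM modcV modc_real gtr0_norm; last lra.
  by rewrite ltr_pdivrMr ?mul1r; lra.
have Oz2 : Omega (bipoint v z2 0).
  apply: ball_bipoint; rewrite -(@ltr_pXn2r _ 2) ?nnegrE ?modc_ge0 ?(ltW r00) //.
  have zq : q <= complex.Re z / 2 by rewrite /q; lra.
  have z0 : 0 < complex.Re z by lra.
  have zm := Re_le_modc z.
  have Rz2 : complex.Re z2 * e = complex.Re z - (1 - e) * q.
    have : z2 * e%:C = z - ((1 - e) * q)%:C by rewrite /z2 divfK.
    by move=> /(congr1 (@complex.Re R)); rewrite mulrC cReZ cReB /= mulrC.
  have mz2 : modc z2 * e <= 2 * modc z.
    have -> : modc z2 * e = modc (z - ((1 - e) * q)%:C).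
      by rewrite /z2 modcM modcV modc_real gtr0_norm // divfK // gt_eqF.
    apply: le_trans (modcB _ _) _; rewrite modc_real ger0_norm; last first.
      by rewrite mulr_ge0 ?(ltW q0) //; lra.
    have : e * q <= e * q by []. have : 0 <= e * q by rewrite mulr_ge0 // ltW.
    lra.
  have -> : modc (z2 - r0%:C) ^+ 2 = modc z2 ^+ 2 - 2 * r0 * complex.Re z2 + r0 ^+ 2.
    by rewrite !modc_sqr cReB cImB /=; ring.
  suff : modc z2 ^+ 2 < 2 * r0 * complex.Re z2 by lra.
  have e20 : 0 < e ^+ 2 by rewrite exprn_gt0.
  rewrite -(ltr_pM2l e20).
  have H1 : e ^+ 2 * modc z2 ^+ 2 <= 4 * modc z ^+ 2.
    have -> : e ^+ 2 * modc z2 ^+ 2 = (modc z2 * e) ^+ 2 by ring.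
    have -> : 4 * modc z ^+ 2 = (2 * modc z) ^+ 2 by ring.
    by rewrite lerXn2r ?nnegrE ?mulr_ge0 ?modc_ge0 // ltW.
  have H2 : e * r0 * complex.Re z <= e ^+ 2 * (2 * r0 * complex.Re z2).
    have -> : e ^+ 2 * (2 * r0 * complex.Re z2) = e * r0 * (2 * (complex.Re z2 * e)) by ring.
    rewrite ler_wpM2l ?mulr_ge0 ?(ltW e0) ?(ltW r00) // Rz2.
    have : 0 <= e * q by rewrite mulr_ge0 // ltW.
    lra.
  (* By the choice of [s], [4 * s / e] is [dl / 2]; the assumption [2 * dl < e * r0] then says that
     the tangent disc of [cayley_bounds] fits into the inner ball after division by [e]. *)
  have H3 : 4 * (4 * s / e * complex.Re z) = 2 * dl * complex.Re z.
    by rewrite sE; field; rewrite gt_eqF.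
  have H4 : 2 * dl * complex.Re z < e * r0 * complex.Re z by rewrite ltr_pM2r.
  lra.
have t01 : 0 <= e <= 1 by lra.
have := cvx_bipoint O1 Oz2 t01; congr (Omega (bipoint v _ _)).
  have E : ((1 - e) * q)%:C = (1 - e%:C) * q%:C :> R[i].
    by rewrite (rmorphM _ (1 - e) q) /= rmorphB /= rmorph1.
  by rewrite /z2 E; field.
rewrite /w1 sub0r mulrN -[X in X - _]mul1r -mulrBl -[1 - e%:C]/(1%:C - e%:C).
by rewrite -rmorphB /= mulrC divfK.
Qed.


Lemma Re_gt0_sum_neq0 (L : R[i]) (s : R) : 0 < s -> 0 < complex.Re L ->
  s <= modc (L + s%:C).
Proof. by move=> s0 L0; apply: le_trans (Re_le_modc _); rewrite cReD /=; lra. Qed.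

(** The inverse Cayley transform takes the supporting half-space at [x] into the unit disc, where
    [1 - conj(u0) U] has positive real part; this function is small for [U] near [u0]. *)
Lemma pos_hol_cayley (s : R) u0 : 0 < s -> modc u0 = 1 -> pos_hol (fun z : V =>
  1 - u0^*%C * ((hip (z - x) n - s%:C) / (hip (z - x) n + s%:C))).
Proof.
move=> s0 u01; split=> z Oz; have L0 := nu_supp xb Oz.
  have Ld : differentiable (fun z : V => hip (z - x) n) z.
    exact: (@differentiable_hip _ _ _ id).
  have den0 : hip (z - x) n + s%:C != 0.
    by rewrite -modc_gt0; have := Re_gt0_sum_neq0 s0 L0; lra.
  have cs := differentiable_cst (s%:C : R[i]) z.
  exact: (differentiableB (differentiable_cst (1 : R[i]) z)
    (differentiableM (differentiable_cst (u0^*%C : R[i]) z)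
    (differentiableM (differentiableB Ld cs)
       (differentiableV (differentiableD Ld cs) den0)))).
set L := hip (z - x) n in L0 *.
have D0 := Re_gt0_sum_neq0 s0 L0.
have H : modc (u0^*%C * ((L - s%:C) / (L + s%:C))) < 1.
  rewrite modcM modc_conj u01 mul1r modcM modcV ltr_pdivrMr ?mul1r; last lra.
  rewrite -(@ltr_pXn2r _ 2) ?nnegrE ?modc_ge0 //.
  rewrite !modc_sqr !(cReD, cImD, cReN, cImN) /=.
  have : 0 < 4 * s * complex.Re L by rewrite !mulr_gt0.
  lra.
rewrite cReB /=; have := Re_le_modc (u0^*%C * ((L - s%:C) / (L + s%:C))); lra.
Qed.

(** Accounts for the normal component of [v], which shifts the first coordinate by a multiple of
    [w]. Both denominators have modulus at least [s]. *)
Lemma cayley_perturb (s : R) z c : 0 < s -> 0 < complex.Re z -> 0 < complex.Re (z + c) ->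
  modc ((z + c - s%:C) / (z + c + s%:C) - (z - s%:C) / (z + s%:C)) <= 2 * modc c / s.
Proof.
move=> s0 z0 zc0.
have d1 := Re_gt0_sum_neq0 s0 z0; have d2 := Re_gt0_sum_neq0 s0 zc0.
have n1 : z + s%:C != 0 by rewrite -modc_gt0; lra.
have n2 : z + c + s%:C != 0 by rewrite -modc_gt0; lra.
have -> : (z + c - s%:C) / (z + c + s%:C) - (z - s%:C) / (z + s%:C) =
    (2 * s)%:C * c / ((z + c + s%:C) * (z + s%:C)).
  rewrite rmorphM /= rmorph_nat; field; rewrite n1 /=.
  by rewrite n2.
rewrite !modcM modcV modcM modc_real gtr0_norm ?mulr_gt0 //.
set m1 := modc (z + s%:C) in d1 *; set m2 := modc (z + c + s%:C) in d2 *.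
have m0 : 0 < m2 * m1 by rewrite mulr_gt0 //; lra.
rewrite ler_pdivrMr //.
have -> : 2 * s * modc c = 2 * modc c / s * (s * s) by field; rewrite gt_eqF.
apply: ler_wpM2l; first by rewrite divr_ge0 ?mulr_ge0 ?modc_ge0 // ltW.
by apply: ler_pM => //; exact: ltW.
Qed.

Variables (c0 ds : R).
Hypothesis c00 : 0 < c0.
Hypothesis ds0 : 0 < ds.
Hypothesis orb : forall dl : R, 0 < dl <= ds -> exists phi psi : V -> V,
  [/\ forall z : V, Omega z -> Omega (phi z) /\ differentiable phi z,
      forall z : V, Omega z -> Omega (psi z) /\ differentiable psi z,
      forall z : V, Omega z -> phi (psi z) = z &
      in_ball (psi (bipoint 0 dl%:C 0)) c0].

Lemma bipoint_w0 v v' z : bipoint v z 0 = bipoint v' z 0.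
Proof. by rewrite /bipoint !scale0r. Qed.

Lemma cReMr z (t : R) : complex.Re (z * t%:C) = complex.Re z * t.
Proof. by rewrite mulrC cReZ mulrC. Qed.

Lemma conj_mul_self z : z * z^*%C = (modc z ^+ 2)%:C.
Proof.
rewrite modc_sqr; case: z => a b.
by apply/eqP; rewrite eq_complex /=; apply/andP; split; apply/eqP; ring.
Qed.

Lemma bipoint_ball_r v (t : R) : 0 < t < 2 * r0 -> Omega (bipoint v t%:C 0).
Proof.
move=> /andP[t0 t1]; apply: ball_bipoint.
by rewrite -rmorphB /= modc_real ltr_norml; lra.
Qed.

(* If the disc of direction [v] does not grow by a factor [1 + e / 8] between the
   heights [s * e / 8] and [dl = 8 * s / e], a supporting functional at height
   [dl] hardly depends on [z], so that it decays linearly as [w] goes to [w0]. *)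
Lemma transverse_functional v (dl s e : R) w1 : 0 < dl -> 0 < e <= 1 / 8 ->
  s = dl * e / 8 -> 4 * dl <= e / 8 * r0 ->
  (forall w, modc w < 1 -> Omega (bipoint v (s * e / 8)%:C w)) ->
  modc w1 < 1 + e / 8 -> ~ Omega (bipoint v dl%:C w1) ->
  exists h w0, [/\ pos_hol h, modc w0 = 1 &
    forall z (t : R), modc z <= dl -> 2 * e <= t ->
      complex.Re (h (bipoint v z ((1 - t)%:C * w0))) <=
      4 * t * complex.Re (h (bipoint v s%:C 0))].
Proof.
move=> dl0 /andP[e0 e8] sE small vO w1k nO.
have s0 : 0 < s by rewrite sE divr_gt0 // mulr_gt0.
have Op : Omega (bipoint v dl%:C 0).
  apply: bipoint_ball_r; rewrite dl0 /=.
  have : e / 8 * r0 <= 1 * r0 by rewrite ler_wpM2r ?(ltW r00) //; lra.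
  lra.
have [y [yb yq _]] := separation opO nu_supp Op nO.
pose al := hip n (nu y); pose be := hip v (nu y); pose ga := hip (x - y) (nu y).
have LE z w : hip (bipoint v z w - y) (nu y) = al * z + be * w + ga by exact: hip_bipoint.
pose b := modc be; pose A0 := modc al; pose a := complex.Re al; pose g := complex.Re ga.
(* The disc of direction [v] at the lower height lies on the positive side of the hyperplane. *)
have h1 : b <= a * (s * e / 8) + g.
  apply: Re_linear_bound => w w1'.
  have := nu_supp yb (vO w w1'); rewrite LE !cReD cReMr -/a -/g.
  by rewrite -addrA [complex.Re (be * w) + g]addrC addrA.
(* The functional is not positive at height [dl] for some [w1] of modulus below [1 + e / 8]. *)
have h2 : a * dl + g <= b * (1 + e / 8).
  move: yq; rewrite LE !cReD cReMr -/a -/g.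
  have := normr_Re_le (be * w1); rewrite modcM ler_norml -/b => /andP[t1 _] t2.
  have t3 : b * modc w1 <= b * (1 + e / 8) by rewrite ler_wpM2l ?modc_ge0 // ltW.
  lra.
(* Positivity on the section of the inner ball by the complex normal line. *)
have h3 : r0 * A0 <= g + r0 * a.
  have -> : r0 * A0 = modc (al * r0%:C) by rewrite modcM modc_real gtr0_norm // mulrC.
  apply: Re_linear_bound => w w1'.
  have zr : modc (r0%:C + r0%:C * w - r0%:C) < r0.
    by rewrite [r0%:C + _]addrC addrK modcM modc_real gtr0_norm // gtr_pMr.
  have := nu_supp yb (ball_bipoint v zr); rewrite LE mulr0 addr0 mulrDr mulrA !cReD.
  rewrite cReMr -/a -/g => t1; lra.
have b0 : 0 < b.
  have := nu_supp yb Op; rewrite LE mulr0 addr0 !cReD cReMr -/a -/g => t1.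
  have t2 : 0 < b * (1 + e / 8) by exact: lt_le_trans t1 h2.
  have t3 : 0 < 1 + e / 8 by lra.
  by rewrite -(pmulr_lgt0 _ t3).
have aA : `|a| <= A0 by exact: normr_Re_le.
have qE : s * e / 8 = dl * (e ^+ 2 / 64) by rewrite sE; field.
have e2 : 0 < e ^+ 2 / 64 <= 1 / 2.
  have E1 : e ^+ 2 <= 1 by rewrite exprn_ile1 ?(ltW e0) //; lra.
  have E2 : 0 < e ^+ 2 by rewrite exprn_gt0.
  lra.
have k01 : 0 < e / 8 <= 1 by lra.
have h1' : b <= a * (dl * (e ^+ 2 / 64)) + g by rewrite -qE.
have A0dl := functional_bounds b0 k01 r00 dl0 e2 small aA h1' h2 h3.
(* The direction of steepest descent of the functional: [be * w0 = - b]. *)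
pose w0 : R[i] := - (be^*%C / b%:C).
have bC : b%:C != 0 :> R[i] by rewrite -modc_eq0 modc_real normr_eq0 gt_eqF.
have w01 : modc w0 = 1.
  by rewrite modcN modcM modcV modc_conj modc_real gtr0_norm // divff // gt_eqF.
exists (fun z : V => hip (z - y) (nu y)), w0; split=> //.
  exact: pos_hol_supp.
move=> z t zdl et; rewrite !LE mulr0 addr0.
have bw : be * ((1 - t)%:C * w0) = - ((1 - t) * b)%:C.
  have -> : be * ((1 - t)%:C * w0) = - ((1 - t)%:C * (be * be^*%C) / b%:C).
    by rewrite /w0; ring.
  rewrite conj_mul_self -/b -rmorphM -fmorphV -rmorphM /=; congr (- _%:C).
  by field; rewrite gt_eqF.
rewrite bw !cReD cReN cReMr /= -/a -/g.
have az : complex.Re (al * z) <= 3 * (e / 8) * b.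
  apply: le_trans (Re_le_modc _) _; rewrite modcM.
  by apply: le_trans A0dl; rewrite ler_wpM2l ?modc_ge0.
have [|k1 k2 k3 k4] := height_arith dl0 _ sE et; first by rewrite e0.
exact: (@functional_ratio _ a A0 b g (e / 8) dl s (s * e / 8)).
Qed.

(** The function of [pos_hol_cayley] is 1 at the centre and [t] plus a perturbation at the point in
    question. The perturbation comes from the component [c] of [v] along [n], which is at most
    [s * e / 8] because the disc of direction [v] at that height lies in the supporting half-space
    at [x]. *)
Lemma normal_functional v (dl s e : R) u0 : 0 < dl -> 0 < e <= 1 / 8 ->
  s = dl * e / 8 ->
  (forall w, modc w < 1 -> Omega (bipoint v (s * e / 8)%:C w)) -> modc u0 = 1 ->
  exists2 h, pos_hol h & forall w (t : R), modc w <= 1 -> 2 * e <= t <= 1 ->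
    Omega (bipoint v (cayley s ((1 - t)%:C * u0)) w) ->
    complex.Re (h (bipoint v (cayley s ((1 - t)%:C * u0)) w)) <=
      4 * t * complex.Re (h (bipoint v s%:C 0)).
Proof.
move=> dl0 /andP[e0 e8] sE vO u01.
have s0 : 0 < s by rewrite sE divr_gt0 // mulr_gt0.
pose c := hip v n.
have nn : hip n n = 1 by rewrite hip_self nu1 // expr1n.
have LxE z w : hip (bipoint v z w - x) n = z + c * w.
  by rewrite hip_bipoint nn mul1r subrr hip0l addr0.
have cle : modc c <= s * e / 8.
  apply: Re_linear_bound => w w1'.
  by have := nu_supp xb (vO w w1'); rewrite LxE cReD /=.
exists (fun z : V =>
  1 - u0^*%C * ((hip (z - x) n - s%:C) / (hip (z - x) n + s%:C))).
  exact: pos_hol_cayley.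
move=> w t w1 /andP[et t1] OP; rewrite !LxE mulr0 addr0 subrr mul0r mulr0 subr0 /= mulr1.
have mu : modc ((1 - t)%:C * u0) < 1 - e.
  by rewrite modcM u01 mulr1 modc_real ger0_norm; lra.
have u1 : modc ((1 - t)%:C * u0) < 1 by lra.
have uE := cayley_inv s0 u1.
have [zr _ _] := cayley_bounds s0 e0 mu.
set z := cayley s _ in uE zr OP *.
have z0 : 0 < complex.Re z.
  by apply: lt_le_trans zr; rewrite divr_gt0 // mulr_gt0.
have zc0 : 0 < complex.Re (z + c * w) by rewrite -LxE; exact: nu_supp.
have := cayley_perturb s0 z0 zc0; rewrite -uE.
set u := (1 - t)%:C * u0; set U := (z + c * w - s%:C) / _ => pert.
have pe : modc (U - u) <= e / 4.
  apply: le_trans pert _; rewrite ler_pdivrMr // modcM.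
  have cw : modc c * modc w <= s * e / 8 * 1.
    by apply: ler_pM; rewrite ?modc_ge0.
  lra.
have -> : u0^*%C * U = u0^*%C * u + u0^*%C * (U - u) by ring.
have uu : u0^*%C * u = (1 - t)%:C.
  by rewrite /u mulrCA [u0^*%C * _]mulrC conj_mul_self u01 expr1n mulr1.
rewrite uu cReB cReD /=.
have := normr_Re_le (u0^*%C * (U - u)); rewrite modcM modc_conj u01 mul1r ler_norml.
move=> /andP[t2 _]; lra.
Qed.

(* One step of the decay: discs parallel to [v] centred on the inner normal grow
   by a definite factor when their distance to the boundary is multiplied
   by [A]. Otherwise the two functionals above turn a bidisc around the normal,
   moved by the automorphism [psi], into one which [bidisc_core] excludes. *)
Lemma key_step (j : nat) (l e dl : R) v w1 (N := (6 * j + 12)%N)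
    (dd := 2 * Dm * l ^+ j) : 0 < l < 1 -> (1 - l) * Dm <= c0 / 2 ->
  (N%:R * Dm) ^+ 2 * (52 * dd / r0) < (c0 / 2) ^+ 2 -> dd <= c0 / 2 ->
  e = (1 / 2) ^+ N.+1 -> 0 < dl -> dl <= ds -> 4 * dl <= e / 8 * r0 ->
  (forall w, modc w < 1 -> Omega (bipoint v (dl * e / 8 * e / 8)%:C w)) ->
  modc w1 < 1 + e / 8 -> Omega (bipoint v dl%:C w1).
Proof.
move=> l01 lD small1 small2 eE dl0 dls small3 vO w1k; apply: contrapT => nO.
have e0 : 0 < e by rewrite eE exprn_gt0 //; lra.
have hmono i m : (i <= m)%N -> (1 / 2) ^+ m <= (1 / 2) ^+ i :> R.
  by move=> im; rewrite ler_wiXn2l //; lra.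
have hN : 2 * e = (1 / 2) ^+ N by rewrite eE exprS; field.
have e8 : 0 < e <= 1 / 8.
  have N3 : (3 <= N.+1)%N by rewrite (@leq_trans 12) // leqW // leq_addl.
  rewrite e0 /=; have := hmono 3%N N.+1 N3; rewrite -eE.
  by have -> : (1 / 2) ^+ 3 = 1 / 8 :> R by field.
pose s := dl * e / 8.
have s0 : 0 < s by rewrite divr_gt0 // mulr_gt0.
have sdl : s <= dl.
  rewrite /s -mulrA ler_piMr ?(ltW dl0) //; lra.
have [h [w0 [hp w01 hT]]] := transverse_functional dl0 e8 (erefl s) small3 vO w1k nO.
have e2 : 0 < e <= 1 / 2 by lra.
have er0 : 2 * dl < e * r0.
  have : 0 < e * r0 by rewrite mulr_gt0.
  by move=> t1; lra.
have domO u w : modc u < 1 - e -> modc w < 1 - e -> Omega (bipoint v (cayley s u) w).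
  exact: (bidisc_bipoint dl0 e2 (erefl s) er0 vO).
have [phi [psi [phiO psiO phipsi psiB]]] : exists phi psi : V -> V,
  [/\ forall z : V, Omega z -> Omega (phi z) /\ differentiable phi z,
      forall z : V, Omega z -> Omega (psi z) /\ differentiable psi z,
      forall z : V, Omega z -> phi (psi z) = z &
      in_ball (psi (bipoint v s%:C 0)) c0].
  have [|phi [psi H]] := orb (dl := s); first by rewrite s0 (le_trans sdl).
  by exists phi, psi; rewrite (bipoint_w0 v 0).
have cay0 : cayley s 0 = s%:C by rewrite /cayley addr0 subr0 divr1 mulr1.
pose F u w := psi (bipoint v (cayley s u) w).
have FO u w : modc u < 1 - e -> modc w < 1 - e ->
    [/\ Omega (F u w), differentiable (fun u => F u w) u &
        differentiable (fun w => F u w) w].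
  move=> ue we; have OP := domO u w ue we; have [Om D1] := psiO _ OP.
  have u1 : modc u < 1 by apply: lt_trans ue _; rewrite ltrBlDr ltrDl.
  split; first exact: Om.
    have cd : differentiable (fun u => cayley s u *: n) u.
      by apply: differentiableZl; exact: differentiable_cayley.
    have bd := differentiableD (differentiableD (differentiable_cst x u) cd)
      (differentiable_cst (w *: v) u).
    exact: (@differentiable_comp _ _ _ _ (fun u => bipoint v (cayley s u) w) psi u bd D1).
  exact: (@differentiable_comp _ _ _ _ (fun w => bipoint v (cayley s u) w) psi w
    (@differentiable_line _ _ _ _ w) D1).
have Fb : in_ball (F 0 0) c0 by rewrite /F cay0.
rewrite eE in FO.
apply: (bidisc_core opO cvxO Dm0 diamO r00 nu1 nu_supp nu_ball c00 l01 lD small1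
  small2 FO Fb w01) => u0 i u01; rewrite -/N => iN.
rewrite -eE in FO.
(* Composition with [phi], which undoes [psi] on [Omega], carries the functionals over to the images
   of the chain points. *)
have pull (f : V -> R[i]) : pos_hol f -> exists2 f', pos_hol f' &
    forall z : V, Omega z -> f' (psi z) = f z.
  move=> [fd fp]; exists (fun z : V => f (phi z)); last by move=> z /phipsi ->.
  split=> z /phiO[Om D1]; last exact: fp.
  exact: (@differentiable_comp _ _ _ _ phi f z D1 (fd _ Om)).
have hb m : (m <= N)%N -> 2 * e <= ((1 / 2) ^+ m : R) <= 1.
  by move=> mN; rewrite hN hmono //= exprn_ile1 //; lra.
have /andP[hi1 hi2] := hb i iN.
have /andP[hNi1 hNi2] := hb (N - i)%N (leq_subr _ _).
set hi : R := (1 / 2) ^+ i in hi1 hi2 *.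
set hNi : R := (1 / 2) ^+ (N - i) in hNi1 hNi2 *.
have e2e : e < 2 * e by rewrite ltr_pMl // ltr1n.
have mu : modc ((1 - hNi)%:C * u0) < 1 - e.
  rewrite modcM u01 mulr1 modc_real ger0_norm ?subr_ge0 // ltrD2l ltrN2.
  exact: lt_le_trans e2e hNi1.
have mw : modc ((1 - hi)%:C * w0) < 1 - e.
  rewrite modcM w01 mulr1 modc_real ger0_norm ?subr_ge0 // ltrD2l ltrN2.
  exact: lt_le_trans e2e hi1.
have m0 : modc (0 : R[i]) < 1 - e.
  by rewrite modc0 subr_gt0; apply: lt_le_trans e2e _; exact: le_trans hi1 hi2.
have OP := domO _ _ mu mw; have OP0 := domO _ _ m0 m0.
have concl (f : V -> R[i]) (t : R) : pos_hol f -> t <= (1 / 2) ^+ (3 * j + 6) ->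
    complex.Re (f (bipoint v (cayley s ((1 - hNi)%:C * u0)) ((1 - hi)%:C * w0))) <=
      4 * t * complex.Re (f (bipoint v s%:C 0)) ->
    exists2 f', pos_hol f' & complex.Re (f' (F ((1 - hNi)%:C * u0) ((1 - hi)%:C * w0)))
      <= 4 * (1 / 2) ^+ (3 * j + 6) * complex.Re (f' (F 0 0)).
  move=> fp tle fle; have [f' fp' fE] := pull f fp.
  have E1 := fE _ OP; have E2 := fE _ OP0.
  have f0 := fp.2 _ OP0; rewrite cay0 in E2 f0.
  exists f'; first exact: fp'.
  rewrite /F cay0 E1 E2; apply: le_trans fle _.
  by apply: ler_wpM2r; [exact: ltW|exact: ler_wpM2l].
(* One of the exponents [i] and [N - i] is at least [3 * j + 6], half of [N]. The transverse
   functional serves when [w] is near its circle, the normal one otherwise. *)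
have [i3|i3] := leqP (3 * j + 6) i.
  apply: (concl h hi hp); first exact: hmono.
  apply: hT => //.
  have [_ zm _] := cayley_bounds s0 e0 mu.
  apply: le_trans zm _; have -> : 2 * s / e = dl / 4 by rewrite /s; field; rewrite gt_eqF.
  by rewrite ler_pdivrMr // ler_peMr ?(ltW dl0) // ler1n.
have [f fp fN] := normal_functional dl0 e8 (erefl s) vO u01.
apply: (concl f hNi fp); first by apply: hmono; exact: chain_half_length.
apply: fN => //; last by rewrite hNi1.
lra.
Qed.

(** The numbers [l], [j] and [e] are fixed from [Dm], [r0] and [c0] alone, before [dl] and [v]. The
    growth factor is therefore the same for all directions and heights, which allows it to be
    iterated. *)
Lemma key_estimate : exists A k z1 : R, [/\ 1 < A, 0 < k, 0 < z1 &
  forall (dl : R) v, 0 < dl <= z1 ->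
  (forall w, modc w < 1 -> Omega (bipoint v (dl / A)%:C w)) ->
  forall w, modc w < 1 + k -> Omega (bipoint v dl%:C w)].
Proof.
(* [1 - l = c0 / (2 * Dm + c0)]: a step of this relative length along a segment in [Omega] is at
   most half of [c0]. *)
pose l := 2 * Dm / (2 * Dm + c0).
have den : 0 < 2 * Dm + c0 by rewrite addr_gt0 ?mulr_gt0.
have l01 : 0 < l < 1.
  by rewrite divr_gt0 ?mulr_gt0 //= ltr_pdivrMr // mul1r ltrDl.
have lD : (1 - l) * Dm <= c0 / 2.
  have -> : (1 - l) * Dm = c0 / 2 * (2 * Dm / (2 * Dm + c0)).
    by rewrite /l; field; rewrite gt_eqF.
  by rewrite ler_piMr ?divr_ge0 ?(ltW c00) //; case/andP: l01 => _ /ltW.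
have [l0 l1] := andP l01.
have Dm2 : 0 < Dm ^+ 2 by rewrite exprn_gt0.
have c02 : 0 < (c0 / 2) ^+ 2 by rewrite exprn_gt0 // divr_gt0.
pose C1 := Dm ^+ 2 * (104 * Dm / r0).
have C10 : 0 <= C1.
  by rewrite mulr_ge0 ?(ltW Dm2) // divr_ge0 ?(ltW r00) // mulr_ge0 // ltW.
(* One constant for both conditions on [j]: on the turning of the normals and on the distance
   [dd]. *)
pose C := Num.max C1 (2 * Dm * (c0 / 2)).
have C0 : 0 <= C by rewrite le_max C10.
have [CC1 CC2] : C1 <= C /\ 2 * Dm * (c0 / 2) <= C by rewrite !le_max !lexx orbT.
have [j jP] := linear_geometric_small l01 C0 c02.
pose N := (6 * j + 12)%N.
pose dd := 2 * Dm * l ^+ j.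
have lj : 0 < l ^+ j by rewrite exprn_gt0.
have small1 : (N%:R * Dm) ^+ 2 * (52 * dd / r0) < (c0 / 2) ^+ 2.
  apply: le_lt_trans jP; rewrite -/N.
  have -> : (N%:R * Dm) ^+ 2 * (52 * dd / r0) = N%:R ^+ 2 * C1 * l ^+ j.
    by rewrite /C1 /dd; field; rewrite gt_eqF.
  by rewrite ler_wpM2r ?(ltW lj) // ler_wpM2l // sqr_ge0.
have small2 : dd <= c0 / 2.
  have c20 : 0 < c0 / 2 by rewrite divr_gt0.
  rewrite -(ler_pM2l c20) -expr2; apply: le_trans (ltW jP).
  have -> : c0 / 2 * dd = 1 * (2 * Dm * (c0 / 2)) * l ^+ j by rewrite /dd; ring.
  rewrite ler_wpM2r ?(ltW lj) //; apply: ler_pM => //.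
    by apply: mulr_ge0; [apply: mulr_ge0 => //; exact: ltW|exact: ltW].
  by rewrite -natrX ler1n expn_gt0 addn_gt0 orbT.
pose e : R := (1 / 2) ^+ N.+1.
have e0 : 0 < e by rewrite exprn_gt0 // divr_gt0.
have e1 : e < 1.
  have h1 : (1 / 2 : R) < 1 by lra.
  by rewrite exprn_ilt1 // h1 divr_gt0.
(* With this [A], [dl / A] is the lower height [s * e / 8] for [s = dl * e / 8]. *)
exists (64 / e ^+ 2), (e / 8), (Num.min (e / 8 * r0 / 4) ds); split.
- rewrite ltr_pdivlMr ?exprn_gt0 // mul1r.
  have E1 : e ^+ 2 <= 1 by rewrite exprn_ile1 // ltW.
  by lra.
- by rewrite divr_gt0.
- by rewrite lt_min ds0 andbT divr_gt0 // mulr_gt0 // divr_gt0.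
move=> dl v /andP[dl0]; rewrite le_min => /andP[dlk dls] vO w1 w1k.
apply: (key_step l01 lD small1 small2 (erefl e) dl0 dls _ _ w1k).
  by lra.
move=> w /vO; have -> // : dl / (64 / e ^+ 2) = dl * e / 8 * e / 8.
by field; rewrite gt_eqF.
Qed.

End KeyEstimate.

(** * From the growth of affine discs to the decay of all holomorphic discs *)

Section Decay.
Variables (R : realType) (d : nat).
Local Notation V := 'rV[R[i]]_d.
Local Notation enorm := (@euclidean_norm R d).
Variable Omega : set V.
Implicit Types (v x y p q : V) (u w z c : R[i]) (t : R).

Hypothesis opO : forall x, Omega x ->
  exists2 e : R, 0 < e & forall h, enorm h < e -> Omega (x + h).
Hypothesis cvxO : forall x y t, Omega x -> Omega y -> 0 <= t <= 1 ->
  Omega (x + t%:C *: (y - x)).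
Variable Dm : R.
Hypothesis Dm0 : 0 < Dm.
Hypothesis diamO : forall x y, Omega x -> Omega y -> enorm (x - y) <= Dm.
Variables (nu : V -> V) (r0 : R).
Hypothesis r00 : 0 < r0.
Local Notation bdry := (bdry Omega).
Local Notation in_ball := (in_ball Omega).
Local Notation pos_hol := (pos_hol Omega).
Hypothesis nu1 : forall y, bdry y -> enorm (nu y) = 1.
Hypothesis nu_supp : forall y (z : V), bdry y -> Omega z ->
  0 < complex.Re (hip (z - y) (nu y)).
Hypothesis nu_ball : forall y, bdry y -> in_ball (y + r0%:C *: nu y) r0.
Variable x : V.
Hypothesis xb : bdry x.
Local Notation n := (nu x).
Local Notation bipoint := (bipoint nu x).
Variables (c0 ds : R).
Hypothesis c00 : 0 < c0.
Hypothesis ds0 : 0 < ds.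
Hypothesis orb : forall dl : R, 0 < dl <= ds -> exists phi psi : V -> V,
  [/\ forall z : V, Omega z -> Omega (phi z) /\ differentiable phi z,
      forall z : V, Omega z -> Omega (psi z) /\ differentiable psi z,
      forall z : V, Omega z -> phi (psi z) = z &
      in_ball (psi (bipoint 0 dl%:C 0)) c0].

(** Multiplying the height by [A] enlarges the disc by [1 + k], and up to height [z1] its size is
    bounded by the diameter. The number of multiplications is logarithmic in [dl], so the size is
    bounded by a power of [dl], with exponent [1 / m] given by [A <= (1 + k) ^+ m]. *)
Lemma affine_disc_decay : exists (m : nat) (C z1 : R), [/\ 0 <= C, 0 < z1 &
  forall (dl : R) v, 0 < dl <= z1 ->
  (forall w, modc w < 1 -> Omega (bipoint v dl%:C w)) -> enorm v ^+ m <= C * dl].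
Proof.
have [A [k [z1 [A1 k0 z10 key]]]] := key_estimate opO cvxO Dm0 diamO r00 nu1
  nu_supp nu_ball xb c00 ds0 orb.
have A0 : 0 < A by lra.
have iter i : forall (dl : R) v, 0 < dl -> dl * A ^+ i <= z1 ->
    (forall w, modc w < 1 -> Omega (bipoint v dl%:C w)) ->
    enorm v * (1 + k) ^+ i <= Dm.
  elim: i => [|i IH] dl v dl0 dlz vO.
    rewrite expr0 mulr1.
    (* The points [w = 1 / 2] and [w = - 1 / 2] of the disc differ by [v]. *)
    have m2 : modc (1 / 2 : R[i]) < 1.
      have -> : 1 / 2 = (1 / 2 : R)%:C :> R[i].
        by rewrite rmorphM /= fmorphV /= rmorph_nat rmorph1.
      by rewrite modc_real ger0_norm; lra.
    have h1 := vO _ m2; have h2 := vO (- (1 / 2)); rewrite modcN in h2.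
    have := diamO h1 (h2 m2).
    have -> // : bipoint v dl%:C (1 / 2) - bipoint v dl%:C (- (1 / 2)) = v.
    by apply/rowP => j; rewrite !mxE; field.
  have dlA : 0 < dl * A by rewrite mulr_gt0.
  have Ai : 1 <= A ^+ i by rewrite exprn_ege1 // ltW.
  have dlAz : dl * A <= z1.
    apply: le_trans dlz; rewrite exprS mulrA ler_peMr //; exact: ltW.
  have vO' : forall w, modc w < 1 + k -> Omega (bipoint v (dl * A)%:C w).
    have AK : dl * A / A = dl by rewrite mulfK // gt_eqF.
    by have := key (dl * A) v; rewrite AK dlA dlAz => /(_ isT vO).
  have := IH (dl * A) ((1 + k)%:C *: v) dlA.
  rewrite -mulrA -exprS => /(_ dlz); rewrite enormZ modc_real ger0_norm; last lra.
  rewrite exprS mulrA [enorm v * _]mulrC; apply=> w w1.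
  have := vO' (w * (1 + k)%:C); rewrite modcM modc_real ger0_norm; last lra.
  have kk : 0 < 1 + k by lra.
  by rewrite gtr_pMl // /bipoint scalerA => /(_ w1).
have [|m mP] := @geometric_small _ A (1 + k)^-1 1 _ ltr01.
  by rewrite invr_ge0 invf_lt1; lra.
have {}mP : A <= (1 + k) ^+ m.
  have k1m : 0 < (1 + k) ^+ m by rewrite exprn_gt0 //; lra.
  by have := mP m (leqnn m); rewrite exprVn ltr_pdivrMr // mul1r => /ltW.
have C0 : 0 <= Dm ^+ m * A / z1 by rewrite divr_ge0 ?mulr_ge0 ?exprn_ge0 // ltW.
exists m, (Dm ^+ m * A / z1), z1; split; [exact: C0|exact: z10|].
move=> dl v /andP[dl0 dlz] vO.
have [i0 i0P] : exists i, z1 < dl * A ^+ i.+1.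
  have [|i iP] := @geometric_small _ z1 A^-1 dl _ dl0.
    by rewrite invr_ge0 invf_lt1; lra.
  exists i; have := iP i.+1 (leqnSn i).
  by rewrite exprVn ltr_pdivrMr ?exprn_gt0.
(* The largest number of multiplications that keeps the height at most [z1]. *)
have [i iP imin] := ex_minnP (ex_intro (fun i => z1 < dl * A ^+ i.+1) i0 i0P).
have dAi : dl * A ^+ i <= z1.
  case: i iP imin => [|i] iP imin; first by rewrite expr0 mulr1.
  by rewrite leNgt; apply/negP => /imin; rewrite ltnn.
have H := iter i dl v dl0 dAi vO.
have Hm : enorm v ^+ m * A ^+ i <= Dm ^+ m.
  have e0 := enorm_ge0 v.
  apply: (@le_trans _ _ ((enorm v * (1 + k) ^+ i) ^+ m)).
    rewrite exprMn ler_wpM2l ?exprn_ge0 // exprAC lerXn2r ?nnegrE ?exprn_ge0 //; lra.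
  by apply: lerXn2r => //; rewrite nnegrE ?(ltW Dm0) // mulr_ge0 // exprn_ge0 //; lra.
have Ai0 : 0 < A ^+ i by rewrite exprn_gt0.
rewrite -(ler_pM2r Ai0); apply: le_trans Hm _.
have -> : Dm ^+ m * A / z1 * dl * A ^+ i = Dm ^+ m * (dl * A ^+ i.+1 / z1).
  by rewrite exprS; field; rewrite gt_eqF.
rewrite ler_peMr ?exprn_ge0 ?(ltW Dm0) // ler_pdivlMr // mul1r; exact: ltW.
Qed.

(** The affine disc around [f 0] of direction [(f w - f 0) / 2] lies in [Omega]: a supporting
    functional that is not positive at one of its points would, composed with [f], violate the
    half-plane form of Schwarz's lemma. The halving costs the factor [2 ^+ m]. *)
Lemma disc_decay : exists (m : nat) (C z1 : R), [/\ 0 <= C, 0 < z1 &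
  forall (dl : R) (f : R[i] -> V), 0 < dl <= z1 ->
  (forall w, modc w < 1 -> Omega (f w) /\ differentiable f w) ->
  f 0 = x + dl%:C *: n ->
  forall w, modc w <= 1 / 2 -> enorm (f w - f 0) ^+ m <= C * dl].
Proof.
have [m [C [z1 [C0 z10 H]]]] := affine_disc_decay.
exists m, (2 ^+ m * C), z1; split=> //; first by rewrite mulr_ge0 ?exprn_ge0.
move=> dl f dlz fO f0 w w2.
have Of0 : Omega (f 0) by have [] := fO 0 (eq_ind_r (fun t => t < 1) ltr01 (modc0 R)).
pose u := f w - f 0.
have half2 : modc (2^-1 : R[i]) = 1 / 2.
  rewrite modcV -[2](rmorph_nat (real_complex R)) modc_real normr_nat; lra.
have : enorm (2^-1 *: u) ^+ m <= C * dl.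
  apply: (H dl _ dlz) => w' w'1; apply: contrapT => nO.
  have bE : bipoint (2^-1 *: u) dl%:C w' = f 0 + (w' * 2^-1) *: u.
    by rewrite /bipoint f0 scalerA.
  rewrite bE in nO.
  have [y [yb yq _]] := separation opO nu_supp Of0 nO.
  pose h z := hip (f z - y) (nu y).
  have hd z : modc z < 1 -> differentiable h z.
    by move=> /fO[_ fd]; exact: differentiable_hip.
  have hp z : modc z < 1 -> 0 < complex.Re (h z).
    by move=> /fO[Ofz _]; exact: nu_supp.
  have w1 : modc w < 1 by lra.
  have [h1 _ _] := half_plane_schwarz hd hp w1.
  have hwE : h w - h 0 = hip u (nu y).
    by rewrite /h -hipBl; congr hip; apply/rowP => j; rewrite !mxE; ring.
  rewrite hwE in h1.
  have h00 : 0 < complex.Re (h 0) by apply: hp; rewrite modc0.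
  have X0 := modc_ge0 (hip u (nu y)).
  have h2 : modc (hip u (nu y)) <= 2 * complex.Re (h 0).
    have e1 : 1 / 2 * modc (hip u (nu y)) <= (1 - modc w) * modc (hip u (nu y)).
      by apply: ler_wpM2r => //; lra.
    have e2 : 2 * modc w * complex.Re (h 0) <= 1 * complex.Re (h 0).
      by apply: ler_wpM2r; lra.
    lra.
  move: yq; have -> : f 0 + (w' * 2^-1) *: u - y = (f 0 - y) + (w' * 2^-1) *: u.
    by rewrite addrAC.
  rewrite hipDl hipZl cReD -/(h 0).
  have := normr_Re_le (w' * 2^-1 * hip u (nu y)).
  rewrite !modcM half2 ler_norml => /andP[e1 _] e2.
  have e3 : modc w' * (1 / 2) * modc (hip u (nu y)) <=
      modc w' * (1 / 2) * (2 * complex.Re (h 0)).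
    by apply: ler_wpM2l => //; rewrite mulr_ge0 ?modc_ge0 //; lra.
  have e4 : modc w' * complex.Re (h 0) < 1 * complex.Re (h 0) by rewrite ltr_pM2r.
  lra.
rewrite enormZ half2 exprMn => h1.
have -> : enorm u ^+ m = 2 ^+ m * ((1 / 2) ^+ m * enorm u ^+ m).
  by rewrite mulrA -exprMn (_ : 2 * (1 / 2) = 1 :> R) ?expr1n ?mul1r //; field.
by rewrite -mulrA ler_wpM2l // exprn_ge0.
Qed.

End Decay.

(** * Inner balls of smooth convex domains *)

Section InnerBalls.
Variables (R : realType) (d : nat).
Local Notation V := 'rV[R[i]]_d.
Local Notation enorm := (@euclidean_norm R d).
Variable Omega : set V.
Implicit Types (v w h x y z : V) (s t : R).
Local Notation bdry := (bdry Omega).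
Local Notation in_ball := (in_ball Omega).

Hypothesis openO : open Omega.
Hypothesis cvxO : convex_set Omega.

Lemma boundary_bdry y : boundary Omega y <-> bdry y.
Proof.
have intO := interior_id Omega; rewrite /boundary.
have -> : interior Omega = Omega by apply/intO.
split=> [[cy Oy]|[Oy ny]].
  by split=> // e e0; exact: closure_enormP.
split=> //= B /near_enormP[e e0 eB]; have [h he Oh] := ny e e0.
by exists (y + h); split=> //; exact: eB.
Qed.

(** Convexity does not apply at [y], which is not in [Omega]. It is applied at a nearby [y + h], and
    the error is compensated by moving the interior point [z]. *)
Lemma segment_inside y z t : bdry y -> Omega z -> 0 < t <= 1 ->
  Omega (y + t%:C *: (z - y)).
Proof.
move=> [_ yb] Oz /andP[t0 t1].
have [e e0 eP] := open_enormP openO Oz.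
have [h hte Oh] := yb (t * e) (mulr_gt0 t0 e0).
(* Solves [(1 - t) (y + h) + t (z - s h) = (1 - t) y + t z]. *)
pose s := (1 - t) / t.
have Oz' : Omega (z - s%:C *: h).
  apply: eP; rewrite enormN enormZr ger0_norm; last by rewrite divr_ge0 ?(ltW t0) // subr_ge0.
  rewrite /s mulrAC ltr_pdivrMr //; apply: (@le_lt_trans _ _ (enorm h)).
    by rewrite ler_piMl ?enorm_ge0 // gerBl ltW.
  by rewrite mulrC.
have := convex_enorm cvxO Oh Oz' (t := t); rewrite (ltW t0) t1 => /(_ isT).
have -> // : y + h + t%:C *: (z - s%:C *: h - (y + h)) = y + t%:C *: (z - y).
apply/rowP => j; rewrite !mxE.
have ts : t%:C * s%:C = 1 - t%:C :> R[i].
  have t0' : t%:C != 0 :> R[i] by rewrite fmorph_eq0 gt_eqF.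
  by rewrite /s rmorphM /= fmorphV /= rmorphB rmorph1 /=; field.
have -> : t%:C * (z 0 j - s%:C * h 0 j - (y 0 j + h 0 j)) =
  t%:C * (z 0 j - y 0 j) - t%:C * s%:C * h 0 j - t%:C * h 0 j by ring.
by rewrite ts; ring.
Qed.

Definition normal_at y v (r : R) := [/\ enorm v = 1,
  forall z, Omega z -> 0 < complex.Re (hip (z - y) v) & in_ball (y + r%:C *: v) r].

Lemma normal_at_le y v (r s : R) : 0 <= s <= r -> normal_at y v r -> normal_at y v s.
Proof.
move=> /andP[s0 sr] [v1 vs vb]; split=> // h hs.
have -> : y + s%:C *: v + h = y + r%:C *: v + (h - (r - s)%:C *: v).
  by apply/rowP => j; rewrite !mxE rmorphB /=; ring.
apply: vb; apply: le_lt_trans (enormB _ _) _.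
by rewrite enormZr v1 mulr1 ger0_norm ?subr_ge0 //; lra.
Qed.

(** The ball in direction [v] lies on the positive side of the hyperplane normal to [w] only if the
    real part of [hip v w] is at least 1, which forces unit vectors to coincide. Hence all defining
    functions give the same inward normal. *)
Lemma normal_at_unique y v w (r s : R) : 0 < r -> normal_at y v r -> normal_at y w s ->
  v = w.
Proof.
move=> r0 [v1 _ vb] [w1 ws _].
have H : r <= r * complex.Re (hip v w).
  apply/ler_addgt0Pr => e e0.
  pose t := Num.max (r - e) 0.
  have [t0 t1 tr] : [/\ 0 <= t, r - e <= t & t < r].
    by split; rewrite ?le_max ?lexx ?orbT // gt_max r0 andbT; lra.
  have := vb (- (t%:C *: w)); rewrite enormN enormZr ger0_norm // w1 mulr1 => /(_ tr) /ws.
  have -> : y + r%:C *: v - t%:C *: w - y = r%:C *: v - t%:C *: w.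
    by apply/rowP => j; rewrite !mxE; ring.
  rewrite hipBl !hipZl cReB !cReZ -(sqr_enorm w) w1 expr1n; lra.
have vw1 : 1 <= complex.Re (hip v w) by rewrite -(ler_pM2l r0) mulr1.
have : enorm (v - w) ^+ 2 <= 0.
  rewrite sqr_enorm !(hipBl, hipBr) !cReB -!sqr_enorm v1 w1 expr1n (Re_hipC w v); lra.
by rewrite exprn_even_le0 //= enorm_eq0 subr_eq0 => /eqP.
Qed.

Section DefiningFunction.
Variables (r : V -> R) (U : set V) (y0 : V).
Hypothesis oU : open U.
Hypothesis Uy0 : U y0.
Hypothesis rU : smooth_on U r.
Hypothesis rO : forall z, U z -> (Omega z <-> r z < 0).
Hypothesis rG : forall z, U z -> gradient r z != 0.
Local Notation G := (gradient r).
Local Notation nor y := (- ((enorm (G y))^-1%:C *: G y)).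

Lemma small_step e (w : V) : 0 < e -> exists2 T : R, 0 < T <= 1 &
  forall t, 0 < t <= T -> enorm (t%:C *: w) <= e.
Proof.
move=> e0; have w0 := enorm_ge0 w.
have w1 : 0 < enorm w + 1 by lra.
exists (Num.min 1 (e / (enorm w + 1))).
  by rewrite lt_min ltr01 divr_gt0 //= ge_min lexx.
move=> t /andP[t0]; rewrite le_min => /andP[t1]; rewrite ler_pdivlMr // => te.
rewrite enormZr gtr0_norm //; nra.
Qed.

Lemma le0_limit (a C T : R) : 0 < T -> (forall t, 0 < t <= T -> a <= C * t) -> a <= 0.
Proof.
move=> T0 H; rewrite leNgt; apply/negP => a0.
pose t := Num.min T (a / (2 * (`|C| + 1))).
have C1 : 0 < 2 * (`|C| + 1) by have := normr_ge0 C; lra.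
have t0 : 0 < t by rewrite lt_min T0 divr_gt0.
have tT : t <= T by rewrite /t ge_min lexx.
have : t * (2 * (`|C| + 1)) <= a by rewrite -ler_pdivlMr // /t ge_min lexx orbT.
have := H t; rewrite t0 tT => /(_ isT).
have : C * t <= `|C| * t by rewrite ler_wpM2r ?ler_norm // ltW.
nra.
Qed.

(** Along a segment from [y] into [Omega] the function [r] is negative, so its first-order term
    cannot be positive: the gradient gives a supporting normal. In the ball of radius [r0] tangent
    at [y] the first-order term is negative and outweighs the quadratic error. Both estimates are
    uniform for [y] near [y0]. *)
Lemma defining_normal : exists e r0 : R, [/\ 0 < e, 0 < r0 &
  forall y, bdry y -> enorm (y - y0) <= e -> normal_at y (nor y) r0].
Proof.
have [C [e [C0 e0 quad]]] := quadratic_bound oU Uy0 rU.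
pose m := enorm (G y0).
have m0 : 0 < m by rewrite enorm_gt0 rG.
have m20 : 0 < m / 2 by rewrite divr_gt0.
have [dl dl0 dlP] := gradient_continuous oU Uy0 rU m20.
pose r0 := Num.min (e / 2) (m / (4 * C)).
have C4 : 0 < 4 * C by lra.
have r00 : 0 < r0 by rewrite lt_min !divr_gt0.
exists (Num.min e (dl / 2)), r0; split=> //.
  by rewrite lt_min e0 divr_gt0.
move=> y yb; rewrite le_min => /andP[ye ydl].
have UY : U y.
  by have [] := quad y 0 ye; rewrite ?enorm0 ?(ltW e0) // addr0.
have Gm : m / 2 <= enorm (G y).
  have := dlP (y - y0); rewrite subrKC => /(_ (ltac:(lra))) H.
  have := enormD (G y) (G y0 - G y); rewrite subrKC (enorm_distC (G y0)).
  rewrite -[enorm (G y0)]/m; lra.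
have G0 : 0 < enorm (G y) by lra.
have ry0 : 0 <= r y.
  by rewrite leNgt; apply/negP => /(rO UY); case: yb.
have inside z t : Omega z -> enorm (t%:C *: (z - y)) <= e -> 0 < t <= 1 ->
    r y + t * complex.Re (hip (z - y) (G y)) <= C * enorm (z - y) ^+ 2 * t ^+ 2.
  move=> Oz zt t01; have [Uz] := quad y (t%:C *: (z - y)) ye zt.
  have rz := proj1 (rO Uz) (segment_inside yb Oz t01).
  rewrite hipZl cReZ enormZr exprMn real_normK ?num_real // => H.
  have := ler_norm (- (r (y + t%:C *: (z - y)) - r y - t * complex.Re (hip (z - y) (G y)))).
  rewrite normrN; lra.
have ineq z : Omega z -> complex.Re (hip (z - y) (G y)) <= 0.
  move=> Oz; have [T /andP[T0 T1] TP] := small_step (z - y) e0.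
  apply: (@le0_limit _ (C * enorm (z - y) ^+ 2) T) => // t /andP[t0 tT].
  have := inside z t Oz; rewrite TP ?t0 ?tT ?(le_trans tT T1) // => /(_ isT isT).
  rewrite expr2 mulrA => H; rewrite -(ler_pM2r t0); lra.
have [p0 Op0] : exists p0, Omega p0.
  by have [h _ Oh] := yb.2 1 ltr01; exists (y + h).
(* Only the sign of [r] is prescribed; its vanishing on the boundary follows by approaching [y]
   along a segment. *)
have ry : r y <= 0.
  have [T /andP[T0 T1] TP] := small_step (p0 - y) e0.
  apply: (@le0_limit _ (C * enorm (p0 - y) ^+ 2 - complex.Re (hip (p0 - y) (G y))) T) => // t /andP[t0 tT].
  have := inside p0 t Op0; rewrite TP ?t0 ?tT ?(le_trans tT T1) // => /(_ isT isT).
  have CE : 0 <= C * enorm (p0 - y) ^+ 2 by rewrite mulr_ge0 ?sqr_ge0 // ltW.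
  have t1 : t <= 1 by exact: le_trans T1.
  have : C * enorm (p0 - y) ^+ 2 * t ^+ 2 <= C * enorm (p0 - y) ^+ 2 * t.
    by rewrite ler_wpM2l // expr2 ler_piMl // ltW.
  lra.
have nor1 : enorm (nor y) = 1.
  by rewrite enormN enormZr gtr0_norm ?invr_gt0 // mulVf // gt_eqF.
have hnor w : complex.Re (hip w (G y)) = - (enorm (G y) * complex.Re (hip w (nor y))).
  rewrite hipNr hipZr cReN conjc_real cReZ mulrN opprK mulrA divff ?mul1r //.
  by rewrite gt_eqF.
split=> //.
- move=> z Oz; have [e1 e10 e1P] := open_enormP openO Oz.
  (* Strictness: [Omega] is open, so the weak inequality still holds after [z] is moved a little in
     the direction of [G y]. *)
  have [T /andP[T0 _] TP] := small_step (G y) (ltac:(lra) : 0 < e1 / 2).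
  have := TP T; rewrite T0 lexx => /(_ isT) TG.
  have /ineq : Omega (z + T%:C *: G y) by apply: e1P; lra.
  have -> : z + T%:C *: G y - y = (z - y) + T%:C *: G y.
    by apply/rowP => j; rewrite !mxE; ring.
  rewrite hipDl cReD hipZl cReZ -sqr_enorm hnor => H.
  have GG : 0 < T * enorm (G y) ^+ 2 by rewrite mulr_gt0 ?exprn_gt0.
  by rewrite -(pmulr_rgt0 _ G0); lra.
- move=> h hr; set v := nor y in nor1 hnor *.
  pose k := r0%:C *: v + h.
  have [r0e r0m] : r0 <= e / 2 /\ r0 <= m / (4 * C) by rewrite !ge_min !lexx orbT.
  have ke : enorm k <= e.
    apply: le_trans (enormD _ _) _; rewrite enormZr nor1 gtr0_norm //; lra.
  rewrite -addrA -/k.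
  have [Uk] := quad y k ye ke; rewrite hnor => H; apply/(rO Uk).
  (* The inequality of the open ball of radius [r0] tangent at the origin. *)
  have kk : enorm k ^+ 2 < 2 * r0 * complex.Re (hip k v).
    rewrite sqr_enorm /k !(hipDl, hipDr) !hipZl !hipZr !cReD conjc_real !cReZ.
    rewrite -!sqr_enorm nor1 expr1n (Re_hipC v h).
    have hh : enorm h ^+ 2 < r0 ^+ 2 by rewrite ltr_pXn2r ?nnegrE ?enorm_ge0 ?(ltW r00).
    nra.
  set X := complex.Re (hip k v) in H kk.
  have X0 : 0 < X by have := sqr_ge0 (enorm k); nra.
  have := ler_norm (r (y + k) - r y - - (enorm (G y) * X)).
  have : C * enorm k ^+ 2 < C * (2 * r0 * X) by rewrite ltr_pM2l.
  have rC : r0 * (4 * C) <= m by rewrite -ler_pdivlMr.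
  have : r0 * (4 * C) * X <= m * X by rewrite ler_wpM2r // ltW.
  have : m / 2 * X <= enorm (G y) * X := ler_wpM2r (ltW X0) Gm.
  lra.
Qed.

End DefiningFunction.

Lemma defining_normal_at y r : bdry y -> defining_function Omega y r ->
  exists2 r0 : R, 0 < r0 &
  normal_at y (- ((enorm (gradient r y))^-1%:C *: gradient r y)) r0.
Proof.
move=> yb [U [[oU Uy] rU rO rG]].
have [e [r0 [e0 r00 H]]] := defining_normal oU Uy rU rO rG.
by exists r0 => //; apply: H; rewrite // subrr enorm0 ltW.
Qed.

Hypothesis bndO : bounded_set Omega.
Hypothesis smooth : smooth_boundary Omega.

Lemma compact_bdry : exists2 K : set V, compact K & forall y, bdry y -> K y.
Proof.
have [D D0 DP] := bounded_enorm bndO.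
have [[p0 Op0]|nO] := pselect (exists p0, Omega p0); last first.
  exists set0; first exact: compact0.
  by move=> y [_ /(_ 1 ltr01)[h _ Oh]]; case: nO; exists (y + h).
exists [set v : V | forall j : 'I_d, modc (v ord0 j - p0 ord0 j) <= D + 1].
  exact: (@rV_compact _ d (fun j => [set z : R[i] | modc (z - p0 ord0 j) <= D + 1])
    (fun j => @compact_disc R _ _)).
move=> y [_ /(_ 1 ltr01)[h h1 Oh]] j /=.
have := modc_le_enorm (y - p0) j; rewrite !mxE; move=> H; apply: le_trans H _.
have -> : y - p0 = (y + h - p0) - h by apply/rowP => k; rewrite !mxE; ring.
by apply: le_trans (enormB _ _) _; rewrite lerD ?(ltW h1) // DP.
Qed.

(** The local radii of [defining_normal] become uniform by compactness, with radii of the form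
    [1 / (N + 1)]. Points of the compact set off the boundary have a neighbourhood free of boundary
    points, where the claim is vacuous. *)
Lemma inner_balls : exists (nu : V -> V) (r0 : R), 0 < r0 /\
  forall y, bdry y -> normal_at y (nu y) r0.
Proof.
have [K cK bK] := compact_bdry.
have rad (N : nat) : 0 < N.+1%:R^-1 :> R by rewrite invr_gt0.
pose P (N : nat) y := bdry y -> exists v, normal_at y v N.+1%:R^-1.
have PW (r0 : R) (A : set V) : 0 < r0 ->
    (forall y, A y -> bdry y -> exists v, normal_at y v r0) ->
    exists N0 : nat, forall N, (N0 <= N)%N -> forall y, A y -> P N y.
  move=> r00 H; exists (Num.truncn r0^-1) => N NN y Ay yb.
  have [v vn] := H y Ay yb; exists v; apply: normal_at_le vn.
  rewrite (ltW (rad N)) /= -[leRHS]invrK lef_pV2 ?posrE ?invr_gt0 //.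
  have /ltW H1 : r0^-1 < (Num.truncn r0^-1).+1%:R by exact: truncnS_gt.
  by apply: le_trans H1 _; rewrite ler_nat ltnS.
have : \forall N \near \oo, K `<=` P N.
  move: cK => /compact_near_coveringP/(_ nat \oo P); apply=> y0 Ky0.
  have loc : exists (r0 e : R), [/\ 0 < r0, 0 < e & forall y, enorm (y - y0) < e ->
      bdry y -> exists v, normal_at y v r0].
    have [y0b|ny0] := pselect (bdry y0).
      have [r [U [[oU Uy] rU rO rG]]] := smooth (proj2 (boundary_bdry y0) y0b).
      have [e [r0 [e0 r00 H]]] := defining_normal oU Uy rU rO rG.
      by exists r0, e; split=> // y ye yb; eexists; apply: H => //; exact: ltW.
    have [Oy0|nOy0] := pselect (Omega y0).
      have [e e0 eP] := open_enormP openO Oy0; exists 1, e; split=> // y ye [nOy _].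
      by case: nOy; have := eP _ ye; rewrite subrKC.
    have [e e0 eP] : exists2 e : R, 0 < e & forall h, enorm h < e -> ~ Omega (y0 + h).
      apply: contrapT => nex; apply: ny0; split=> // e e0; apply: contrapT => nh.
      by apply: nex; exists e => // h he Oh; apply: nh; exists h.
    exists 1, (e / 2); split=> //; first by rewrite divr_gt0.
    move=> y ye [_ /(_ (e / 2))[|h he Oh]]; first by rewrite divr_gt0.
    case: (eP (y - y0 + h)); first by apply: le_lt_trans (enormD _ _) _; lra.
    by rewrite addrA [y0 + _]addrC subrK.
  have [r0 [e [r00 e0 H]]] := loc.
  have [N0 N0P] := PW r0 [set y | enorm (y - y0) < e] r00 H.
  exists ([set y | enorm (y - y0) < e], [set N | (N0 <= N)%N]).
    split=> /=; last by exists N0.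
    by apply/near_enormP; exists e => // h he /=; rewrite addrC addKr.
  by move=> [y N] [/= ye NN]; exact: N0P.
case=> N _ /(_ N (leqnn N)) NP.
have : forall y, exists v, bdry y -> normal_at y v N.+1%:R^-1.
  move=> y; have [yb|nb] := pselect (bdry y); last by exists 0.
  by have [v vn] := NP y (bK y yb) yb; exists v.
by case/choice => nu nuP; exists nu, N.+1%:R^-1.
Qed.

End InnerBalls.

(** * Kobayashi distance *)

Section Mobius.
Variable R : realType.
Implicit Types a b w z : R[i].

Definition mobius b w : R[i] := (w + b) / (1 + b^*%C * w).

Lemma mobius_den b w : modc b < 1 -> modc w < 1 -> 1 + b^*%C * w != 0.
Proof.
move=> b1 w1; rewrite -modc_gt0.
have := modcD (1 + b^*%C * w) (- (b^*%C * w)); rewrite addrK modc1 modcN modcM modc_conj.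
have := modc_ge0 b; have := modc_ge0 w; nra.
Qed.

Lemma mobius_disc b w : modc b < 1 -> modc w < 1 -> modc (mobius b w) < 1.
Proof.
move=> b1 w1; have D0 := mobius_den b1 w1.
rewrite /mobius modcM modcV ltr_pdivrMr ?modc_gt0 // mul1r.
rewrite -(@ltr_pXn2r _ 2) ?nnegrE ?modc_ge0 // -subr_gt0.
have -> : modc (1 + b^*%C * w) ^+ 2 - modc (w + b) ^+ 2 =
    (1 - modc w ^+ 2) * (1 - modc b ^+ 2).
  by rewrite !modc_sqr; case: b {b1 D0} => b1 b2; case: w {w1} => w1 w2 /=; ring.
by rewrite mulr_gt0 // subr_gt0 expr_lt1 // modc_ge0.
Qed.

Lemma mobiusK b a : modc b < 1 -> modc a < 1 ->
  mobius b ((a - b) / (1 - b^*%C * a)) = a.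
Proof.
move=> b1 a1; have D0 : 1 - b^*%C * a != 0.
  have := @mobius_den (- b) a; rewrite modcN rmorphN mulNr; exact.
have bb : 1 - b^*%C * b != 0.
  by have := @mobius_den (- b) b; rewrite modcN rmorphN mulNr; exact.
rewrite /mobius.
have -> : (a - b) / (1 - b^*%C * a) + b = a * (1 - b^*%C * b) / (1 - b^*%C * a).
  by field.
have -> : 1 + b^*%C * ((a - b) / (1 - b^*%C * a)) =
  (1 - b^*%C * b) / (1 - b^*%C * a) by field.
by field; rewrite D0 bb.
Qed.

Lemma mobius_differentiable b w : modc b < 1 -> modc w < 1 ->
  differentiable (mobius b) w.
Proof.
move=> b1 w1; have idd : differentiable (fun w : R[i] => w) w by [].
have n1 := differentiableD idd (differentiable_cst b w).
have d1 := differentiableD (differentiable_cst (1 : R[i]) w)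
  (differentiableM (differentiable_cst b^*%C w) idd).
exact: (differentiableM n1 (differentiableV d1 (mobius_den b1 w1))).
Qed.

(** With this normalization [expR (2 * poincare_dist a b)] is exactly the Harnack constant
    [(1 + rho) / (1 - rho)], once a Mobius map has taken 0 to [b]. *)
Lemma poincare_harnack (H : R[i] -> R[i]) a b : modc a < 1 -> modc b < 1 ->
  (forall z, modc z < 1 -> differentiable H z) ->
  (forall z, modc z < 1 -> 0 < complex.Re (H z)) ->
  complex.Re (H b) <= expR (2 * poincare_dist a b) * complex.Re (H a).
Proof.
move=> a1 b1 Hd H0; pose w := (a - b) / (1 - b^*%C * a).
have w1 : modc w < 1.
  have := @mobius_disc (- b) a; rewrite modcN => /(_ b1 a1).
  by rewrite /mobius rmorphN mulNr.
have w0 := modc_ge0 w.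
have T1 z : modc z < 1 -> modc (mobius b z) < 1 by exact: mobius_disc.
have [||_ _] := @half_plane_schwarz R (H \o mobius b) _ _ w w1.
- move=> z z1; apply: differentiable_comp; first exact: mobius_differentiable.
  by apply: Hd; exact: T1.
- by move=> z /T1; exact: H0.
rewrite /= mobiusK // [mobius b 0]/mobius mulr0 add0r addr0 divr1.
rewrite /poincare_dist -/w -/(modc w) [2 * (_ / 2)]mulrC divfK ?pnatr_eq0 //.
have w10 : 0 < (1 + modc w) / (1 - modc w) by rewrite divr_gt0 ?subr_gt0 // ltr_pwDl.
rewrite lnK ?posrE //.
by rewrite mulrAC ler_pdivlMr ?subr_gt0 // [_ * (1 - _)]mulrC.
Qed.

End Mobius.

Section KobayashiBall.
Variables (R : realType) (d : nat).
Local Notation V := 'rV[R[i]]_d.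
Local Notation enorm := (@euclidean_norm R d).
Variable Omega : set V.
Implicit Types (v w h x y p q : V).

Lemma link_harnack (h : V -> R[i]) p q (l : R) : pos_hol Omega h ->
  disc_link Omega p q l -> complex.Re (h q) <= expR (2 * l) * complex.Re (h p).
Proof.
move=> [hd h0] [f [a [b [fd fO [a1 b1] [<- <-] ->]]]].
have disc (z : R[i]) : modc z < 1 -> unit_disc z.
  by move=> z1; rewrite /unit_disc /= normc_modc ltcR.
have disc' (z : R[i]) : unit_disc z -> modc z < 1.
  by rewrite /unit_disc /= normc_modc ltcR.
have fz z : modc z < 1 -> Omega (f z) by move=> /disc z1; apply: fO; exists z.
apply: (@poincare_harnack R (h \o f)); [exact: disc'|exact: disc'| |] => z z1 /=.
  exact: (@differentiable_comp _ _ _ _ f h z (fd _ (disc z z1)) (hd _ (fz z z1))).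
exact: (h0 _ (fz z z1)).
Qed.

(** Along a chain of discs the Harnack constants multiply as the lengths add. The [1] in [M + 1] is
    there because the infimum defining the distance need not be attained. *)
Lemma kobayashi_harnack (h : V -> R[i]) p q (M : R) : pos_hol Omega h -> Omega p ->
  (kobayashi_dist Omega p q <= M%:E)%E ->
  complex.Re (h q) <= expR (2 * (M + 1)) * complex.Re (h p).
Proof.
move=> hP Op pM.
have : (kobayashi_dist Omega p q < (M + 1)%:E)%E.
  by apply: le_lt_trans pM _; rewrite lte_fin ltrDl.
move=> /ereal_inf_lt[_ [L [n [c [l [c0 cn cl ->]]]] <-]]; rewrite lte_fin => LM.
have chain k : (k <= n)%N ->
    complex.Re (h (c k)) <= expR (2 * \sum_(i < k) l i) * complex.Re (h p).
  elim: k => [_|k IH kn]; first by rewrite big_ord0 mulr0 expR0 mul1r c0.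
  apply: le_trans (link_harnack hP (cl k kn)) _.
  rewrite big_ord_recr /= mulrDr expRD [expR _ * expR _]mulrC -mulrA.
  by rewrite ler_wpM2l ?expR_ge0 // IH // ltnW.
have := chain n (leqnn n); rewrite cn => H; apply: le_trans H _.
rewrite ler_wpM2r ?(ltW (hP.2 _ Op)) // ler_expR; lra.
Qed.

Hypothesis openO : open Omega.
Variable nu : V -> V.
Hypothesis nu1 : forall y, bdry Omega y -> enorm (nu y) = 1.
Hypothesis nu_supp : forall y z : V, bdry Omega y -> Omega z ->
  0 < complex.Re (hip (z - y) (nu y)).

(** By the ball around [o], every supporting functional exceeds [e / 2] at [o]. Harnack's inequality
    keeps it away from 0 at [p], so no point outside [Omega] can be close to [p]. *)
Lemma kobayashi_in_ball o (M : R) : Omega o -> exists2 c0 : R, 0 < c0 &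
  forall p, Omega p -> (kobayashi_dist Omega p o <= M%:E)%E -> in_ball Omega p c0.
Proof.
move=> Omo; have [e e0 eP] := open_enormP openO Omo.
exists (e / 2 / expR (2 * (M + 1))); first by rewrite !divr_gt0 ?expR_gt0.
move=> p Op pM h he; apply: contrapT => nO.
have [y [yb hy _]] := separation (open_enormP openO) nu_supp Op nO.
have := kobayashi_harnack (pos_hol_supp nu_supp yb) Op pM.
set E := expR _ in he *; have E0 : 0 < E by exact: expR_gt0.
have e2 : 0 < e / 2 by rewrite divr_gt0.
have : Omega (o - (e / 2)%:C *: nu y).
  by apply: eP; rewrite enormN enormZr nu1 // mulr1 gtr0_norm //; lra.
move=> /(nu_supp yb).
have -> : o - (e / 2)%:C *: nu y - y = (o - y) - (e / 2)%:C *: nu y.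
  by rewrite addrAC.
rewrite (hipBl (o - y)) (cReB (hip (o - y) _)) hipZl cReZ -sqr_enorm nu1 // expr1n mulr1 => h1 h2.
have : enorm h * E < e / 2 by rewrite -ltr_pdivlMr.
have : E * complex.Re (hip (p - y) (nu y)) <= E * enorm h.
  rewrite ler_pM2l //.
  have -> : p - y = (p + h - y) - h by apply/rowP => j; rewrite !mxE; ring.
  rewrite (hipBl (p + h - y)) (cReB (hip (p + h - y) _)).
  have := cauchy_schwarz (- h) (nu y); rewrite hipNl cReN enormN nu1 // mulr1; lra.
lra.
Qed.

Lemma orbit_balls o x n (M T : R) : Omega o ->
  [set x + (expR (- (2 * t)))%:C *: n | t in [set t : R | T < t]]
     `<=` Aut_orbit Omega
            [set p | Omega p /\ (kobayashi_dist Omega p o <= M%:E)%E] ->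
  exists c0 ds : R, [/\ 0 < c0, 0 < ds & forall dl : R, 0 < dl <= ds ->
    exists phi psi : V -> V,
    [/\ forall z : V, Omega z -> Omega (phi z) /\ differentiable phi z,
        forall z : V, Omega z -> Omega (psi z) /\ differentiable psi z,
        forall z : V, Omega z -> phi (psi z) = z &
        in_ball Omega (psi (x + dl%:C *: n)) c0]].
Proof.
move=> Omo orb; have [c0 c00 c0P] := kobayashi_in_ball M Omo.
(* The height [dl] has parameter [t = - ln dl / 2]; [T + 1] makes [T < t] strict. *)
exists c0, (expR (- (2 * (T + 1)))); split; rewrite ?expR_gt0 // => dl /andP[dl0 dlT].
pose t := - ln dl / 2.
have dlE : dl = expR (- (2 * t)).
  by rewrite /t [2 * _]mulrC divfK ?pnatr_eq0 // opprK lnK.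
have Tt : T < t.
  by move: dlT; rewrite dlE ler_expR; lra.
have [|phi [phid [phiO [psi [psid psiO phiK psiK]]]] [p [Op pM] pE]] :=
  orb (x + dl%:C *: n); first by exists t; [exact: Tt|rewrite dlE].
exists phi, psi; split.
- by move=> z Oz; split; [exact: phiO|exact: phid].
- by move=> z Oz; split; [exact: psiO|exact: psid].
- by move=> z Oz; apply: psiK; rewrite inE.
- by rewrite -pE phiK ?inE //; exact: c0P.
Qed.

End KobayashiBall.

(** * Order of contact *)

Section OrderOfZero.
Variables (R : realType) (d : nat).
Local Notation V := 'rV[R[i]]_d.
Local Notation enorm := (@euclidean_norm R d).
Implicit Types (z w h : R[i]) (G : R[i] -> V) (f q : R[i] -> R[i]).

Lemma derive1_entry G z : (forall j, differentiable (fun w => G w 0 j) z) ->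
  forall j, (derive1 G z) 0 j = derive1 (fun w => G w 0 j) z.
Proof.
move=> Gd j; suff -> : derive1 G z = \row_k derive1 (fun w => G w 0 k) z by rewrite mxE.
rewrite derive1E; apply: cvg_lim; first exact: norm_hausdorff.
move=> A /= /near_enormP[e e0 eA].
pose c := (d%:R + 1 : R); have c0 : 0 < c by rewrite ltr_wpDl.
have ec0 : 0 < e / c by rewrite divr_gt0.
have [||dl dl0 dlP] := @uniform_radius R 'I_d (fun k dl => forall h, modc h < dl ->
    modc (G (z + h) 0 k - G z 0 k - derive1 (fun w => G w 0 k) z * h) <= e / c * modc h).
- by move=> k s t H ts h ht; apply: H; exact: lt_le_trans ht ts.
- by move=> k; have := differentiable_cdiff (Gd k) ec0.
rewrite /dnbhs /within /=; apply/near_modcP; exists dl => // h hd.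
rewrite add0r => h0 /=; set L := \row_k _ in eA *.
rewrite -(subrK L (_ *: _)) addrC; apply: eA.
apply: le_lt_trans (enorm_le_sum _) _.
have h0' : 0 < modc h by rewrite modc_gt0.
apply: (@le_lt_trans _ _ (\sum_(k < d) (e / c))).
  apply: ler_sum => k _; rewrite !mxE -(ler_pM2r h0') -modcM.
  rewrite mulrBl mulrAC mulVf // mul1r [h *: _]mulr1 [h + z]addrC.
  exact: dlP.
rewrite sumr_const card_ord -mulr_natl mulrA ltr_pdivrMr // mulrC ltr_pM2l //.
by rewrite ltrDl.
Qed.

(** The sum and product rules in the one shape that the induction for [derive1n_idM] meets. *)
Lemma cdiff_idMD f q z c l m : cdiff f z l -> cdiff q z m ->
  cdiff (fun w => w * f w + c * q w) z (f z + z * l + c * m).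
Proof.
move=> fl qm e e0; have fc := cdiff_ccont fl.
have z0 := modc_ge0 z; have c0 := modc_ge0 c.
pose e1 := e / (modc z + modc c + 1).
have s0 : 0 < modc z + modc c + 1 by lra.
have e10 : 0 < e1 by rewrite divr_gt0.
have eE : (modc z + modc c + 1) * e1 = e by rewrite /e1 mulrC divfK // gt_eqF.
have [d1 d10 H1] := fl _ e10; have [d2 d20 H2] := qm _ e10.
have [d3 d30 H3] := fc _ e10.
exists (Num.min d1 (Num.min d2 d3)) => [|h]; first by rewrite !lt_min d10 d20.
rewrite !lt_min => /and3P[/H1 h1 /H2 h2 /H3 h3].
have -> : (z + h) * f (z + h) + c * q (z + h) - (z * f z + c * q z) -
    (f z + z * l + c * m) * h =
  z * (f (z + h) - f z - l * h) + c * (q (z + h) - q z - m * h) +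
  (f (z + h) - f z) * h by ring.
apply: le_trans (modcD _ _) _; apply: le_trans (lerD (modcD _ _) (lexx _)) _.
rewrite !(modcM z) (modcM c) (modcM (f (z + h) - f z)) -eE.
have := ler_wpM2l z0 h1; have := ler_wpM2l c0 h2.
have := ler_wpM2r (modc_ge0 h) h3; lra.
Qed.

Section Disc.
Variable rho : R.
Let D := [set z : R[i] | modc z < rho].

Lemma disc_near z : D z -> \forall w \near z, D w.
Proof. exact: near_open (@open_disc R rho) z. Qed.

Lemma disc_derive1 f z : (forall w, D w -> differentiable f w) -> D z ->
  differentiable (derive1 f) z.
Proof.
move=> fd Dz; have /near_modcP[e e0 eP] := disc_near Dz.
apply: (@derive1_differentiable _ f z (e / 2)); first by rewrite divr_gt0.
move=> w wz; apply: fd; rewrite -(subrKC z w); apply: eP.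
by apply: le_lt_trans wz _; lra.
Qed.

Lemma disc_derive1n f k z : (forall w, D w -> differentiable f w) -> D z ->
  differentiable (derive1n k f) z.
Proof.
move=> fd; elim: k z => [|k IH] z Dz; first exact: fd.
exact: (disc_derive1 (f := derive1n k f) IH).
Qed.

Lemma differentiable_disc_ext f q z : (forall w, D w -> f w = q w) -> D z ->
  differentiable f z -> differentiable q z.
Proof.
move=> fq Dz; apply: differentiable_near.
by have /near_modcP[e e0 eP] := disc_near Dz; exists e => // h /eP /fq.
Qed.

Lemma derive1_disc_ext f q z : (forall w, D w -> f w = q w) -> D z ->
  derive1 f z = derive1 q z.
Proof.
move=> fq Dz; rewrite !derive1E; apply: near_eq_derive.
by apply: filterS (disc_near Dz) => w; exact: fq.
Qed.

Lemma derive1n_entry G k z : (forall w, D w -> differentiable G w) -> D z ->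
  forall j, (derive1n k G z) 0 j = derive1n k (fun w => G w 0 j) z.
Proof.
move=> Gd; have Gjd j w : D w -> differentiable (fun w => G w 0 j) w.
  by move=> /Gd; exact: differentiable_entry.
elim: k z => [//|k IH] z Dz j.
have kd i : differentiable (fun w => derive1n k G w 0 i) z.
  apply: (differentiable_disc_ext _ Dz (disc_derive1n k (Gjd i) Dz)) => w Dw.
  by rewrite (IH w Dw).
transitivity (derive1 (fun w => derive1n k G w 0 j) z).
  exact: (derive1_entry kd j).
exact: (derive1_disc_ext (fun w Dw => IH w Dw j) Dz).
Qed.

(** Leibniz's rule, with two terms because the second derivative of the factor [w] is 0. At [k = 0]
    the meaningless index [k.-1] carries the coefficient 0. *)
Lemma derive1n_idM q k z : (forall w, D w -> differentiable q w) -> D z ->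
  derive1n k (fun w => w * q w) z =
  z * derive1n k q z + k%:R * derive1n k.-1 q z.
Proof.
move=> qd; elim: k z => [|k IH] z Dz; first by rewrite mul0r addr0.
transitivity (derive1 (fun w => w * derive1n k q w + k%:R * derive1n k.-1 q w) z).
  exact: (derive1_disc_ext IH Dz).
have qk := differentiable_cdiff (disc_derive1n k qd Dz).
have qk' := differentiable_cdiff (disc_derive1n k.-1 qd Dz).
have := cdiff_derive1 (cdiff_idMD k%:R qk qk') => ->.
rewrite -[derive1 (derive1n k q) z]/(derive1n k.+1 q z) [k.+1.-1]/=.
case: k {IH qk qk'} => [|k] /=; first by rewrite mul0r; ring.
by rewrite -[derive1 (derive1n k q) z]/(derive1n k.+1 q z) -[in RHS]natr1; ring.
Qed.

End Disc.
(** Division by [z] lowers the order of vanishing by one: at 0 the derivatives of [f] and of its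
    quotient [q] differ by a shift of index and a nonzero factor [k + 1]. *)
Lemma zero_order a f (rho : R) : 0 < rho ->
  (forall z, modc z < rho -> differentiable f z) ->
  (forall k, (k < a)%N -> derive1n k f 0 = 0) -> derive1n a f 0 != 0 ->
  exists c e : R, [/\ 0 < c, 0 < e &
    forall z, modc z <= e -> c * modc z ^+ a <= modc (f z)].
Proof.
elim: a f rho => [|a IH] f rho rho0 fd fv fa.
  have f0 : 0 < modc (f 0) by rewrite modc_gt0.
  have f02 : 0 < modc (f 0) / 2 by lra.
  have fc : ccont f 0 by apply: differentiable_ccont; apply: fd; rewrite modc0.
  have [e e0 eP] := fc _ f02; exists (modc (f 0) / 2), (e / 2); split=> //; first by lra.
  move=> z ze; rewrite expr0 mulr1; have := eP z (ltac:(lra)); rewrite add0r.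
  have := modcD (f z) (f 0 - f z); rewrite subrKC (modc_distC (f 0)); lra.
have rho2 : 0 < rho / 2 by lra.
have fd' z : modc (z - 0) <= rho / 2 -> differentiable f z.
  by rewrite subr0 => zr; apply: fd; lra.
have [B B0 BP] := bounded_on_disc fd'.
have [|q [qd _ qf _]] := @divide_at _ f 0 (rho / 2) B 0 rho2 fd' BP.
  by rewrite subrr modc0; lra.
have f00 : f 0 = 0 by exact: (fv 0%N).
have fE : f = fun z => z * q z.
  by apply/funext => z; rewrite qf f00 add0r subr0.
have qd' z : modc z < rho / 2 -> differentiable q z.
  by move=> zr; apply: qd; rewrite subr0 ltW.
have fk k : derive1n k.+1 f 0 = k.+1%:R * derive1n k q 0.
  rewrite fE (derive1n_idM k.+1 (rho := rho / 2)) //; first by rewrite mul0r add0r.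
  by rewrite /= modc0.
have [||c [e [c0 e0 H]]] := IH q (rho / 2) rho2 qd'.
- move=> k ka; have := fv k.+1 ka; rewrite fk => /eqP.
  by rewrite mulf_eq0 pnatr_eq0 /= => /eqP.
- by move: fa; rewrite fk mulf_eq0 pnatr_eq0.
exists c, e; split=> // z /H h; rewrite fE exprS mulrCA (modcM z).
by rewrite ler_wpM2l // modc_ge0.
Qed.

Lemma vector_zero_order a G (rho : R) : 0 < rho ->
  (forall z, modc z < rho -> differentiable G z) ->
  (forall k, (k < a)%N -> derive1n k G 0 = 0) -> derive1n a G 0 != 0 ->
  exists c e : R, [/\ 0 < c, 0 < e &
    forall z, modc z <= e -> c * modc z ^+ a <= enorm (G z)].
Proof.
move=> rho0 Gd Gv Ga; have D0 : [set z : R[i] | modc z < rho] 0 by rewrite /= modc0.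
have [j Gj] : exists j, (derive1n a G 0) 0 j != 0.
  apply: contrapT => nj; move/eqP: Ga; apply; apply/rowP => j; rewrite mxE.
  by apply/eqP/negPn/negP => Gj; apply: nj; exists j.
rewrite (derive1n_entry a Gd D0) in Gj.
have [|k ka|c [e [c0 e0 H]]] := zero_order rho0 _ _ Gj.
- by move=> z /Gd; exact: differentiable_entry.
- by rewrite -(derive1n_entry k Gd D0) (Gv k ka) mxE.
exists c, e; split=> // z /H h; apply: le_trans h (modc_le_enorm _ _).
Qed.

Lemma pow_le_pow (c C e : R) (a b : nat) : 0 < c -> 0 < e ->
  (forall t, 0 < t <= e -> c * t ^+ a <= C * t ^+ b) -> (b <= a)%N.
Proof.
move=> c0 e0 H; rewrite leqNgt; apply/negP => ab.
pose t := Num.min e (Num.min 1 (c / (2 * (`|C| + 1)))).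
have C1 : 0 < 2 * (`|C| + 1) by have := normr_ge0 C; lra.
have t0 : 0 < t by rewrite !lt_min e0 ltr01 divr_gt0.
have te : t <= e by rewrite ge_min lexx.
have t1 : t <= 1 by rewrite !ge_min lexx !orbT.
have tc : t * (2 * (`|C| + 1)) <= c by rewrite -ler_pdivlMr // !ge_min lexx !orbT.
have := H t; rewrite t0 te => /(_ isT).
have -> : t ^+ b = t ^+ a * t * t ^+ (b - a.+1) by rewrite -exprSr -exprD subnKC.
have p1 : t ^+ (b - a.+1) <= 1 by rewrite exprn_ile1 // ltW.
have p0 : 0 <= t ^+ (b - a.+1) by rewrite exprn_ge0 // ltW.
have ta : 0 < t ^+ a by rewrite exprn_gt0.
set p := t ^+ (b - a.+1) in p1 p0 *; set u := t ^+ a in ta *.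
have : C * (u * t * p) <= `|C| * (u * t).
  apply: (@le_trans _ _ (`|C| * (u * t * p))).
    by rewrite ler_wpM2r ?ler_norm // mulr_ge0 // mulr_ge0 // ltW.
  by rewrite ler_wpM2l // ler_piMr // mulr_ge0 // ltW.
have : u * (t * (2 * (`|C| + 1))) <= u * c by rewrite ler_wpM2l // ltW.
have : 0 < u * t by rewrite mulr_gt0.
have := normr_ge0 C; have : 0 <= `|C| * (u * t) by rewrite !mulr_ge0 // ltW.
lra.
Qed.

End OrderOfZero.

(** * The bound on the order of contact, from the decay of discs *)

Section Contact.
Variables (R : realType) (d : nat).
Local Notation V := 'rV[R[i]]_d.
Local Notation enorm := (@euclidean_norm R d).
Variables (Omega U : set V) (r : V -> R) (x : V).
Implicit Types (z w : R[i]) (y : V) (g : R[i] -> V).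
Hypothesis oU : open U.
Hypothesis Ux : U x.
Hypothesis rU : smooth_on U r.
Hypothesis rO : forall z : V, U z -> (Omega z <-> r z < 0).
Hypothesis G0 : gradient r x != 0.
Local Notation G := (gradient r x).
Local Notation n := (- ((enorm G)^-1%:C *: G)).

Lemma push_arith (u v q t M C : R) : `|u - v - t * q| <= C * t ^+ 2 ->
  q <= - (M / 2) -> 0 <= t -> t * (4 * C) <= M -> u <= v - M / 4 * t.
Proof.
move=> h1 h2 t0 h3; have := ler_norm (u - v - t * q).
have : t * q <= t * (- (M / 2)) by rewrite ler_wpM2l.
have : t * (4 * C) * t <= M * t by rewrite ler_wpM2r.
lra.
Qed.

Lemma enorm_normalized (v : V) : 0 < enorm v -> enorm (- ((enorm v)^-1%:C *: v)) = 1.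
Proof.
by move=> v0; rewrite enormN enormZr gtr0_norm ?invr_gt0 // mulVf // gt_eqF.
Qed.

Lemma normal_descent (v w : V) : 0 < enorm v -> enorm (w - v) <= enorm v / 2 ->
  complex.Re (hip (- ((enorm v)^-1%:C *: v)) w) <= - (enorm v / 2).
Proof.
move=> v0 wv; set u := - _.
have u1 : enorm u = 1 by exact: enorm_normalized.
have uv : complex.Re (hip u v) = - enorm v.
  rewrite /u hipNl hipZl cReN cReZ -sqr_enorm expr2 mulrA mulVf ?mul1r //.
  by rewrite gt_eqF.
have := cauchy_schwarz u (w - v); rewrite u1 mul1r hipBr cReB uv.
by set q := complex.Re _ => H; lra.
Qed.

(** Near [x] the gradient keeps at least half of its length in its direction at [x], so a step [t]
    along [n] lowers [r] by [enorm G / 2 * t] up to a quadratic error. Half of this remains for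
    small [t], uniformly in [y]. *)
Lemma push_inside : exists c e : R, [/\ 0 < c, 0 < e &
  forall y t, enorm (y - x) <= e -> 0 <= t <= e ->
    U (y + t%:C *: n) /\ r (y + t%:C *: n) <= r y - c * t].
Proof.
have [C [e [C0 e0 quad]]] := quadratic_bound oU Ux rU.
have m0 : 0 < enorm G by rewrite enorm_gt0.
have m20 : 0 < enorm G / 2 by rewrite divr_gt0.
have [dl dl0 dlP] := gradient_continuous oU Ux rU m20.
have n1 : enorm n = 1 by exact: enorm_normalized.
have C4 : 0 < 4 * C by lra.
exists (enorm G / 4), (Num.min e (Num.min (dl / 2) (enorm G / (4 * C)))).
split; rewrite ?divr_gt0 // ?lt_min ?e0 ?divr_gt0 //.
move=> y t; rewrite !le_min => /and3P[ye yd _] /andP[t0 /and3P[te _ tC]].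
have tn : enorm (t%:C *: n) = t by rewrite enormZr n1 mulr1 ger0_norm.
have [|Uy H] := quad y (t%:C *: n) ye; first by rewrite tn.
split=> //; rewrite tn in H.
have := dlP (y - x); rewrite subrKC => /(_ (ltac:(lra))) H2.
apply: (push_arith (q := complex.Re (hip n (gradient r y))) _ _ t0 _ : _ <= _).
- by move: H; rewrite hipZl cReZ; exact.
- exact: normal_descent.
- by rewrite -ler_pdivlMr.
Qed.

Variables (m : nat) (C z1 : R).
Hypothesis z1_gt0 : 0 < z1.
Hypothesis decay : forall (dl : R) (f : R[i] -> V), 0 < dl <= z1 ->
  (forall w, modc w < 1 -> Omega (f w) /\ differentiable f w) ->
  f 0 = x + dl%:C *: n -> forall w, modc w <= 1 / 2 -> enorm (f w - f 0) ^+ m <= C * dl.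

Lemma scale_small (K e : R) (b : nat) : 0 < K -> 0 < e -> (0 < b)%N ->
  exists2 t0 : R, 0 < t0 & forall t, 0 < t <= t0 -> K * t ^+ b <= e.
Proof.
move=> K0 e0 b0; exists (Num.min 1 (e / K)); first by rewrite lt_min ltr01 divr_gt0.
move=> t /andP[t0]; rewrite le_min ler_pdivlMr // => /andP[t1 te].
apply: le_trans te; rewrite [leRHS]mulrC ler_pM2l // -[b]prednK // exprS.
by rewrite ler_piMr ?(ltW t0) // exprn_ile1 // ltW.
Qed.

Lemma contact_bound g (rho : R) (a b : nat) (c1 e1 : R) : 0 < rho -> g 0 = x ->
  (forall z, modc z < rho -> differentiable g z) -> 0 < c1 -> 0 < e1 ->
  (forall z, modc z <= e1 -> c1 * modc z ^+ a <= enorm (g z - x)) ->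
  (forall vs, (size vs < b)%N -> iter_real_derive (r \o g) vs 0 = 0) ->
  (b <= a * m)%N.
Proof.
move=> rho0 g0 gd c10 e10 glow van.
have [->|b0] := posnP b; first by [].
have [c [e [c0 e0 push]]] := push_inside.
have Ug : U (g 0) by rewrite g0.
have [C2 [dl [C20 dl0 up]]] := order_bound oU Ug rU rho0 gd van.
have [e2 e20 gx] : exists2 e2 : R, 0 < e2 & forall z, modc z < e2 -> enorm (g z - x) <= e.
  have gc : {for 0, continuous g}.
    by apply: differentiable_continuous; apply: gd; rewrite modc0.
  have /gc /near_modcP[e2 e20 e2P] : nbhs (g 0) [set y | enorm (y - x) <= e].
    by apply/near_enormP; exists e => // h he /=; rewrite g0 addrC addKr ltW.
  by exists e2 => // z /e2P; rewrite add0r.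
(* [c * K = C2 + 1]: the translation by [s = K * t ^+ b] lowers [r] by more than the bound
   [C2 * t ^+ b] on [r \o g], so the translated disc lies in [Omega]. *)
pose K := (C2 + 1) / c; have K0 : 0 < K by rewrite divr_gt0 //; lra.
have [t1 t10 t1P] := scale_small K0 e0 b0.
have [t2 t20 t2P] := scale_small K0 z1_gt0 b0.
pose T := Num.min (Num.min t1 t2) (Num.min (Num.min dl e1) (Num.min (e2 / 2) (rho / 2))).
have T0 : 0 < T by rewrite !lt_min t10 t20 dl0 e10 !divr_gt0.
(* The decay at [w = 1 / 2] gives [(c1 * (t / 2) ^+ a) ^+ m <= C * s], which compares the powers
   [a * m] and [b] of [t] for all small [t]. *)
apply: (@pow_le_pow _ (c1 ^+ m / 2 ^+ (a * m)) (C * K) T) => //.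
  by rewrite divr_gt0 // exprn_gt0.
move=> t /andP[tp]; rewrite !le_min => /andP[/andP[tt1 tt2] /andP[/andP[td te1] /andP[te2 trho]]].
pose s := K * t ^+ b.
have s0 : 0 < s by rewrite mulr_gt0 // exprn_gt0.
have se : s <= e by apply: t1P; rewrite tp.
have sz : s <= z1 by apply: t2P; rewrite tp.
pose f w := g (t%:C * w) + s%:C *: n.
have tw w : modc w < 1 -> modc (t%:C * w) <= t.
  by move=> w1; rewrite modcM modc_real gtr0_norm // ler_piMr ?ltW.
have fO w : modc w < 1 -> Omega (f w) /\ differentiable f w.
  move=> w1; have tw1 := tw w w1; split.
    have [|Uf rf] := push (g (t%:C * w)) s (gx _ (ltac:(lra))).
      by rewrite ltW.
    apply/(rO Uf); apply: le_lt_trans rf _.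
    have := up (t%:C * w) (ltac:(lra)); have := ler_norm (r (g (t%:C * w))).
    have : C2 * modc (t%:C * w) ^+ b <= C2 * t ^+ b.
      by rewrite ler_wpM2l // lerXn2r ?nnegrE ?modc_ge0 // ltW.
    have -> : c * s = (C2 + 1) * t ^+ b by rewrite /s /K mulrA [c * _]mulrC divfK // gt_eqF.
    have : 0 < t ^+ b by rewrite exprn_gt0.
    lra.
  have idd : differentiable (fun w : R[i] => w) w by [].
  have td' : differentiable (fun w : R[i] => t%:C * w) w :=
    differentiableM (differentiable_cst t%:C w) idd.
  have gtd : differentiable g (t%:C * w) by apply: gd; lra.
  exact: (differentiableD (@differentiable_comp _ _ _ _ _ g w td' gtd)
    (differentiable_cst (s%:C *: n) w)).
have f0 : f 0 = x + s%:C *: n by rewrite /f mulr0 g0.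
have h2 : modc ((1 / 2 : R)%:C : R[i]) = 1 / 2 by rewrite modc_real ger0_norm //; lra.
have := decay (dl := s) (f := f) (ltac:(by rewrite s0)) fO f0 (w := (1 / 2 : R)%:C) (ltac:(by rewrite h2)).
have -> : f (1 / 2 : R)%:C - f 0 = g (t%:C * (1 / 2 : R)%:C) - x.
  by rewrite f0 /f opprD addrACA subrr addr0.
have tm : modc (t%:C * (1 / 2 : R)%:C) = t / 2.
  by rewrite modcM h2 modc_real gtr0_norm //; lra.
have := glow (t%:C * (1 / 2 : R)%:C); rewrite tm => /(_ (ltac:(lra))) low H.
have -> : C * K * t ^+ b = C * s by rewrite /s mulrA.
apply: le_trans H.
have -> : c1 ^+ m / 2 ^+ (a * m) * t ^+ (a * m) = (c1 * (t / 2) ^+ a) ^+ m.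
  rewrite exprMn -exprM expr_div_n; ring.
apply: lerXn2r low; rewrite nnegrE ?enorm_ge0 // mulr_ge0 ?exprn_ge0 ?ltW //; lra.
Qed.

Lemma contact_order_le g : nonconstant_germ x g ->
  (contact_order r x g <= (m%:R)%:E)%E.
Proof.
move=> [g0 /near_modcP[rho rho0 gd] _].
have {}gd z : modc z < rho -> differentiable g z by move=> /gd; rewrite add0r.
rewrite /contact_order; set h := fun z => _.
have hd z : modc z < rho -> differentiable h z.
  by move=> /gd gz; exact: (differentiableB gz (differentiable_cst x z)).
have [ex|nex] := pselect (exists a, derive1n a h 0 != 0); last first.
  (* If all derivatives of [h] at 0 vanish, the denominator is [+oo] and the quotient is 0 by
     convention. *)
  have -> : holomorphic_order h = +oo%E.
    apply/eqyP => A _; apply: (@le_trans _ _ ((Num.truncn A).+1%:R)%:E).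
      by rewrite lee_fin ltW // truncnS_gt.
    apply: ereal_sup_ubound; exists (Num.truncn A).+1 => // k _.
    by apply: contrapT => /eqP hk; apply: nex; exists k.
  by rewrite invey mule0 lee_fin ler0n.
case: (ex_minnP ex) => a ha amin.
have hv k : (k < a)%N -> derive1n k h 0 = 0.
  by move=> ka; apply: contrapT => /eqP /amin; rewrite leqNgt ka.
have -> : holomorphic_order h = (a%:R)%:E.
  apply/eqP; rewrite eq_le; apply/andP; split.
    apply: ge_ereal_sup => _ [k hk <-]; rewrite lee_fin ler_nat leqNgt.
    by apply/negP => /hk h0; rewrite h0 eqxx in ha.
  by apply: ereal_sup_ubound; exists a.
have a0 : a != 0%N.
  apply: contraNneq ha => ->; rewrite /h /= g0 subrr; exact: eqxx.
have [c1 [e1 [c10 e10 low]]] := vector_zero_order rho0 hd hv ha.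
rewrite inver pnatr_eq0 (negbTE a0) lee_pdivrMr ?ltr0n ?lt0n //.
rewrite -EFinM -natrM; apply: ge_ereal_sup => _ [b hb <-]; rewrite lee_fin ler_nat mulnC.
apply: (contact_bound rho0 g0 gd c10 e10 low) => vs vb; exact: (hb _ vb).
Qed.

End Contact.

Theorem theorem2p25 (R : realType) (d : nat) (Omega : set 'rV[R[i]]_d)
  (domOmega : is_domain Omega)
  (bndOmega : bounded_set Omega)
  (cvxOmega : convex_set Omega)
  (smoothOmega : smooth_boundary Omega)
  (o x n : 'rV[R[i]]_d) (M T : R)
  (Omega_o : Omega o)
  (bd_x : boundary Omega x)
  (normal_n : inward_unit_normal Omega x n)
  (M_ge0 : 0 <= M)
  (orbit_n : [set x + (expR (- (2 * t)))%:C *: n | t in [set t : R | T < t]]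
     `<=` Aut_orbit Omega
            [set p | Omega p /\ (kobayashi_dist Omega p o <= M%:E)%E]) :
  finite_type Omega x.

Proof.
have [oO _ _] := domOmega.
have op := open_enormP oO.
have cv := @convex_enorm _ _ _ cvxOmega.
have [Dm Dm0 diamO] := bounded_enorm bndOmega.
have xb : bdry Omega x by apply/(boundary_bdry oO).
have [nu [r0 [r00 nuP]]] := inner_balls oO cvxOmega bndOmega smoothOmega.
have nu1 y : bdry Omega y -> euclidean_norm (nu y) = 1 by move=> /nuP[].
have nu_supp y (z : 'rV[R[i]]_d) : bdry Omega y -> Omega z ->
  0 < complex.Re (hip (z - y) (nu y)) by move=> /nuP[_ + _]; exact.
have nu_ball y : bdry Omega y -> in_ball Omega (y + r0%:C *: nu y) r0 by move=> /nuP[].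
(* Finite type quantifies over all defining functions, while [n] comes from one of them; uniqueness
   of the normal identifies their normalized gradients with [nu x]. *)
have normalE r : defining_function Omega x r ->
    nu x = - ((euclidean_norm (gradient r x))^-1%:C *: gradient r x).
  move=> rx; have [s s0 ns] := defining_normal_at oO cvxOmega xb rx.
  exact: normal_at_unique r00 (nuP x xb) ns.
have nE : n = nu x by case: normal_n => r rx ->; rewrite -normalE.
have [c0 [ds [c00 ds0 orb]]] := orbit_balls oO nu1 nu_supp Omega_o orbit_n.
have [|m [C [z1 [_ z10 decay]]]] := disc_decay op cv Dm0 diamO r00 nu1 nu_supp nu_ball
    xb c00 ds0.
  move=> dl /orb[phi [psi [h1 h2 h3 h4]]]; exists phi, psi; split=> //.
  by rewrite /bipoint scale0r addr0 -nE.
move=> r rx; apply: (@le_lt_trans _ _ (m%:R)%:E); last exact: ltry.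
apply: ge_ereal_sup => _ [g gg <-].
have nG := normalE r rx.
have [U [[oU Ux] rU rO rG]] := rx.
rewrite nG in decay.
exact: (contact_order_le oU Ux rU rO (rG x Ux) z10 decay gg).
Qed.
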